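(* Let $A$ be a $C_0(X)$-algebra with base map $\phi$. Consider the following two properties. (i) $H_x$ is strictly closed in $M(A)$ for all $x\in X_\phi$. (ii) For all $x\in X_\phi$, $J_x$ is locally modular and $\phi$ is locally closed at $x$. Then (ii) implies (i), and (i) and (ii) are equivalent if $A$ is $\sigma$-unital.
   Context: For a C$^*$-algebra $A$, $\mathrm{Prim}(A)$ is the primitive ideal space with the hull-kernel topology and $M(A)$ is the multiplier algebra. $A$ is a $C_0(X)$-algebra with base map $\phi$ if $X$ is a locally compact Hausdorff space and $\phi:\mathrm{Prim}(A)\to X$ is continuous; $X_\phi$ denotes the image of $\phi$ with the subspace topology. For a closed two-sided ideal $J$ of $A$, $\tilde J=\{b\in M(A): ba,ab\in J \text{ for all } a\in A\}$. If $P\in\mathrm{Prim}(A)$ then $\tilde P\in\mathrm{Prim}(M(A))$, and $P\mapsto\tilde P$ is a homeomorphism onto a dense open subset of $\mathrm{Prim}(M(A))$. The map $\phi$ has a unique extension to a continuous map $\overline\phi:\mathrm{Prim}(M(A))\to\beta X$ (the Stone-Čech compactification) with $\overline\phi(\tilde P)=\phi(P)$ for all $P\in\mathrm{Prim}(A)$. For $x\in X_\phi$ put $J_x=\bigcap\{P\in\mathrm{Prim}(A):\phi(P)=x\}$ and $H_x=\bigcap\{Q\in\mathrm{Prim}(M(A)):\overline\phi(Q)=x\}$. ''Strictly closed'' means closed in the strict topology of $M(A)$. For $x\in X_\phi$ let $H(x)=\phi^{-1}(x)\subseteq\mathrm{Prim}(A)$, with boundary $\partial H(x)$ and interior $U(x)$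 in $\mathrm{Prim}(A)$. $J_x$ is locally modular if for each $P\in\partial H(x)$ there is a relatively open neighbourhood $V$ of $P$ in $\mathrm{Prim}(A)\setminus U(x)$ such that $A/\ker V$ is unital, where $\ker V=\bigcap_{Q\in V}Q$. The map $\phi$ is locally closed at $x$ if whenever $Y$ is a closed subset of $\mathrm{Prim}(A)$ such that $x$ lies in the closure of $\phi(Y)$, then $x\in\phi(Y)$. *)

(* Defs.v *)
From HB Require Import structures.
From mathcomp Require Import all_boot all_order all_algebra.
From mathcomp Require Import all_classical all_reals all_analysis.
From mathcomp Require Import complex.

Set Implicit Arguments.
Unset Strict Implicit.
Unset Printing Implicit Defensive.

Import Order.TTheory GRing.Theory Num.Theory.
Import numFieldNormedType.Exports.
Local Open Scope classical_set_scope.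
Local Open Scope ring_scope.

(** * Complex *-algebras, C*-algebras, Hilbert spaces

    MathComp's rings are unital, so the product of a possibly non-unital
    algebra is the operation [amul], written [x ** y], on a left module. *)

HB.mixin Record Lmodule_isStarAlgebra (R : realType) A
    & GRing.Lmodule R[i] A := {
  amul : A -> A -> A;
  star : A -> A;
  amulA : forall x y z, amul x (amul y z) = amul (amul x y) z;
  amulDl : forall x y z, amul (x + y) z = amul x z + amul y z;
  amulDr : forall x y z, amul x (y + z) = amul x y + amul x z;
  amulZl : forall (k : R[i]) x y, amul (k *: x) y = k *: amul x y;
  amulZr : forall (k : R[i]) x y, amul x (k *: y) = k *: amul x y;
  starK : forall x, star (star x) = x;
  starD : forall x y, star (x + y) = star x + star y;
  starZ : forall (k : R[i]) x, star (k *: x) = (Num.conj k) *: star x;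
  starM : forall x y, star (amul x y) = amul (star y) (star x);
}.

#[short(type="starAlgType")]
HB.structure Definition StarAlgebra (R : realType) :=
  {A of GRing.Lmodule R[i] A & Lmodule_isStarAlgebra R A}.

Notation "x ** y" := (amul x y) (at level 40, left associativity) : ring_scope.

HB.mixin Record StarAlgebra_isCStar (R : realType) A
    & CompleteNormedModule R[i] A & StarAlgebra R A := {
  norm_amul : forall x y : A, `|x ** y| <= `|x| * `|y|;
  norm_star_amul : forall x : A, `|star x ** x| = `|x| ^+ 2;
}.

#[short(type="cstarAlgType")]
HB.structure Definition CStarAlgebra (R : realType) :=
  {A of CompleteNormedModule R[i] A & StarAlgebra R A
      & StarAlgebra_isCStar R A}.

HB.mixin Record NormedModule_isHilbert (R : realType) H
    & CompleteNormedModule R[i] H := {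
  inner : H -> H -> R[i];
  innerDZl : forall (k : R[i]) (x y z : H),
    inner (k *: x + y) z = k * inner x z + inner y z;
  innerC : forall x y : H, inner y x = Num.conj (inner x y);
  inner_norm : forall x : H, inner x x = `|x| ^+ 2;
}.

#[short(type="hilbertType")]
HB.structure Definition Hilbert (R : realType) :=
  {H of CompleteNormedModule R[i] H & NormedModule_isHilbert R H}.

(** * Representations and the primitive ideal space *)

Record star_representation (R : realType) (B : starAlgType R)
    (H : hilbertType R) (pi : B -> H -> H) : Prop := {
  rep_continuous : forall b, continuous (pi b);
  rep_linear : forall b (k : R[i]) x y, pi b (k *: x + y) = k *: pi b x + pi b y;
  repDZ : forall (k : R[i]) b c x, pi (k *: b + c) x = k *: pi b x + pi c x;
  repM : forall b c x, pi (b ** c) x = pi b (pi c x);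
  rep_star : forall b x y, inner (pi (star b) x) y = inner x (pi b y);
}.

Record closed_subspace (R : realType) (H : hilbertType R) (K : set H) : Prop := {
  cs_closed : closed K;
  cs0 : K 0;
  csDZ : forall (k : R[i]) x y, K x -> K y -> K (k *: x + y);
}.

(* The first clause excludes the zero representation on a line, whose kernel
   would otherwise make the whole algebra a primitive ideal. *)
Definition irreducible_rep (R : realType) (B : starAlgType R)
    (H : hilbertType R) (pi : B -> H -> H) : Prop :=
  (exists b x, pi b x != 0) /\
  forall K : set H, closed_subspace K -> (forall b x, K x -> K (pi b x)) ->
    K = [set 0] \/ K = setT.

Definition primitive (R : realType) (B : starAlgType R) (P : set B) : Prop :=
  exists (H : hilbertType R) (pi : B -> H -> H),
    [/\ star_representation pi, irreducible_rep pi &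
        P = [set b | forall x, pi b x = 0]].

Record prim (R : realType) (B : starAlgType R) := Prim {
  prim_ideal :> set B;
  prim_primitive : primitive prim_ideal
}.

HB.instance Definition _ (R : realType) (B : starAlgType R) :=
  gen_eqMixin (prim B).
HB.instance Definition _ (R : realType) (B : starAlgType R) :=
  gen_choiceMixin (prim B).

Lemma closed_subspace_closure (R : realType) (H : hilbertType R) (S : set H) :
  S 0 -> (forall (k : R[i]) x y, S x -> S y -> S (k *: x + y)) ->
  closed_subspace (closure S).
Proof.
move=> S0 SDZ; split; [exact: closed_closure|exact: subset_closure|].
move=> k x y Sx Sy U Uxy.
have kx : (fun p : H * H => k *: p.1 + p.2) @ (x, y) --> k *: x + y.
  by apply: cvgD; [apply: cvgZl_tmp; exact: cvg_fst|exact: cvg_snd].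
have [[V W] [Vx Wy] VWU] := kx _ Uxy.
have [s [Ss Vs]] := Sx _ Vx; have [t [St Wt]] := Sy _ Wy.
by exists (k *: s + t); split; [exact: SDZ|exact: (VWU (s, t))].
Qed.

Lemma closed_set0 (R : realType) (H : hilbertType R) : closed [set (0 : H)].
Proof. exact/accessible_closed_set1/hausdorff_accessible/norm_hausdorff. Qed.

Lemma primitive_prime (R : realType) (B : starAlgType R) (P : set B) (s t : B) :
  primitive P -> (forall x, P (s ** x ** t)) -> P s \/ P t.
Proof.
move=> [H [pi [repi [[b0 [x0 nz0]] irr] ->]]] /= sxt.
have pi0 b : pi b 0 = 0.
  by have := rep_linear repi b (-1) 0 0; rewrite scaler0 addr0 scaleN1r addNr.
have pi0l x : pi 0 x = 0.
  by have := repDZ repi (-1) 0 0 x; rewrite scaler0 addr0 scaleN1r addNr.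
have [|/existsNP[xi /eqP eta0]] := pselect (forall x, pi t x = 0); first by right.
set eta := pi t xi in eta0; left.
have clpre (f : H -> H) : continuous f -> closed [set x | f x = 0].
  move=> cf; have := @preimage_closed _ _ f [set 0].
  by apply => //; [exact: closed_set0].
pose K := closure (range (pi ^~ eta)).
have csK : closed_subspace K.
  apply: closed_subspace_closure; first by exists 0.
  by move=> k _ _ [b _ <-] [c _ <-]; exists (k *: b + c) => //; rewrite repDZ.
have invK b x : K x -> K (pi b x).
  move=> Kx U /(rep_continuous repi) /Kx[_ [[c _ <-] Uc]].
  by exists (pi b (pi c eta)); split => //; exists (b ** c); rewrite // repM.
have [K0|KT] := irr K csK invK; last first.
  move=> x; suff : K `<=` [set x | pi s x = 0] by rewrite KT; exact.
  rewrite (closure_id [set x | pi s x = 0]).1; last exact/clpre/rep_continuous.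
  by apply: closureS => _ [b _ <-] /=; rewrite -!repM.
pose N := [set e | forall x, pi x e = 0].
have csN : closed_subspace N.
  split; [|by move=> x; exact: pi0|].
    rewrite (_ : N = \bigcap_(b in setT) [set e | pi b e = 0]).
      by apply: closed_bigI => b _; exact/clpre/rep_continuous.
    by apply/seteqP; split=> [e Ne b _|e Ne b]; [exact: Ne|exact: (Ne b)].
  by move=> k x y Nx Ny b; rewrite rep_linear// Nx Ny scaler0 addr0.
have invN b x : N x -> N (pi b x) by move=> Nx c; rewrite Nx pi0.
have Neta : N eta.
  move=> x; suff : K (pi x eta) by rewrite K0.
  by apply: subset_closure; exists x.
have [N0|NT] := irr N csN invN.
  by move: Neta eta0; rewrite N0 /= => ->; rewrite eqxx.
have Nx0 : N x0 by rewrite NT.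
by move: nz0; rewrite Nx0 eqxx.
Qed.

(* The hull-kernel topology: the closed sets are the hulls
   [{P | S `<=` P}]. *)
Definition hk_open (R : realType) (B : starAlgType R) (U : set (prim B)) : Prop :=
  exists S : set B, U = [set P : prim B | ~ (S `<=` P)].

Section hull_kernel.
Context {R : realType} {B : starAlgType R}.

Lemma hk_openT : hk_open [set: prim B].
Proof.
exists setT; apply/seteqP; split=> // P _ /= TP.
have [H [pi [_ [[b [x nz]] _] EP]]] := prim_primitive P.
have : (P : set B) b by exact: TP.
by rewrite EP /= => /(_ x) /eqP; rewrite (negbTE nz).
Qed.

Lemma hk_openI : setI_closed (@hk_open R B).
Proof.
move=> _ _ [S ->] [T ->].
exists [set b | exists s x t, [/\ S s, T t & b = s ** x ** t]].
apply/seteqP; split=> P /= => [[nSP nTP] STP|nST].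
  have [s [Ss nPs]] : exists s, S s /\ ~ (P : set B) s.
    by apply: contrapT => nex; apply: nSP => s Ss; apply: contrapT => nPs;
      apply: nex; exists s.
  have [t [Tt nPt]] : exists t, T t /\ ~ (P : set B) t.
    by apply: contrapT => nex; apply: nTP => t Tt; apply: contrapT => nPt;
      apply: nex; exists t.
  have := @primitive_prime _ _ P s t (prim_primitive P).
  by case=> // x; apply: STP; exists s, x, t.
have [H [pi [repi _ EP]]] := prim_primitive P.
have pi0 b : pi b 0 = 0.
  by have := rep_linear repi b (-1) 0 0; rewrite scaler0 addr0 scaleN1r addNr.
split=> sub; apply: nST => _ [s [x [t [Ss Tt ->]]]]; rewrite EP => y /=;
  rewrite !(repM repi).
  by have := sub _ Ss; rewrite EP; exact.
by have := sub _ Tt; rewrite EP /= => ->; rewrite !pi0.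
Qed.

Lemma hk_open_bigU (I : Type) (f : I -> set (prim B)) :
  (forall i, hk_open (f i)) -> hk_open (\bigcup_i f i).
Proof.
move=> of_.
exists [set b | exists i (S : set B), f i = [set P : prim B | ~ (S `<=` P)] /\ S b].
apply/seteqP; split=> P /= => [[i _ fiP] sub|nsub].
  have [S fiE] := of_ i; move: (fiP); rewrite fiE; apply => b Sb.
  by apply: sub; exists i, S.
apply: contrapT => nP; apply: nsub => b [i [S [fiE Sb]]].
apply: contrapT => nPb; apply: nP; exists i => //; rewrite fiE /= => SP.
by apply: nPb; exact: SP.
Qed.

HB.instance Definition _ :=
  isOpenTopological.Build (prim B) hk_openT hk_openI hk_open_bigU.

Definition kernel (V : set (prim B)) : set B :=
  \bigcap_(P in V) (P : set B).

End hull_kernel.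

(** * The multiplier algebra

    [M(A)] is realised as Busby's algebra of double centralizers: pairs
    [(L, R)] of maps with [a ** L b = R a ** b].  In a C*-algebra such maps
    are automatically linear and bounded.  An element [m = (L, R)] acts on the
    ideal [A] of [M(A)] by [m a = L a] and [a m = R a]. *)

Section multiplier.
Context {R : realType} {A : cstarAlgType R}.
Implicit Types (a b c x y : A) (p q : (A -> A) * (A -> A)).

Definition double_centralizer p : Prop :=
  forall a b, a ** p.1 b = p.2 a ** b.

Lemma amul0l x : 0 ** x = 0 :> A.
Proof. by have := amulZl 0 (0 : A) x; rewrite !scale0r. Qed.

Lemma amul0r x : x ** 0 = 0 :> A.
Proof. by have := amulZr 0 x (0 : A); rewrite !scale0r. Qed.

Lemma amulNl x y : (- x) ** y = - (x ** y).
Proof. by rewrite -scaleN1r amulZl scaleN1r. Qed.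

Lemma amulNr x y : x ** (- y) = - (x ** y).
Proof. by rewrite -scaleN1r amulZr scaleN1r. Qed.

Lemma star_amul_eq0 x : star x ** x = 0 -> x = 0.
Proof.
move=> xx0; have := norm_star_amul x; rewrite xx0 normr0 => /esym/eqP.
by rewrite expf_eq0/= normr_eq0 => /eqP.
Qed.

Lemma amul_inj_l x y : (forall c, c ** x = c ** y) -> x = y.
Proof.
move=> xy; apply/eqP; rewrite -subr_eq0; apply/eqP/star_amul_eq0.
by rewrite amulDr amulNr xy subrr.
Qed.

Lemma amul_inj_r x y : (forall c, x ** c = y ** c) -> x = y.
Proof.
move=> xy; rewrite -[x]starK -[y]starK; congr star.
by apply: amul_inj_l => c; rewrite -[c]starK -!starM xy.
Qed.

Lemma dc_linear_l p : double_centralizer p ->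
  forall (k : R[i]) x y, p.1 (k *: x + y) = k *: p.1 x + p.1 y.
Proof.
move=> dp k x y; apply: amul_inj_l => c.
by rewrite dp !amulDr !amulZr !dp.
Qed.

Lemma dc_linear_r p : double_centralizer p ->
  forall (k : R[i]) x y, p.2 (k *: x + y) = k *: p.2 x + p.2 y.
Proof.
move=> dp k x y; apply: amul_inj_r => c.
by rewrite -dp !amulDl !amulZl !dp.
Qed.

Definition dc_pred : {pred (A -> A) * (A -> A)} :=
  fun p => `[< double_centralizer p >].

Lemma dc_submod_closed : submod_closed dc_pred.
Proof.
split; first by apply/asboolP => a b /=; rewrite amul0l amul0r.
move=> k p q /asboolP dp /asboolP dq; apply/asboolP => a b /=.
by rewrite !fctE amulDr amulDl amulZr amulZl dp dq.
Qed.

HB.instance Definition _ := GRing.isSubmodClosed.Build _ _ dc_pred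
  dc_submod_closed.

End multiplier.

Record multiplier (R : realType) (A : cstarAlgType R) := Multiplier {
  centralizers :> (A -> A) * (A -> A);
  centralizersP : centralizers \in dc_pred
}.

HB.instance Definition _ (R : realType) (A : cstarAlgType R) :=
  [isSub for @centralizers R A].
HB.instance Definition _ (R : realType) (A : cstarAlgType R) :=
  [Choice of multiplier A by <:].
HB.instance Definition _ (R : realType) (A : cstarAlgType R) :=
  [SubChoice_isSubLmodule of multiplier A by <:].

Section multiplier_star_algebra.
Context {R : realType} {A : cstarAlgType R}.
Implicit Types (m n : multiplier A) (a b : A).

Definition mul_l m a : A := (centralizers m).1 a.
Definition mul_r a m : A := (centralizers m).2 a.

Lemma multiplierP m a b : a ** mul_l m b = mul_r a m ** b.
Proof. by have /asboolP := centralizersP m; exact. Qed.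

Lemma multiplier_eq m n : (forall a, mul_l m a = mul_l n a) -> m = n.
Proof.
move=> mn; apply/val_inj => /=; rewrite [LHS]surjective_pairing [RHS]surjective_pairing.
congr pair; apply/funext => a; first exact: mn.
by apply: amul_inj_r => b; rewrite -!multiplierP mn.
Qed.

Lemma dc_mul_subproof m n :
  (mul_l m \o mul_l n, fun a => mul_r (mul_r a m) n) \in dc_pred.
Proof. by apply/asboolP => a b /=; rewrite !multiplierP. Qed.

Definition multiplier_mul m n := Multiplier (dc_mul_subproof m n).

Lemma dc_star_subproof m :
  (fun a => star (mul_r (star a) m), fun a => star (mul_l m (star a)))
    \in dc_pred.
Proof.
apply/asboolP => a b /=.
by rewrite -[a in LHS]starK -starM -multiplierP starM starK.
Qed.

Definition multiplier_star m := Multiplier (dc_star_subproof m).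

Lemma mul_lDZ m (k : R[i]) a b : mul_l m (k *: a + b) = k *: mul_l m a + mul_l m b.
Proof. by apply: dc_linear_l; apply/asboolP/centralizersP. Qed.

Lemma mul_rDZ m (k : R[i]) a b : mul_r (k *: a + b) m = k *: mul_r a m + mul_r b m.
Proof. by apply: dc_linear_r; apply/asboolP/centralizersP. Qed.

Fact multiplier_mulA m n p : multiplier_mul m (multiplier_mul n p) =
  multiplier_mul (multiplier_mul m n) p.
Proof. exact/multiplier_eq. Qed.

Fact multiplier_mulDl m n p : multiplier_mul (m + n) p =
  multiplier_mul m p + multiplier_mul n p.
Proof. exact/multiplier_eq. Qed.

Fact multiplier_mulDr m n p : multiplier_mul m (n + p) =
  multiplier_mul m n + multiplier_mul m p.
Proof.
apply: multiplier_eq => a; have := mul_lDZ m 1 (mul_l n a) (mul_l p a).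
by rewrite !scale1r.
Qed.

Fact multiplier_mulZl (k : R[i]) m n :
  multiplier_mul (k *: m) n = k *: multiplier_mul m n.
Proof. exact/multiplier_eq. Qed.

Fact multiplier_mulZr (k : R[i]) m n :
  multiplier_mul m (k *: n) = k *: multiplier_mul m n.
Proof.
have ml0 : mul_l m 0 = 0.
  by have := mul_lDZ m (-1) 0 0; rewrite scaler0 addr0 scaleN1r addNr.
apply: multiplier_eq => a; have := mul_lDZ m k (mul_l n a) 0.
by rewrite !addr0 ml0 addr0.
Qed.

Fact multiplier_starK m : multiplier_star (multiplier_star m) = m.
Proof. by apply: multiplier_eq => a; rewrite /mul_l/= /mul_r/= !starK. Qed.

Fact multiplier_starD m n :
  multiplier_star (m + n) = multiplier_star m + multiplier_star n.
Proof. by apply: multiplier_eq => a; exact: starD. Qed.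

Fact multiplier_starZ (k : R[i]) m :
  multiplier_star (k *: m) = Num.conj k *: multiplier_star m.
Proof. by apply: multiplier_eq => a; exact: starZ. Qed.

Fact multiplier_starM m n : multiplier_star (multiplier_mul m n) =
  multiplier_mul (multiplier_star n) (multiplier_star m).
Proof. by apply: multiplier_eq => a; rewrite /mul_l/= /mul_l/= /mul_r/= starK. Qed.

HB.instance Definition _ := Lmodule_isStarAlgebra.Build R (multiplier A)
  multiplier_mulA multiplier_mulDl multiplier_mulDr multiplier_mulZl
  multiplier_mulZr multiplier_starK multiplier_starD multiplier_starZ
  multiplier_starM.

(* The strict topology is the coarsest topology making [m |-> m a] and
   [m |-> a m] continuous into the norm topology for every [a : A]. *)
Definition strict_maps m : {ptws A -> (A * A)%type} := fun a => (mul_l m a, mul_r a m).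

Definition strictly_closed (S : set (multiplier A)) : Prop :=
  @closed (initial_topology strict_maps) S.

Definition tilde (J : set A) : set (multiplier A) :=
  [set m | forall a, J (mul_l m a) /\ J (mul_r a m)].

End multiplier_star_algebra.

(** * sigma-unital algebras and unital quotients *)

Section sigma_unital.
Context {R : realType} {A : cstarAlgType R}.

Definition positive (a : A) : Prop := exists b : A, a = star b ** b.

(* A countable approximate unit: an increasing sequence of positive
   contractions. *)
Definition sigma_unital : Prop := exists u : nat -> A,
  [/\ forall n, positive (u n) /\ `|u n| <= 1,
      forall n, positive (u n.+1 - u n),
      forall a, (u n ** a) @[n --> \oo] --> a &
      forall a, (a ** u n) @[n --> \oo] --> a].

(* The quotient of [A] by the ideal [I] has a unit, the class of [e]. *)
Definition unital_quotient (I : set A) : Prop :=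
  exists e : A, forall a, I (e ** a - a) /\ I (a ** e - a).

End sigma_unital.

Arguments sigma_unital {R} A.

(** * The Stone-Cech compactification

    The closure of the image of [X] in the cube of all continuous functions
    from [X] to the unit interval. *)

Section stone_cech.
Context {R : realType} {X : topologicalType}.

Definition unit_fun : Type :=
  {f : X -> R | continuous f /\ forall x, 0 <= f x <= 1}.

HB.instance Definition _ := gen_eqMixin unit_fun.
HB.instance Definition _ := gen_choiceMixin unit_fun.

Definition stone_cech_eval (x : X) : {ptws unit_fun -> R} := fun f => sval f x.

Definition stone_cech : Type := set_type (closure (range stone_cech_eval)).

HB.instance Definition _ := Topological.on stone_cech.

Lemma stone_cech_eval_closure (x : X) :
  stone_cech_eval x \in closure (range stone_cech_eval).
Proof. by apply/mem_set/subset_closure; exists x. Qed.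

Definition to_stone_cech (x : X) : stone_cech :=
  exist _ (stone_cech_eval x) (stone_cech_eval_closure x).

End stone_cech.

Arguments stone_cech R X : clear implicits.
Arguments to_stone_cech R {X} x.

(** * C_0(X)-algebras *)

Section C0X_algebra.
Context {R : realType} {A : cstarAlgType R} {X : topologicalType}.
Variable phi : prim A -> X.

Definition C0X_algebra : Prop :=
  [/\ hausdorff_space X, locally_compact [set: X] & continuous phi].

(* [phibar] is the extension of [phi] along the embedding of [prim A] in
   [prim (multiplier A)] sending [P] to [tilde P]. *)
Definition multiplier_extension
    (phibar : prim (multiplier A) -> stone_cech R X) : Prop :=
  continuous phibar /\
  forall (P : prim A) (Q : prim (multiplier A)),
    (Q : set (multiplier A)) = tilde P -> phibar Q = to_stone_cech R (phi P).

Definition H_ (phibar : prim (multiplier A) -> stone_cech R X) (x : X) :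
    set (multiplier A) :=
  kernel (phibar @^-1` [set to_stone_cech R x]).

(* Local modularity of [kernel (phi @^-1` [set x])]: [closure Hx `\` U] is the
   boundary of the fibre [Hx], and a relatively open set of the complement of
   [U] is [W `\` U] with [W] open. *)
Definition locally_modular (x : X) : Prop :=
  let Hx := phi @^-1` [set x] in let U := Hx° in
  forall P, (closure Hx `\` U) P ->
    exists W : set (prim A), [/\ open W, (W `\` U) P &
      unital_quotient (kernel (W `\` U))].

Definition locally_closed_at (x : X) : Prop :=
  forall Y : set (prim A), closed Y ->
    closure (phi @` Y) x -> (phi @` Y) x.

End C0X_algebra.

(* Main.v *)
(** Let [T x] be the strictly closed ideal of multipliers in [tilde P] for every
    [P] over [x]; it contains [H_ x], and (i) says that [H_ x = T x] when [A] is
    sigma-unital, because [m u_n] lies in [H_ x] for [m] in [T x].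

    The main tool is a limit argument: if [x] is in the closure of [phi S] and [b]
    keeps distance [eps] from [tilde P] for all [P] in [S], then the ideals
    [bigcap {tilde P | P in S, phi P in N}], for [N] a neighbourhood of [x],
    generate a closed ideal that misses [b], so some primitive [Q] over [x] does
    not contain [b].

    (ii) implies (i): if [m] in [T x] is not in [Q] over [x], let [S] consist of
    the [P] at which [m* m] is larger than some [eps]. By local closedness [S]
    has an adherent point over [x], on the boundary of the fibre, and by local
    modularity [m] coincides near this point with an element of [A]. The limit
    argument yields a primitive ideal over [x] without this element; it comes
    from some [P] over [x], which is absurd.

    (i) implies (ii): given neighbourhoods [N_k] of [x] and an approximate unit
    [u_k], there is [m] in [T x] with [m + 1/4 >= 1 - u_k] at all [P] with
    [phi P] outside [N_k]. If (ii) failed at [x], this [m], built for suitable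
    [N_k], would keep a distance from [tilde P] along a set of [P] accumulating
    over [x] (over a nearby point, for modularity), against the limit argument
    and (i). *)

From HB Require Import structures.
From mathcomp Require Import all_boot all_order all_algebra.
From mathcomp Require Import all_classical all_reals all_analysis.
From mathcomp Require Import complex ring lra zify.
Require Import Defs.

Set Implicit Arguments.
Unset Strict Implicit.
Unset Printing Implicit Defensive.

Import Order.TTheory GRing.Theory Num.Theory.
Import numFieldNormedType.Exports.
Local Open Scope classical_set_scope.
Local Open Scope ring_scope.

(** The delicate primitive ideals of [multiplier A] are those containing the image of [A]: they come
    from no point of [prim A] and are reached only as limits. Every other one is [tilde P] for some
    [P], so membership of an element of [A] in the ideals over [x] is decided on the fibre alone;
    this is why multipliers are replaced by elements of [A] wherever possible. The constants fit
    together as follows. The errors made in building [m] sum to 1/4. If moreover [m] is within 1/4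
    of [tilde P], then [m + 1/4 >= 1 - u_k] gives [u_k >= 1 - 1/4 - 1/4 = 1/2] at [P], and 1/2 is
    the threshold at which [2 u_k - 1] is positive and can be turned into a unit of a quotient.
    Neither spectra nor quotient algebras are formed. Positivity is expressed by norm balls, roots
    come from an iteration, and quotients appear as positivity or distance modulo an ideal.
    Primitive ideals are produced as kernels of the representations of extreme functionals. *)

Local Notation "x %:C" := (real_complex _ x) : ring_scope.

(** * Deciding identities in non-commutative algebras *)

(* A term is expanded into a combination of words over its atoms; two terms are
   equal as soon as the coefficients of every word agree, and these scalar
   goals are left to [ring].  With the zero product, this decides linear
   identities in a module. *)

Inductive ncterm (C : Type) :=
| NC0
| NCvar of nat
| NCadd of ncterm C & ncterm C
| NCopp of ncterm C
| NCscale of C & ncterm C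
| NCmul of ncterm C & ncterm C.
Arguments NC0 {C}.
Arguments NCvar {C}.

Section nc.
Variables (K : comNzRingType) (V : lmodType K) (mul : V -> V -> V).
Hypotheses (mulA : forall x y z, mul x (mul y z) = mul (mul x y) z)
  (mulDl : forall x y z, mul (x + y) z = mul x z + mul y z)
  (mulDr : forall x y z, mul x (y + z) = mul x y + mul x z)
  (mulZl : forall k x y, mul (k *: x) y = k *: mul x y)
  (mulZr : forall k x y, mul x (k *: y) = k *: mul x y).

Fixpoint nc_nth (l : list V) n : V :=
  match l, n with
  | x :: _, O => x
  | _ :: l, S n => nc_nth l n
  | nil, _ => 0
  end.

Fixpoint nc_eval (env : list V) (t : ncterm K) : V :=
  match t with
  | NC0 => 0
  | NCvar n => nc_nth env n
  | NCadd a b => nc_eval env a + nc_eval env b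
  | NCopp a => - nc_eval env a
  | NCscale k a => k *: nc_eval env a
  | NCmul a b => mul (nc_eval env a) (nc_eval env b)
  end.

Fixpoint nc_foldl (env : list V) x (w : list nat) : V :=
  match w with
  | nil => x
  | n :: w => nc_foldl env (mul x (nc_nth env n)) w
  end.

Definition nc_word (env : list V) (w : nat * list nat) : V :=
  nc_foldl env (nc_nth env w.1) w.2.

Fixpoint nc_sum env (l : list (K * (nat * list nat))) : V :=
  match l with
  | nil => 0
  | (k, w) :: l => k *: nc_word env w + nc_sum env l
  end.

(** Concatenation and the equality tests are private copies, so that [nc_reduce] can unfold exactly
    these names and leave the scalar coefficients intact for [ring]. *)
Fixpoint nc_app {T : Type} (l l' : list T) : list T :=
  match l with nil => l' | x :: l => x :: nc_app l l' end.

Fixpoint nc_scale (k : K) (l : list (K * (nat * list nat))) :=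
  match l with
  | nil => nil
  | (c, w) :: l => (k * c, w) :: nc_scale k l
  end.

Definition nc_catw (v w : nat * list nat) :=
  let (a, s) := v in let (b, t) := w in (a, nc_app s (b :: t)).

Fixpoint nc_mulw (k : K) v (l : list (K * (nat * list nat))) :=
  match l with
  | nil => nil
  | (c, w) :: l => (k * c, nc_catw v w) :: nc_mulw k v l
  end.

Fixpoint nc_mul l (l' : list (K * (nat * list nat))) :=
  match l with
  | nil => nil
  | (c, w) :: l => nc_app (nc_mulw c w l') (nc_mul l l')
  end.

Fixpoint nc_nf (t : ncterm K) : list (K * (nat * list nat)) :=
  match t with
  | NC0 => nil
  | NCvar n => (1, (n, nil)) :: nil
  | NCadd a b => nc_app (nc_nf a) (nc_nf b)
  | NCopp a => nc_scale (-1) (nc_nf a)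
  | NCscale k a => nc_scale k (nc_nf a)
  | NCmul a b => nc_mul (nc_nf a) (nc_nf b)
  end.

Fixpoint nc_eqn (m n : nat) : bool :=
  match m, n with
  | O, O => true
  | S m, S n => nc_eqn m n
  | _, _ => false
  end.

Fixpoint nc_eqs (s t : list nat) : bool :=
  match s, t with
  | nil, nil => true
  | a :: s, b :: t => if nc_eqn a b then nc_eqs s t else false
  | _, _ => false
  end.

Definition nc_eqw (v w : nat * list nat) : bool :=
  let (a, s) := v in let (b, t) := w in
  if nc_eqn a b then nc_eqs s t else false.

Fixpoint nc_insert (k : K) w (l : list (K * (nat * list nat))) :=
  match l with
  | nil => (k, w) :: nil
  | (c, v) :: l => if nc_eqw v w then (c + k, v) :: l else (c, v) :: nc_insert k w l
  end.

Fixpoint nc_collect (l : list (K * (nat * list nat))) :=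
  match l with
  | nil => nil
  | (k, w) :: l => nc_insert k w (nc_collect l)
  end.

Fixpoint nc_zero (l : list (K * (nat * list nat))) : Prop :=
  match l with
  | nil => True
  | (k, w) :: l => k = 0 /\ nc_zero l
  end.

Lemma nc_sum_app env l l' :
  nc_sum env (nc_app l l') = nc_sum env l + nc_sum env l'.
Proof. by elim: l => [|[k w] l IH] /=; rewrite ?add0r// IH addrA. Qed.

Lemma nc_sum_scale env k l : nc_sum env (nc_scale k l) = k *: nc_sum env l.
Proof.
by elim: l => [|[c w] l IH] /=; rewrite ?scaler0// IH scalerDr scalerA.
Qed.

Lemma nc_foldl_mul env x y w : nc_foldl env (mul x y) w = mul x (nc_foldl env y w).
Proof. by elim: w y => [//|n w IH] y /=; rewrite -IH -mulA. Qed.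

Lemma nc_word_cat env v w :
  nc_word env (nc_catw v w) = mul (nc_word env v) (nc_word env w).
Proof.
case: v w => [a s] [b t]; rewrite /nc_word /=.
by elim: s (nc_nth env a) => [|n s IH] x /=; rewrite ?nc_foldl_mul ?IH.
Qed.

Let mul0l x : mul 0 x = 0.
Proof. by have := mulZl 0 0 x; rewrite !scale0r. Qed.

Let mul0r x : mul x 0 = 0.
Proof. by have := mulZr 0 x 0; rewrite !scale0r. Qed.

Lemma nc_sum_mulw env k w l :
  nc_sum env (nc_mulw k w l) = k *: mul (nc_word env w) (nc_sum env l).
Proof.
elim: l => [|[c v] l IH] /=; first by rewrite mul0r scaler0.
by rewrite IH nc_word_cat mulDr mulZr scalerDr scalerA.
Qed.

Lemma nc_sum_mul env l l' :
  nc_sum env (nc_mul l l') = mul (nc_sum env l) (nc_sum env l').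
Proof.
elim: l => [|[c v] l IH] /=; first by rewrite mul0l.
by rewrite nc_sum_app IH nc_sum_mulw mulDl mulZl.
Qed.

Lemma nc_nfP env t : nc_sum env (nc_nf t) = nc_eval env t.
Proof.
elim: t => //= [n|a <- b <-|a <-|k a <-|a <- b <-].
- by rewrite /nc_word /= scale1r addr0.
- exact: nc_sum_app.
- by rewrite nc_sum_scale scaleN1r.
- exact: nc_sum_scale.
- exact: nc_sum_mul.
Qed.

Lemma nc_eqwP v w : nc_eqw v w -> v = w.
Proof.
have eqnP m n : nc_eqn m n -> m = n.
  by elim: m n => [|m IH] [|n] //= /IH ->.
have eqsP s t : nc_eqs s t -> s = t.
  by elim: s t => [|a s IH] [|b t] //=; case: ifP => // /eqnP -> /IH ->.
case: v w => [a s] [b t] /=.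
by case: ifP => // /eqnP -> /eqsP ->.
Qed.

Lemma nc_sum_insert env k w l :
  nc_sum env (nc_insert k w l) = k *: nc_word env w + nc_sum env l.
Proof.
elim: l => [//|[c v] l IH] /=; case: ifP => [/nc_eqwP ->|_] /=.
  by rewrite scalerDl addrA (addrC (c *: _)).
by rewrite IH addrCA.
Qed.

Lemma nc_zeroP env l : nc_zero l -> nc_sum env l = 0.
Proof.
by elim: l => [//|[k w] l IH] /= [-> /IH ->]; rewrite scale0r addr0.
Qed.

Lemma nc_correct env t1 t2 :
  nc_zero (nc_collect (nc_nf (NCadd t1 (NCopp t2)))) ->
  nc_eval env t1 = nc_eval env t2.
Proof.
move=> /(nc_zeroP env) h; apply/eqP; rewrite -subr_eq0; apply/eqP.
have <- : nc_eval env (NCadd t1 (NCopp t2)) = nc_eval env t1 - nc_eval env t2.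
  by [].
rewrite -nc_nfP -[RHS]h; elim: (nc_nf _) => //= -[k w] l IH.
by rewrite nc_sum_insert IH.
Qed.

End nc.

Lemma nc_star_correct (R : realType) (B : starAlgType R) (env : list B) t1 t2 :
  nc_zero (nc_collect (nc_nf (NCadd t1 (NCopp t2)))) ->
  nc_eval amul env t1 = nc_eval amul env t2.
Proof.
by apply: nc_correct; [exact: amulA|exact: amulDl|exact: amulDr
  |exact: amulZl|exact: amulZr].
Qed.

Lemma nc_lin_correct (K : comNzRingType) (V : lmodType K) (env : list V) t1 t2 :
  nc_zero (nc_collect (nc_nf (NCadd t1 (NCopp t2)))) ->
  nc_eval (fun _ _ => 0) env t1 = nc_eval (fun _ _ => 0) env t2.
Proof.
by apply: nc_correct => *; rewrite ?addr0 ?scaler0.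
Qed.

(** The dummy [match goal] runs [constr_eq] while a term is being built; its failure falls through
    to the second branch. The value [O] on the empty list is not reached, since [nc_atoms] has
    collected every atom before. *)
Ltac nc_lookup x env :=
  lazymatch env with
  | cons ?y ?env' =>
    match env with
    | _ => let _ := match goal with _ => constr_eq x y end in constr:(O)
    | _ => let n := nc_lookup x env' in constr:(S n)
    end
  | nil => constr:(O)
  end.

Ltac nc_add x env :=
  lazymatch env with
  | nil => constr:(cons x nil)
  | cons ?y ?env' =>
    match env with
    | _ => let _ := match goal with _ => constr_eq x y end in env
    | _ => let env'' := nc_add x env' in constr:(cons y env'')
    end
  end.

Ltac nc_atoms t env :=
  lazymatch t with
  | (?a + ?b)%R => let env := nc_atoms a env in nc_atoms b env
  | (- ?a)%R => nc_atoms a env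
  | (_ *: ?a)%R => nc_atoms a env
  | (?a ** ?b)%R => let env := nc_atoms a env in nc_atoms b env
  | 0%R => env
  | _ => nc_add t env
  end.

Ltac nc_reify K t env :=
  lazymatch t with
  | (?a + ?b)%R =>
    let a := nc_reify K a env in let b := nc_reify K b env in
    constr:(@NCadd K a b)
  | (- ?a)%R => let a := nc_reify K a env in constr:(@NCopp K a)
  | (?k *: ?a)%R => let a := nc_reify K a env in constr:(@NCscale K k a)
  | (?a ** ?b)%R =>
    let a := nc_reify K a env in let b := nc_reify K b env in
    constr:(@NCmul K a b)
  | 0%R => constr:(@NC0 K)
  | _ => let n := nc_lookup t env in constr:(@NCvar K n)
  end.

Ltac nc_reduce :=
  lazy [nc_zero nc_collect nc_insert nc_eqw nc_eqs nc_eqn nc_nf nc_mul nc_mulw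
        nc_catw nc_scale nc_app]; repeat split.

Ltac nc_apply lem K :=
  lazymatch goal with
  | |- @eq ?V ?x ?y =>
    let env := nc_atoms x (@nil V) in
    let env := nc_atoms y env in
    let t1 := nc_reify K x env in
    let t2 := nc_reify K y env in
    refine (lem env t1 t2 _); nc_reduce
  end.

Ltac nc R B := nc_apply (@nc_star_correct R B) (R[i])%type; try ring; try field.
Ltac lin K V := nc_apply (@nc_lin_correct K V) K; try ring.

(** * Extreme functionals below a sublinear one *)

Section extreme.
Variables (R : realType) (V : lmodType R[i]).
Implicit Types (p q f g : V -> R) (x y : V).

Definition sublinear p : Prop :=
  (forall x y, p (x + y) <= p x + p y) /\
  (forall (t : R) x, 0 <= t -> p (t%:C *: x) = t * p x).

Definition rlinear f : Prop :=
  (forall x y, f (x + y) = f x + f y) /\ (forall (t : R) x, f (t%:C *: x) = t * f x).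

Definition below f p : Prop := forall x, f x <= p x.

Definition convex_extreme p f : Prop :=
  forall g h (t : R), 0 < t < 1 -> rlinear g -> rlinear h -> below g p -> below h p ->
    (forall x, f x = t * g x + (1 - t) * h x) -> g = f.

Definition face p q : Prop :=
  forall g h (t : R), 0 < t < 1 -> rlinear g -> rlinear h -> below g p -> below h p ->
    below (fun x => t * g x + (1 - t) * h x) q -> below g q /\ below h q.

(** The bound inherited by the linear [f <= q] with [f x = q x]: such an [f] satisfies [f y = f (y +
    t x) - t q x <= q (y + t x) - t q x] for all [t >= 0]. *)
Definition tilt q x y : R := inf [set r | exists t : R, 0 <= t /\ r = q (y + t%:C *: x) - t * q x].

Lemma sublinear0 p : sublinear p -> p 0 = 0.
Proof. by case=> _ /(_ 0 0 (lexx _)); rewrite scaler0 mul0r. Qed.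

Lemma sublinearN p x : sublinear p -> - p (- x) <= p x.
Proof.
move=> sp; have := sp.1 x (- x); rewrite subrr sublinear0//; lra.
Qed.

Section tilt.
Variables (q : V -> R) (x : V).
Hypothesis sq : sublinear q.

Lemma tilt_lb y : lbound [set r | exists t : R, 0 <= t /\ r = q (y + t%:C *: x) - t * q x] (- q (- y)).
Proof.
move=> _ [t [t0 ->]].
have := sq.1 (y + t%:C *: x) (- y); rewrite addrAC subrr add0r (sq.2 _ _ t0); lra.
Qed.

Lemma tilt_has y : has_inf [set r | exists t : R, 0 <= t /\ r = q (y + t%:C *: x) - t * q x].
Proof.
split; last by exists (- q (- y)); exact: tilt_lb.
by exists (q (y + 0%:C *: x) - 0 * q x); exists 0.
Qed.

Lemma tilt_le y (t : R) : 0 <= t -> tilt q x y <= q (y + t%:C *: x) - t * q x.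
Proof.
move=> t0; apply: ge_inf; first by exists (- q (- y)); exact: tilt_lb.
by exists t.
Qed.

Lemma tilt_le0 y : tilt q x y <= q y.
Proof. by have := tilt_le y (lexx 0); rewrite scale0r addr0 mul0r subr0. Qed.

Lemma le_tilt y c : (forall t : R, 0 <= t -> c <= q (y + t%:C *: x) - t * q x) -> c <= tilt q x y.
Proof.
move=> h; apply: lb_le_inf; first exact: (tilt_has y).1.
by move=> _ [t [t0 ->]]; exact: h.
Qed.

Lemma tilt_sublinear : sublinear (tilt q x).
Proof.
split=> [y z|t y t0].
  rewrite -lerBlDr; apply: le_tilt => t t0.
  rewrite lerBlDl -lerBlDr; apply: le_tilt => s s0.
  rewrite lerBlDr.
  have st0 : 0 <= s + t by rewrite addr_ge0.
  apply: (le_trans (tilt_le (y + z) st0)).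
  have := sq.1 (y + t%:C *: x) (z + s%:C *: x).
  rewrite addrACA -scalerDl -raddfD/= (addrC t s). lra.
have [->|tN0] := eqVneq t 0.
  rewrite mul0r scale0r; apply/eqP; rewrite eq_le; apply/andP; split.
    by have := tilt_le0 0; rewrite (sublinear0 sq).
  apply: le_tilt => s s0; rewrite add0r (sq.2 _ _ s0); lra.
have tp : 0 < t by rewrite lt_neqAle eq_sym tN0.
have scl s u : 0 <= s -> q (s%:C *: y + (s * u)%:C *: x) - (s * u) * q x = s * (q (y + u%:C *: x) - u * q x).
  move=> s0; rewrite mulrBr -(sq.2 s _ s0) scalerDr scalerA -rmorphM/=; lra.
apply/eqP; rewrite eq_le; apply/andP; split.
  rewrite -ler_pdivrMl//; apply: le_tilt => u u0.
  by rewrite ler_pdivrMl// -scl//; apply: tilt_le; exact: mulr_ge0.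
apply: le_tilt => s s0.
have -> : s = t * (s / t) by rewrite mulrCA divff// mulr1.
rewrite scl// ler_pM2l//; apply: tilt_le; exact: divr_ge0.
Qed.

Lemma tilt_self : tilt q x (- x) <= - q x.
Proof.
have := tilt_le (- x) ler01.
by rewrite rmorph1 scale1r addNr sublinear0// mul1r sub0r.
Qed.

(** At [- x] the bound on the convex combination reads [t g x + (1 - t) h x >= q x], while [g] and
    [h] are at most [q]. So both equal [q] at [x], and then both lie below the tilt. *)
Lemma tilt_face p : face p q -> face p (tilt q x).
Proof.
move=> fpq g h t t01 lg lh gp hp fq.
have lin0N (k : V -> R) : rlinear k -> k (- x) = - k x.
  by move=> lk; have := lk.2 (-1) x; rewrite rmorphN1 scaleN1r mulN1r.
have [gq hq] : below g q /\ below h q.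
  apply: (fpq _ _ t) => // y; apply: le_trans (fq y) (tilt_le0 y).
have fx := le_trans (fq (- x)) tilt_self.
have tg : 0 < t by lra. have th : 0 < 1 - t by lra.
have gx := gq x; have hx := hq x.
rewrite lin0N// lin0N// in fx.
have gE : g x = q x.
  apply/eqP; rewrite eq_le gx /= leNgt; apply/negP => lt.
  have : t * g x < t * q x by rewrite ltr_pM2l.
  have : (1 - t) * h x <= (1 - t) * q x by rewrite ler_pM2l.
  lra.
have hE : h x = q x.
  apply/eqP; rewrite eq_le hx /= leNgt; apply/negP => lt.
  have : t * g x <= t * q x by rewrite ler_pM2l.
  have : (1 - t) * h x < (1 - t) * q x by rewrite ltr_pM2l.
  lra.
split=> y; apply: le_tilt => s s0.
  by have := gq (y + s%:C *: x); rewrite lg.1 lg.2 gE; lra.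
by have := hq (y + s%:C *: x); rewrite lh.1 lh.2 hE; lra.
Qed.

End tilt.

(** The pointwise infimum is finite because every member is at least [- p (- x)], and subadditive
    because the smaller of two members serves for both arguments. It supplies the lower bounds for
    Zorn's lemma. *)
Lemma chain_inf (F : set (V -> R)) p : (forall q, F q -> sublinear q /\ below q p) ->
  (forall q q', F q -> F q' -> below q q' \/ below q' q) -> (exists q, F q) ->
  exists q, [/\ sublinear q, forall q', F q' -> below q q' &
    forall f, (forall q', F q' -> below f q') -> below f q].
Proof.
move=> Fs Fc [q0 Fq0].
pose S x := [set r | exists q, F q /\ r = q x].
have lbS x : lbound (S x) (- p (- x)).
  move=> _ [q [/Fs[sq qp] ->]]; apply: le_trans (sublinearN x sq).
  by rewrite lerN2; exact: qp.
have hS x : has_inf (S x) by split; [exists (q0 x), q0|exists (- p (- x)); exact: lbS].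
pose q x := inf (S x).
have qle r x : F r -> q x <= r x.
  by move=> Fr; apply: ge_inf; [exact: (hS x).2|exists r].
have q_ge c x : (forall r, F r -> c <= r x) -> c <= q x.
  move=> h; apply: lb_le_inf; first exact: (hS x).1.
  by move=> _ [r [Fr ->]]; exact: h.
exists q; split; [split=> [x y|t x t0]|by move=> r Fr x; exact: qle|].
- rewrite -lerBlDr; apply: (q_ge _ _) => r Fr; rewrite lerBlDl -lerBlDr.
  apply: (q_ge _ _) => s Fs'; rewrite lerBlDr.
  have [[sr _] [ss _]] := (Fs _ Fr, Fs _ Fs').
  case: (Fc _ _ Fr Fs') => rs.
    apply: (le_trans (qle _ _ Fr)); have := sr.1 x y; have := rs y; lra.
  apply: (le_trans (qle _ _ Fs')); have := ss.1 x y; have := rs x; lra.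
- have [->|tN0] := eqVneq t 0.
    rewrite mul0r scale0r; apply/eqP; rewrite eq_le; apply/andP; split.
      by rewrite -(sublinear0 (Fs _ Fq0).1); exact: qle.
    by apply: (q_ge _ _) => r /Fs[sr _]; rewrite sublinear0.
  have tp : 0 < t by rewrite lt_neqAle eq_sym tN0.
  apply/eqP; rewrite eq_le; apply/andP; split.
    rewrite -ler_pdivrMl//; apply: (q_ge _ _) => r Fr; rewrite ler_pdivrMl//.
    by rewrite -(Fs _ Fr).1.2//; exact: qle.
  apply: (q_ge _ _) => r Fr; rewrite (Fs _ Fr).1.2// ler_pM2l//; exact: qle.
- by move=> f fF x; apply: (q_ge _ _) => r Fr; exact: fF.
Qed.

(* A minimal element among the sublinear functionals cutting out a face of
   [{f | f <= p}] cannot be tilted, hence is linear, hence an extreme point. *)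
Lemma extreme_exists p x0 : sublinear p ->
  exists f, [/\ rlinear f, below f p, f x0 = p x0 & convex_extreme p f].
Proof.
move=> sp.
pose good q := [/\ sublinear q, below q p & face p q].
have good_tilt q x : good q -> good (tilt q x).
  move=> [sq qp fq]; split; [exact: tilt_sublinear| |exact: tilt_face].
  by move=> y; apply: le_trans (tilt_le0 x sq y) (qp y).
have goodp : good p by split=> // g h t _ _ _ gp hp _.
(* Staying below [q0] forces the value at [x0]: since [q0 (- x0) <= - p x0], a linear functional
   below [q0] is at least, hence exactly, [p x0] there. *)
pose q0 := tilt p x0.
have gq0 : good q0 by exact: good_tilt.
pose T := {q | good q /\ below q q0}.
have rT : below q0 q0 by move=> x.
pose t0 : T := exist _ q0 (conj gq0 rT).
(* The order is reversed, so that a maximal element is a minimal functional. *)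
pose Rl (s t : T) : bool := `[< below (sval t) (sval s) >].
have [|||[m [gm mq0]] mmax] := @ZL_preorder T t0 Rl.
- by move=> t; apply/asboolP => x.
- move=> r s t /asboolP rs /asboolP st; apply/asboolP => x.
  exact: le_trans (st x) (rs x).
- move=> A tot.
  have [[a0 Aa0]|nA] := pselect (exists a, A a); last first.
    by exists t0 => s As; exfalso; apply: nA; exists s.
  pose F := [set q | exists2 a, A a & q = sval a].
  have [|||q [sq qF Fq]] := @chain_inf F p.
  + by move=> _ [[q [[sq qp fq] ?]] _ ->].
  + move=> _ _ [a Aa ->] [b Ab ->].
    by case: (tot _ _ Aa Ab) => /asboolP; [right|left].
  + by exists (sval a0), a0.
  have qp : below q p.
    move=> x; apply: le_trans (qF (sval a0) _ x) _; first by exists a0.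
    by case: (a0) => [? [[]]].
  have qq0 : below q q0.
    move=> x; apply: le_trans (qF (sval a0) _ x) _; first by exists a0.
    by case: (a0) => [? []].
  have fq : face p q.
    move=> g h t t01 lg lh gp hp gh.
    have key a : A a -> below g (sval a) /\ below h (sval a).
      move=> Aa; have [_ _ fa] := (svalP a).1; apply: (fa _ _ t) => //.
      by move=> x; apply: le_trans (gh x) _; apply: qF; exists a.
    by split; apply: Fq => _ [a /key[? ?] ->].
  exists (exist _ q (conj (And3 sq qp fq) qq0)).
  by move=> s As; apply/asboolP => x /=; apply: qF; exists s.
have min x : below m (tilt m x).
  have gt := good_tilt m x gm; have [sm _ _] := gm.
  have tq0 : below (tilt m x) q0.
    by move=> y; apply: le_trans (tilt_le0 x sm y) (mq0 y).
  have := mmax (exist _ (tilt m x) (conj gt tq0)).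
  rewrite /Rl/= => h; apply/asboolP; apply: h; apply/asboolP => y.
  exact: tilt_le0.
have [[mD mZ] mp fm] := gm.
(* By minimality [m (- x) <= tilt m x (- x) <= - m x]; an odd sublinear functional is linear. *)
have mN x : m (- x) = - m x.
  apply/eqP; rewrite eq_le; apply/andP; split.
    by apply: le_trans (tilt_self x (conj mD mZ)); exact: min.
  have := sublinearN (- x) (conj mD mZ); rewrite opprK; lra.
have lm : rlinear m.
  split=> [x y|t x].
    apply/eqP; rewrite eq_le mD /=.
    have := mD (x + y) (- y); rewrite addrK mN; lra.
  case: (leP 0 t) => [/mZ //|tge0].
  have := mZ (- t) x; rewrite oppr_ge0 => /(_ (ltW tge0)).
  rewrite rmorphN scaleNr mN; lra.
exists m; split => //.
  apply/eqP; rewrite eq_le mp /=.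
  have h1 := mq0 (- x0); have h2 := tilt_self x0 sp.
  have := le_trans h1 h2; rewrite mN; lra.
move=> g h t t01 lg lh gp hp mE.
have [gm' _] : below g m /\ below h m.
  by apply: (fm _ _ t) => // x; rewrite -mE.
apply/funext => x; apply/eqP; rewrite eq_le gm' /=.
have gN : g (- x) = - g x by have := lg.2 (-1) x; rewrite rmorphN1 scaleN1r mulN1r.
have := gm' (- x); rewrite gN mN; lra.
Qed.

End extreme.

(** * Unital C*-algebras *)

Lemma bounded_increasing_cvg (R : realType) (r : nat -> R) (M : R) :
  (forall n, r n <= r n.+1) -> (forall n, r n <= M) ->
  exists l, (forall n, r n <= l) /\
    forall eps, 0 < eps -> exists n0, forall n, (n0 <= n)%N -> l - eps <= r n.
Proof.
move=> rS rM.
have hs : has_sup (range r).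
  by split; [exists (r 0), 0|exists M => _ [n _ <-]].
have mono : {homo r : m n / (m <= n)%N >-> m <= n}.
  by apply: homo_leq => // x y z; exact: le_trans.
exists (sup (range r)); split=> [n|eps eps0].
  by apply: (ub_le_sup hs.2); exists n.
have [_ [n0 _ <-] lt0] := sup_adherent eps0 hs.
by exists n0 => n /mono; apply: le_trans; exact: ltW.
Qed.

(** The norm is a real function subject to axioms, not a structure on [B]: [multiplier A] carries
    only a star algebra structure, and its norm is built later, as [mnorm]. *)
Record ucstar (R : realType) (B : starAlgType R) (e : B) (N : B -> R) : Prop := UCStar {
  uc1l : forall x, e ** x = x;
  uc1r : forall x, x ** e = x;
  ucD : forall x y, N (x + y) <= N x + N y;
  ucZ : forall (k : R[i]) x, N (k *: x) = complex.Re `|k| * N x;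
  uc_eq0 : forall x, N x = 0 -> x = 0;
  ucM : forall x y, N (x ** y) <= N x * N y;
  uc_starM : forall x, N (star x ** x) = N x ^+ 2;
  uc_complete : forall u : nat -> B,
    (forall eps, 0 < eps -> exists n0, forall m n, (n0 <= m)%N -> (n0 <= n)%N ->
      N (u m - u n) <= eps) ->
    exists l, forall eps, 0 < eps -> exists n0, forall n, (n0 <= n)%N ->
      N (u n - l) <= eps
}.

Section star.
Variables (R : realType) (B : starAlgType R).

Lemma starN (x : B) : star (- x) = - star x.
Proof.
by rewrite -scaleN1r starZ -[RHS]scaleN1r rmorphN1.
Qed.

Lemma star0 : star (0 : B) = 0.
Proof. by have := starN 0; rewrite oppr0 => /eqP; rewrite -addr_eq0 -mulr2n -scaler_nat scaler_eq0 pnatr_eq0 => /eqP. Qed.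

Lemma starB (x y : B) : star (x - y) = star x - star y.
Proof. by rewrite starD starN. Qed.

Lemma conj_real (r : R) : Num.conj (r%:C : R[i]) = r%:C.
Proof. by apply/CrealP; rewrite complex_real. Qed.

Lemma starZr (r : R) (x : B) : star (r%:C *: x) = r%:C *: star x.
Proof. by rewrite starZ conj_real. Qed.

Lemma salg0l (x : B) : 0 ** x = 0.
Proof. by have := amulZl 0 (0 : B) x; rewrite !scale0r. Qed.

Lemma salg0r (x : B) : x ** 0 = 0.
Proof. by have := amulZr 0 x (0 : B); rewrite !scale0r. Qed.

Lemma salgNl (x y : B) : (- x) ** y = - (x ** y).
Proof. by rewrite -scaleN1r amulZl scaleN1r. Qed.

Lemma salgNr (x y : B) : x ** (- y) = - (x ** y).
Proof. by rewrite -scaleN1r amulZr scaleN1r. Qed.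

Lemma Re_normr_real (r : R) : complex.Re `|r%:C : R[i]| = `|r|.
Proof. by rewrite normc_def /= expr0n addr0 sqrtr_sqr. Qed.

End star.

Section uc.
Variables (R : realType) (B : starAlgType R) (e : B) (N : B -> R).
Hypothesis uc : ucstar e N.
Implicit Types (x y z h k a b : B) (r s t : R).

Definition ucE := (@amulDl R B, @amulDr R B, @salgNl R B, @salgNr R B, @amulZl R B,
  @amulZr R B, uc1l uc, uc1r uc).

Definition uclim (u : nat -> B) l := forall eps, 0 < eps ->
  exists n0, forall n, (n0 <= n)%N -> N (u n - l) <= eps.

Definition ucclosed (T : set B) := forall u l, (forall n, T (u n)) -> uclim u l -> T l.

Definition sa x := star x = x.

Lemma N0 : N 0 = 0.
Proof. by rewrite -[0](scale0r (0 : B)) (ucZ uc) normr0 mul0r. Qed.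

Lemma NZ r x : N (r%:C *: x) = `|r| * N x.
Proof. by rewrite (ucZ uc) Re_normr_real. Qed.

Lemma NN x : N (- x) = N x.
Proof.
have -> : - x = (-1)%:C *: x by rewrite rmorphN1 scaleN1r.
by rewrite NZ normrN1 mul1r.
Qed.

Lemma N_ge0 x : 0 <= N x.
Proof. by have := ucD uc x (- x); rewrite NN subrr N0; lra. Qed.

Lemma NB x y : N (x - y) <= N x + N y.
Proof. by rewrite -[N y]NN; exact: (ucD uc). Qed.

Lemma NC x y : N (x - y) = N (y - x).
Proof. by rewrite -NN opprB. Qed.

Lemma N_triangle x y z : N (x - z) <= N (x - y) + N (y - z).
Proof. by have := ucD uc (x - y) (y - z); rewrite addrA subrK. Qed.

Lemma N_le_add x y : N x <= N (x - y) + N y.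
Proof. by have := ucD uc (x - y) y; rewrite subrK. Qed.

Lemma N_star x : N (star x) = N x.
Proof.
have le y : N y <= N (star y).
  have [->|y0] := eqVneq y 0; first by rewrite N0 N_ge0.
  have Np : 0 < N y.
    rewrite lt_neqAle N_ge0 andbT eq_sym; apply/eqP => /(uc_eq0 uc) y00.
    by rewrite y00 eqxx in y0.
  have := ucM uc (star y) y; rewrite (uc_starM uc) expr2.
  by rewrite ler_pM2r.
by apply/eqP; rewrite eq_le le /= -[X in _ <= N X]starK le.
Qed.

Lemma star_e : star e = e.
Proof.
have h := uc1r uc (star e).
by rewrite -[in RHS](starK e) -h starM starK h.
Qed.

Lemma N_sa x : sa x -> N (x ** x) = N x ^+ 2.
Proof. by move=> sx; rewrite -{1}sx (uc_starM uc). Qed.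

Lemma N_e : N e <= 1.
Proof.
have := N_sa star_e; rewrite (uc1l uc) => h.
have := N_ge0 e; nra.
Qed.

Lemma NM x y r s : N x <= r -> N y <= s -> N (x ** y) <= r * s.
Proof.
move=> xr ys; apply: le_trans (ucM uc _ _) _.
by apply: ler_pM => //; exact: N_ge0.
Qed.

Lemma N_le0 x : (forall eps, 0 < eps -> N x <= eps) -> x = 0.
Proof.
move=> h; apply: (uc_eq0 uc); apply/eqP; rewrite eq_le N_ge0 andbT.
by apply/ler_addgt0Pr => eps eps0; rewrite add0r h.
Qed.

Lemma uclim_unique u l l' : uclim u l -> uclim u l' -> l = l'.
Proof.
move=> ul ul'; apply/eqP; rewrite -subr_eq0; apply/eqP; apply: N_le0 => eps eps0.
have e2 : 0 < eps / 2 by lra.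
have [n hn] := ul _ e2; have [m hm] := ul' _ e2.
have := hn (maxn m n) (leq_maxr _ _); have := hm (maxn m n) (leq_maxl _ _).
have := N_triangle l (u (maxn m n)) l'; rewrite (NC l (u _)); lra.
Qed.

Lemma uclim_lip (f : B -> B) (C : R) u l : (forall x y, N (f x - f y) <= C * N (x - y)) ->
  uclim u l -> uclim (f \o u) (f l).
Proof.
move=> lip ul eps eps0.
have C1 : 0 < `|C| + 1 by have := normr_ge0 C; lra.
have [n hn] := ul (eps / (`|C| + 1)) (divr_gt0 eps0 C1).
exists n => j /hn hj; apply: le_trans (lip _ _) _.
have : C * N (u j - l) <= (`|C| + 1) * N (u j - l).
  by apply: ler_wpM2r; [exact: N_ge0|have := ler_norm C; lra].
have : (`|C| + 1) * N (u j - l) <= (`|C| + 1) * (eps / (`|C| + 1)) by rewrite ler_pM2l.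
rewrite mulrCA divff ?mulr1; [lra|by rewrite gt_eqF].
Qed.

Lemma uclimMl u l x : uclim u l -> uclim (fun n => x ** u n) (x ** l).
Proof.
apply: (@uclim_lip (amul x) (N x)) => y z.
have -> : x ** y - x ** z = x ** (y - z) by nc R B.
exact: (ucM uc).
Qed.

Lemma uclimMr u l x : uclim u l -> uclim (fun n => u n ** x) (l ** x).
Proof.
apply: (@uclim_lip (amul^~ x) (N x)) => y z /=.
have -> : y ** x - z ** x = (y - z) ** x by nc R B.
by rewrite mulrC; exact: (ucM uc).
Qed.

Lemma uclim_star u l : uclim u l -> uclim (fun n => star (u n)) (star l).
Proof.
apply: (@uclim_lip star 1) => y z; by rewrite mul1r -starB N_star.
Qed.

Lemma closed_commute x : ucclosed [set y | x ** y = y ** x].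
Proof.
move=> u l ux ul; apply: (@uclim_unique (fun n => x ** u n)); first exact: uclimMl.
by rewrite /= (_ : (fun n => _) = (fun n => u n ** x)); [exact: uclimMr|apply/funext => n; exact: ux].
Qed.

Lemma closed_sa : ucclosed sa.
Proof.
move=> u l ux ul; apply: (@uclim_unique u) => //.
rewrite (_ : u = fun n => star (u n)); [exact: uclim_star|by apply/funext => n; rewrite ux].
Qed.

Lemma closed_N r : ucclosed [set y | N y <= r].
Proof.
move=> u l ux ul /=; apply/ler_addgt0Pr => eps eps0.
have [n hn] := ul _ eps0; have := hn n (leqnn _); have := ux n => /=.
have := N_le_add l (u n); rewrite NC; lra.
Qed.

(* [q] is the limit of the iteration [p := (x + p ^ 2) / 2] from [0], whose
   increments are dominated by those of the same real iteration at [x = 1]. *)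
Lemma sqrt_iter x : sa x -> N x <= 1 ->
  exists q, (e - q) ** (e - q) = e - x /\
    forall T : set B, T 0 -> (forall y, T y -> T (2^-1%:C *: (x + y ** y))) ->
      ucclosed T -> T q.
Proof.
move=> sx Nx.
pose p n := iter n (fun y => 2^-1%:C *: (x + y ** y)) 0.
pose r n : R := iter n (fun t : R => (1 + t ^+ 2) / 2) 0.
have r01 n : 0 <= r n <= 1.
  by elim: n => [|n]; rewrite /r /= ?lexx ?ler01// -/(r n) => /andP[h1 h2]; nra.
have rS n : r n <= r n.+1.
  by rewrite /r /= -/(r n); have := sqr_ge0 (1 - r n); nra.
have Np n : N (p n) <= r n.
  elim: n => [|n IH]; first by rewrite N0.
  rewrite /p /r /= -/(p n) -/(r n) NZ.
  have := NM IH IH; have := ucD uc x (p n ** p n).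
  rewrite ger0_norm ?invr_ge0//; lra.
have pcom y n : x ** y = y ** x -> p n ** y = y ** p n.
  move=> xy; elim: n => [|n IH]; first by rewrite salg0l salg0r.
  rewrite /p /= -/(p n) amulZl amulZr amulDl amulDr xy.
  by rewrite -amulA IH amulA IH amulA.
have pp m n : p m ** p n = p n ** p m.
  by apply: (pcom _ _); apply/esym/(pcom _ _).
have pS n : N (p n.+1 - p n) <= r n.+1 - r n.
  elim: n => [|n IH].
    have := Np 1; rewrite /= subr0 /r /= subr0; exact.
  have -> : p n.+2 - p n.+1 = 2^-1%:C *: ((p n.+1 - p n) ** (p n.+1 + p n)).
    have -> : p n.+2 = 2^-1%:C *: (x + p n.+1 ** p n.+1) by [].
    have -> : p n.+1 = 2^-1%:C *: (x + p n ** p n) :> B by [].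
    set y := p n.+1; rewrite -/y.
    have h : y ** p n = p n ** y by rewrite pp.
    rewrite [in LHS](_ : 2^-1%:C *: (x + p n ** p n) = y)//.
    rewrite amulDl !amulDr !salgNl h.
    have -> : y = 2^-1%:C *: (x + p n ** p n) by [].
    nc R B.
  rewrite NZ ger0_norm ?invr_ge0//.
  have h : N (p n.+1 + p n) <= r n.+1 + r n.
    by apply: le_trans (ucD uc _ _) _; exact: lerD.
  have := NM IH h.
  have -> : r n.+2 = (1 + r n.+1 ^+ 2) / 2 by [].
  have E : r n.+1 = (1 + r n ^+ 2) / 2 by [].
  have -> : (1 + r n.+1 ^+ 2) / 2 - r n.+1 = 2^-1 * ((r n.+1 - r n) * (r n.+1 + r n)).
    by rewrite [X in _ - X]E; field.
  by move=> ?; rewrite ler_pM2l ?invr_gt0.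
have pd m n : (n <= m)%N -> N (p m - p n) <= r m - r n.
  move=> /subnK <-; elim: (m - n)%N => [|j IH]; first by rewrite add0n !subrr N0.
  rewrite addSn; have := N_triangle (p (j + n).+1) (p (j + n)%N) (p n).
  have := pS (j + n)%N; lra.
have [l [rl lr]] := bounded_increasing_cvg rS (fun n => proj2 (andP (r01 n))).
have [|q pq] := uc_complete uc (u := p).
  move=> eps eps0; have [n0 h] := lr _ eps0; exists n0 => m n hm hn.
  have [nm|/ltnW mn] := leqP n m.
    by have := pd _ _ nm; have := rl m; have := h _ hn; lra.
  by rewrite NC; have := pd _ _ mn; have := rl n; have := h _ hm; lra.
exists q; split; last first.
  move=> T T0 TS Tc; apply: (Tc p) => // n.
  by elim: n => [//|n]; exact: TS.
have pq' : uclim (fun n => p n.+1) q.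
  by move=> eps /pq[n0 h]; exists n0 => n hn; apply: h; exact: leqW.
have qq : uclim (fun n => p n ** p n) (q ** q).
  move=> eps eps0.
  have N1 n : N (p n) <= 1 by apply: le_trans (Np n) _; case/andP: (r01 n).
  have Nq : N q <= 1 by apply: (@closed_N 1 p).
  have [n0 h] := pq (eps / 2) ltac:(lra); exists n0 => n /h hn.
  have -> : p n ** p n - q ** q = p n ** (p n - q) + (p n - q) ** q by nc R B.
  have := ucD uc (p n ** (p n - q)) ((p n - q) ** q).
  have := NM (N1 n) hn; have := NM hn Nq; lra.
have qE : q = 2^-1%:C *: (x + q ** q).
  apply: (uclim_unique pq') => eps /qq[n0 h]; exists n0 => n /h hn.
  have -> : p n.+1 - 2^-1%:C *: (x + q ** q) = 2^-1%:C *: (p n ** p n - q ** q).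
    by rewrite /p /= -/(p n); nc R B.
  rewrite NZ ger0_norm ?invr_ge0//; have := N_ge0 (p n ** p n - q ** q); lra.
have q2 : q ** q = 2%:C *: q - x.
  by rewrite [in 2%:C *: q]qE; nc R B.
rewrite !ucE q2; nc R B.
Qed.

(** Positivity is taken in the form that square roots give; that [star b ** b] is positive in this
    sense is the deeper [pos_starM]. *)
Definition pos h := exists2 k, sa k & h = k ** k.

Lemma sa_e : sa e. Proof. exact: star_e. Qed.

Lemma saD x y : sa x -> sa y -> sa (x + y).
Proof. by move=> sx sy; rewrite /sa starD sx sy. Qed.

Lemma saN x : sa x -> sa (- x).
Proof. by move=> sx; rewrite /sa starN sx. Qed.

Lemma saB x y : sa x -> sa y -> sa (x - y).
Proof. by move=> sx sy; apply/saD/saN. Qed.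

Lemma saZ r x : sa x -> sa (r%:C *: x).
Proof. by move=> sx; rewrite /sa starZr sx. Qed.

Lemma saM x y : sa x -> sa y -> x ** y = y ** x -> sa (x ** y).
Proof. by move=> sx sy xy; rewrite /sa starM sx sy. Qed.

Lemma sa_starM x : sa (star x ** x).
Proof. by rewrite /sa starM starK. Qed.

Lemma pos_sa h : pos h -> sa h.
Proof. by case=> k sk ->; exact: saM. Qed.

Lemma sa_sq_eq0 x : sa x -> x ** x = 0 -> x = 0.
Proof.
move=> sx xx0; have := N_sa sx; rewrite xx0 N0 => /esym/eqP.
by rewrite sqrf_eq0 => /eqP /(uc_eq0 uc).
Qed.

Lemma realZ_inv t x : 0 < t -> t%:C *: (t^-1%:C *: x) = x.
Proof. by move=> t0; rewrite scalerA -rmorphM /= divff ?gt_eqF// rmorph1 scale1r. Qed.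

(** Write [h = t (e - x)] with [N x <= 1] and take [sqrt t] times the root of [e - x]. The
    inequality [N (t e - h) <= t] stands in for a nonnegative spectrum; the third conclusion is the
    same inequality for the root, which is therefore itself positive. *)
Lemma ball_sqrt h t : sa h -> 0 < t -> N (t%:C *: e - h) <= t ->
  exists r : B, [/\ sa r, r ** r = h, (exists2 s, 0 < s & N (s%:C *: e - r) <= s) &
    forall y, h ** y = y ** h -> r ** y = y ** r].
Proof.
move=> sh t0 ht; pose x := e - t^-1%:C *: h.
have xE : x = t^-1%:C *: (t%:C *: e - h).
  by rewrite scalerBr scalerA -rmorphM /= mulVf ?gt_eqF// rmorph1 scale1r.
have sx : sa x by apply: saB; [exact: sa_e|exact: saZ].
have Nx : N x <= 1.
  by rewrite xE NZ gtr0_norm ?invr_gt0// ler_pdivrMl// mulr1.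
have [q [q2 qT]] := sqrt_iter sx Nx.
have sq : sa q.
  apply: qT; [exact: star0| |exact: closed_sa] => y sy.
  by apply/saZ/saD => //; exact: saM.
have Nq : N q <= 1.
  apply: (qT [set y | N y <= 1]); [by rewrite /= N0| |exact: closed_N] => y /= Ny.
  rewrite NZ ger0_norm ?invr_ge0//; have := NM Ny Ny; have := ucD uc x (y ** y); lra.
pose s := Num.sqrt t; have s0 : 0 < s by rewrite sqrtr_gt0.
exists (s%:C *: (e - q)); split.
- by apply/saZ/saB => //; exact: sa_e.
- rewrite amulZl amulZr scalerA -rmorphM /= -expr2 sqr_sqrtr ?ltW// q2 /x opprB addrC subrK.
  exact: realZ_inv.
- exists s => //; rewrite (_ : _ - _ = s%:C *: q); last by nc R B.
  by rewrite NZ gtr0_norm// ger_pMr.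
- move=> y hy; have qy : y ** q = q ** y.
    apply: (qT [set q | y ** q = q ** y]) => [|z /= yz|].
    + by rewrite /= salg0l salg0r.
    + rewrite !ucE hy; congr (_ *: (_ + _)); by rewrite -amulA -yz !amulA yz.
    + exact: closed_commute.
  by rewrite !ucE qy.
Qed.

Let ii : 'i * 'i = -1 :> R[i].
Proof. by rewrite -expr2 sqrCi. Qed.

Let star_i x : star ('i *: x) = - ('i *: star x).
Proof. by rewrite starZ conjCi scaleNr. Qed.

Let Ni x : N ('i *: x) = N x.
Proof. by rewrite (ucZ uc) normCi /= mul1r. Qed.

Section unitary.
Variables (k l : B) (s : R).
Hypotheses (sk : sa k) (sl : sa l) (kl : k ** l = l ** k) (s0 : 0 <= s)
  (kls : k ** k + l ** l = s%:C *: e).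

(* The element [k + i l] has modulus [sqrt s]. *)
Lemma N_unitary : N (k + 'i *: l) <= Num.sqrt s.
Proof.
rewrite -[leLHS]ger0_norm ?N_ge0// -sqrtr_sqr ler_wsqrtr// -(uc_starM uc).
have -> : star (k + 'i *: l) ** (k + 'i *: l) = s%:C *: e.
  by rewrite -kls starD star_i sk sl !ucE kl; nc R B; ring: ii.
by rewrite NZ ger0_norm// ler_piMr ?N_e.
Qed.

Lemma N_unitary_l : N k <= Num.sqrt s.
Proof.
have -> : k = 2^-1%:C *: ((k + 'i *: l) + star (k + 'i *: l)).
  by rewrite starD star_i sk sl; nc R B.
rewrite NZ ger0_norm ?invr_ge0//.
have := ucD uc (k + 'i *: l) (star (k + 'i *: l)); rewrite N_star.
have := N_unitary; lra.
Qed.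

Lemma N_unitary_r : N l <= Num.sqrt s.
Proof.
rewrite -Ni; have -> : 'i *: l = 2^-1%:C *: ((k + 'i *: l) - star (k + 'i *: l)).
  by rewrite starD star_i sk sl; nc R B.
rewrite NZ ger0_norm ?invr_ge0//.
have := NB (k + 'i *: l) (star (k + 'i *: l)); rewrite N_star.
have := N_unitary; lra.
Qed.

End unitary.

(** If [w] is a root of [e - k ** k] commuting with [k], then [k + i w] has modulus one, whence
    [N w <= 1]. *)
Lemma N_sub_sq k : sa k -> N k <= 1 -> N (e - k ** k) <= 1.
Proof.
move=> sk Nk.
have skk : sa (k ** k) by exact: saM.
have Nkk : N (k ** k) <= 1 by have := NM Nk Nk; rewrite mulr1.
have Nk1 : N (1%:C *: e - (e - k ** k)) <= 1.
  by rewrite rmorph1 scale1r opprB addrC subrK.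
have [w [sw w2 _ wc]] := ball_sqrt (saB sa_e skk) ltr01 Nk1.
have kw : k ** w = w ** k.
  by apply/esym/wc; rewrite !ucE amulA.
have h : k ** k + w ** w = 1%:C *: e by rewrite w2 rmorph1 scale1r addrC subrK.
rewrite -w2; have := N_unitary_r sk sw kw ler01 h; rewrite sqrtr1 => Nw.
by have := NM Nw Nw; rewrite mulr1.
Qed.

Lemma pos_of_ball h t : sa h -> 0 < t -> N (t%:C *: e - h) <= t -> pos h.
Proof. by move=> sh t0 ht; have [r [sr <- _ _]] := ball_sqrt sh t0 ht; exists r. Qed.

(** Together with [pos_of_ball] this characterises positivity by a norm inequality, which reduces
    sums of positive elements to the triangle inequality. The factor [s = t ^ (-1/2)] brings [k]
    into the unit ball. *)
Lemma ball_of_pos h t : pos h -> 0 < t -> N h <= t -> N (t%:C *: e - h) <= t.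
Proof.
move=> [k sk ->] t0 Nh; pose s := Num.sqrt t^-1.
have s2 : s ^+ 2 = t^-1 by rewrite sqr_sqrtr// invr_ge0 ltW.
have Nsk : N (s%:C *: k) <= 1.
  rewrite NZ ger0_norm ?sqrtr_ge0// -(@ler_pXn2r _ 2)// ?nnegrE ?mulr_ge0 ?sqrtr_ge0 ?N_ge0//.
  by rewrite exprMn s2 -(N_sa sk) expr1n ler_pdivrMl// mulr1.
have := N_sub_sq (saZ s sk) Nsk.
have -> : e - s%:C *: k ** (s%:C *: k) = t^-1%:C *: (t%:C *: e - k ** k).
  rewrite scalerBr [in RHS]scalerA -[in RHS]rmorphM /= mulVf ?gt_eqF// rmorph1 scale1r.
  by rewrite amulZl amulZr scalerA -rmorphM /= -expr2 s2.
by rewrite NZ gtr0_norm ?invr_gt0// ler_pdivrMl// mulr1.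
Qed.

Lemma pos_sqrt h : pos h -> exists r : B, [/\ pos r, r ** r = h &
  forall y, h ** y = y ** h -> r ** y = y ** r].
Proof.
move=> ph; have t0 : 0 < N h + 1 by have := N_ge0 h; lra.
have [|r [sr r2 [s s0 hs] rc]] := ball_sqrt (pos_sa ph) t0.
  by apply: ball_of_pos => //; lra.
by exists r; split=> //; exact: pos_of_ball hs.
Qed.

Lemma posD a b : pos a -> pos b -> pos (a + b).
Proof.
move=> pa pb.
have ta : 0 < N a + 1 by have := N_ge0 a; lra.
have tb : 0 < N b + 1 by have := N_ge0 b; lra.
have tab : 0 < (N a + 1) + (N b + 1) by lra.
apply: (pos_of_ball _ tab); first by apply: saD; exact: pos_sa.
have -> : (N a + 1 + (N b + 1))%:C *: e - (a + b)
  = ((N a + 1)%:C *: e - a) + ((N b + 1)%:C *: e - b) by nc R B.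
apply: le_trans (ucD uc _ _) _; apply: lerD; apply: ball_of_pos => //; lra.
Qed.

Lemma posZ r a : 0 <= r -> pos a -> pos (r%:C *: a).
Proof.
move=> r0 [k sk ->]; exists ((Num.sqrt r)%:C *: k); first exact: saZ.
by rewrite amulZl amulZr scalerA -rmorphM /= -expr2 sqr_sqrtr.
Qed.

Lemma pos0 : pos 0.
Proof. by exists 0; [exact: star0|rewrite salg0l]. Qed.

Lemma pos_e : pos e.
Proof. by exists e; [exact: star_e|rewrite (uc1l uc)]. Qed.

Lemma pos_sub y s : sa y -> N y <= s -> pos (s%:C *: e - y).
Proof.
move=> sy Ny; have [s0|s0] := ltP 0 s.
  apply: (pos_of_ball _ s0); first by apply: saB => //; exact/saZ/sa_e.
  by rewrite opprB addrC subrK.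
have -> : y = 0.
  by apply: (uc_eq0 uc); apply/eqP; rewrite eq_le N_ge0 andbT; exact: le_trans s0.
have -> : s = 0 by have := N_ge0 y; lra.
by rewrite scale0r subr0; exact: pos0.
Qed.

(** With [a = k ** k] and [l] a root of [s e - a], the commuting elements [k] and [l] satisfy
    [k ** k + l ** l = s e], so [N k <= sqrt s]. *)
Lemma pos_N_le a s : pos a -> 0 <= s -> pos (s%:C *: e - a) -> N a <= s.
Proof.
move=> [k sk aE] s0 /pos_sqrt[l [pl l2 lc]].
have kl : k ** l = l ** k by apply/esym/lc; rewrite aE !ucE amulA.
have h : k ** k + l ** l = s%:C *: e by rewrite l2 aE addrC subrK.
have Nk := N_unitary_l sk (pos_sa pl) kl s0 h.
by have := NM Nk Nk; rewrite -aE -expr2 sqr_sqrtr.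
Qed.

Lemma pos_N_mono a b : pos a -> pos (b - a) -> N a <= N b.
Proof.
move=> pa pba; apply: pos_N_le => //; first exact: N_ge0.
have sb : sa b by rewrite -(subrK a b); apply: saD; exact: pos_sa.
have -> : (N b)%:C *: e - a = ((N b)%:C *: e - b) + (b - a) by nc R B.
by apply: posD => //; exact: pos_sub.
Qed.

Lemma pos_antisym a : pos a -> pos (- a) -> a = 0.
Proof.
move=> pa pNa; apply: (uc_eq0 uc); apply/eqP; rewrite eq_le N_ge0 andbT.
by rewrite -N0; apply: pos_N_mono => //; rewrite sub0r.
Qed.

Lemma posM a b : pos a -> pos b -> a ** b = b ** a -> pos (a ** b).
Proof.
move=> /pos_sqrt[r [pr <- rc]] /pos_sqrt[k [pk <- kc]] ab.
have rb : r ** (k ** k) = (k ** k) ** r by exact: rc.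
have kr : k ** r = r ** k by apply: kc.
exists (r ** k); first by apply: saM; [exact: pos_sa|exact: pos_sa|].
by rewrite -!amulA; congr (_ ** _); rewrite !amulA kr.
Qed.

Fixpoint pow x n := if n is n.+1 then x ** pow x n else e.

Lemma powD x m n : pow x (m + n) = pow x m ** pow x n.
Proof. by elim: m => [|m IH] /=; rewrite ?(uc1l uc)// IH amulA. Qed.

Lemma pow_commute x y n : x ** y = y ** x -> pow x n ** y = y ** pow x n.
Proof.
move=> xy; elim: n => [|n IH] /=; first by rewrite (uc1l uc) (uc1r uc).
by rewrite -amulA IH !amulA xy.
Qed.

Lemma sa_pow x n : sa x -> sa (pow x n).
Proof.
move=> sx; elim: n => [|n IH] /=; first exact: sa_e.
by apply: saM => //; exact/esym/pow_commute.
Qed.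

Lemma pos_pow x n : pos x -> pos (pow x n).
Proof.
move=> px; elim: n => [|n IH] /=; first exact: pos_e.
by apply: posM => //; exact/esym/pow_commute.
Qed.

Lemma N_pow x n : N x <= 1 -> N (pow x n) <= 1.
Proof.
move=> Nx; elim: n => [|n IH] /=; first exact: N_e.
by have := NM Nx IH; rewrite mulr1.
Qed.

Lemma N_pow2 x j : sa x -> N (pow x (2 ^ j)) = N x ^+ (2 ^ j).
Proof.
move=> sx; elim: j => [|j IH]; first by rewrite /= (uc1r uc) expr1.
rewrite expnS mul2n -addnn powD N_sa; last exact: sa_pow.
by rewrite IH -exprM addnn muln2.
Qed.

(** Exponential growth beats linear growth. This replaces the spectral radius formula: at the
    exponents [2 ^ j] the norm of a power of a self-adjoint element is the power of its norm. *)
Lemma sq_growth (c : R) : 0 <= c -> (forall j, c ^+ (2 ^ j) <= (2 ^ j)%:R + 1) -> c <= 1.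
Proof.
move=> c0 h; rewrite leNgt; apply/negP => c1; pose d := c - 1.
have d0 : 0 < d by rewrite /d; lra.
have bern n : 1 + n%:R * d <= c ^+ n.
  elim: n => [|n IH]; first by rewrite mul0r addr0 expr0.
  rewrite exprS -natr1; have n0 : 0 <= n%:R :> R by [].
  have -> : c = 1 + d by rewrite /d; ring.
  have := ler_wpM2l (_ : 0 <= 1 + d) IH.
  have : 0 <= n%:R * d * d by rewrite !mulr_ge0// ltW.
  have -> : c = 1 + d by rewrite /d; ring.
  by move=> ? /(_ ltac:(lra)); nra.
(* [m] is large enough for [k = 2 ^ m] to satisfy [k d ^ 2 >= 2]. At [j = m + 1] Bernoulli's
   inequality then gives [c ^ (2 k) >= (1 + k d) ^ 2 > 2 k + 1]. *)
pose m := (Num.truncn (2 / (d * d))).+1.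
have hm : 2 / (d * d) < m%:R by rewrite /m; exact: truncnS_gt.
have lt2 n : (n < 2 ^ n)%N by exact: ltn_expl.
pose k : R := (2 ^ m)%:R.
have km : m%:R <= k by rewrite ler_nat ltnW.
have kd : 2 <= k * (d * d).
  by rewrite -ler_pdivrMr ?mulr_gt0//; apply/ltW/(lt_le_trans hm).
have := h m.+1; rewrite expnS mulnC exprM expr2 natrM -/k => h1.
have b := bern (2 ^ m)%N; rewrite -/k in b.
have k1 : 0 < k by rewrite /k ltr0n expn_gt0.
have : (1 + k * d) * (1 + k * d) <= c ^+ (2 ^ m) * c ^+ (2 ^ m).
  have : 0 <= 1 + k * d by rewrite addr_ge0// mulr_ge0// ltW.
  by move=> ?; apply: ler_pM.
have : 2 * k <= k * (k * (d * d)) by rewrite mulrC ler_pM2l.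
have : 0 < k * d by rewrite mulr_gt0.
nra.
Qed.

(** The nonzero spectra of [b b*] and [b* b] agree, in norm form. From [b D = G b] with [N G <= 1]
    the products [b D ^ n] stay bounded, so consecutive powers of [D] differ by at most one in norm
    and [N (D ^ n) <= n + 1]; then [sq_growth] gives [N D <= 1]. *)
Lemma pos_swap b : pos (b ** star b) -> pos (star b ** b).
Proof.
move=> pg; pose t := N b ^+ 2 + 1.
have t0 : 0 < t by rewrite /t; have := sqr_ge0 (N b); lra.
set g := b ** star b in pg; set h := star b ** b.
have NgE : N g = N b ^+ 2.
  by rewrite /g -[b in b ** _]starK (uc_starM uc) N_star.
pose G := e - t^-1%:C *: g; pose D := e - t^-1%:C *: h.
have NZt x : N (t^-1%:C *: x) = t^-1 * N x by rewrite NZ gtr0_norm ?invr_gt0.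
have NG : N G <= 1.
  have -> : G = t^-1%:C *: (t%:C *: e - g).
    by rewrite scalerBr scalerA -rmorphM /= mulVf ?gt_eqF// rmorph1 scale1r.
  rewrite NZt ler_pdivrMl// mulr1; apply: ball_of_pos => //.
  by rewrite NgE /t; lra.
have bD : b ** D = G ** b by rewrite /D /G /g /h !ucE !amulA.
have NbD n : N (b ** pow D n) <= N b.
  elim: n => [|n IH] /=; first by rewrite (uc1r uc).
  by rewrite amulA bD -amulA; have := NM NG IH; rewrite mul1r.
have Nd n : N (pow D n - pow D n.+1) <= 1.
  have -> : pow D n - pow D n.+1 = t^-1%:C *: (star b ** (b ** pow D n)).
    by rewrite /= {3}/D !ucE opprB addrC subrK /h amulA.
  rewrite NZt ler_pdivrMl// mulr1.
  have Nsb : N (star b) <= N b by rewrite N_star.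
  by have := NM Nsb (NbD n); rewrite /t -expr2; lra.
have ND n : N (pow D n) <= n%:R + 1.
  elim: n => [|n IH]; first by rewrite add0r; exact: N_e.
  rewrite -natr1; have := N_le_add (pow D n.+1) (pow D n).
  by rewrite NC; have := Nd n; lra.
have sD : sa D by apply: saB; [exact: sa_e|exact/saZ/sa_starM].
have ND1 : N D <= 1.
  apply: sq_growth; first exact: N_ge0.
  by move=> j; rewrite -N_pow2.
apply: (@pos_of_ball _ t) => //; first exact: sa_starM.
have -> : t%:C *: e - h = t%:C *: D.
  by rewrite /D scalerBr realZ_inv.
by rewrite NZ gtr0_norm// ger_pMr.
Qed.

(* With [a = |h|] for [h = b* b] and [c = b (a - h)], one finds
   [c* c = - a (a - h)^2 <= 0], which forces [c = 0] and then [h = a]. *)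
Lemma pos_starM b : pos (star b ** b).
Proof.
set h := star b ** b; have sh : sa h by exact: sa_starM.
have [|a [pa a2 ac]] := @pos_sqrt (h ** h); first by exists h.
have ah : a ** h = h ** a by apply: ac; rewrite amulA.
have [s [ps s2 sc]] := pos_sqrt pa.
have sa_ : sa a by exact: pos_sa.
pose q := a - h; have sq : sa q by exact: saB.
have sh' : s ** h = h ** s by exact: sc.
have sa' : s ** a = a ** s by exact: sc.
have sq' : s ** q = q ** s by rewrite /q !ucE sa' sh'.
have hq : h ** q = - (a ** q).
  by rewrite /q !ucE ah a2 opprB.
pose c := b ** q.
have cE : star c ** c = - (s ** q ** (s ** q)).
  rewrite /c starM sq -amulA (amulA (star b)) -/h hq salgNr; congr (- _).
  by rewrite -s2 !amulA sq'.
have pN : pos (- (star c ** c)).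
  by rewrite cE opprK; exists (s ** q) => //; apply: saM => //; exact: pos_sa.
have pcc : pos (c ** star c).
  pose x := 2^-1%:C *: (c + star c); pose y := 2^-1%:C *: (star c - c).
  have sx : sa x by apply: saZ; rewrite /sa starD starK addrC.
  have sy : sa ('i *: y).
    by rewrite /sa star_i starZr starB starK -scalerN -scalerN opprB.
  have -> : c ** star c = 2%:C *: (x ** x) + 2%:C *: (('i *: y) ** ('i *: y))
      + - (star c ** c).
    have -> : ('i *: y) ** ('i *: y) = - (y ** y).
      by rewrite amulZl amulZr scalerA ii scaleN1r.
    by rewrite /x /y; nc R B.
  apply: posD => //; apply: posD.
    by apply: posZ => //; exists x.
  by apply: posZ => //; exists ('i *: y).
have cc0 := pos_antisym (pos_swap pcc) pN.
have sq0 : s ** q = 0.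
  apply: sa_sq_eq0; first by apply: saM => //; exact: pos_sa.
  by move: cE; rewrite cc0 => /eqP; rewrite eq_sym oppr_eq0 => /eqP.
have aq0 : a ** q = 0 by rewrite -s2 -amulA sq0 salg0r.
have q0 : q = 0.
  by apply: sa_sq_eq0 => //; rewrite {1}/q amulDl salgNl hq aq0 oppr0 subr0.
by rewrite -(subrK h a) -/q q0 add0r in pa.
Qed.

Lemma pos_conj x h : pos h -> pos (star x ** h ** x).
Proof.
move=> [k sk ->]; rewrite (_ : _ ** _ = star (k ** x) ** (k ** x)).
  exact: pos_starM.
by rewrite starM sk !amulA.
Qed.

Lemma pos_N_sq b : pos ((N b ^+ 2)%:C *: e - star b ** b).
Proof. by apply: pos_sub; [exact: sa_starM|rewrite (uc_starM uc)]. Qed.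

Lemma N_le1 z : sa z -> pos (e - z) -> pos (e + z) -> N z <= 1.
Proof.
move=> sz p1 p2.
have pz : pos (1%:C *: e - z ** z).
  rewrite (_ : _ - _ = (e - z) ** (e + z)).
    by apply: posM => //; rewrite !ucE; nc R B.
  by rewrite !ucE; nc R B.
have := pos_N_le (ex_intro2 _ _ z sz erefl) ler01 pz.
by rewrite N_sa// -[X in _ <= X](expr1n _ 2) ler_pXn2r// ?nnegrE ?N_ge0.
Qed.

Record ideal (I : set B) : Prop := Ideal {
  ideal0 : I 0;
  idealD : forall x y, I x -> I y -> I (x + y);
  idealZ : forall (k : R[i]) x, I x -> I (k *: x);
  idealMl : forall x y, I y -> I (x ** y);
  idealMr : forall x y, I x -> I (x ** y)
}.

Lemma idealN I x : ideal I -> I x -> I (- x).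
Proof. by move=> iI Ix; rewrite -scaleN1r; exact: idealZ. Qed.

(** [w] is the modulus of [z], obtained as the root of [e - (e - z ** z)]. The iterates converging
    to [e - w] stay in any closed ideal containing [e - z ** z], hence the last clause; for the
    ideal [A] of the multiplier algebra it makes [w] congruent to 1 modulo [A]. *)
Lemma abs_exists z : sa z -> N z <= 1 -> exists w : B,
  [/\ pos w, w ** w = z ** z, z ** w = w ** z &
    forall I, ideal I -> ucclosed I -> I (e - z ** z) -> I (e - w)].
Proof.
move=> sz Nz; pose x := e - z ** z.
have sx : sa x by apply: saB; [exact: sa_e|exact: saM].
have [q [q2 qT]] := sqrt_iter sx (N_sub_sq sz Nz).
have sq : sa q.
  apply: qT; [exact: star0| |exact: closed_sa] => y sy.
  by apply/saZ/saD => //; exact: saM.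
have Nq : N q <= 1.
  apply: (qT [set y | N y <= 1]); [by rewrite /= N0| |exact: closed_N] => y /= Ny.
  rewrite NZ ger0_norm ?invr_ge0//; have := NM Ny Ny; have := ucD uc x (y ** y).
  by have := N_sub_sq sz Nz; rewrite -/x; lra.
exists (e - q); split.
- apply: (pos_of_ball _ ltr01); first by apply: saB => //; exact: sa_e.
  by rewrite rmorph1 scale1r opprB addrC subrK.
- by rewrite q2 /x opprB addrC subrK.
- have : z ** q = q ** z; last by rewrite !ucE => ->.
  apply: (qT [set q | z ** q = q ** z]) => [|y /= zy|].
  + by rewrite /= salg0l salg0r.
  + rewrite !ucE !amulA; congr (_ *: (_ + _)).
    by rewrite zy -amulA zy amulA.
  + exact: closed_commute.
- move=> I iI cI Ix; rewrite opprB addrC subrK.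
  apply: qT => //; first exact: (ideal0 iI).
  by move=> y Iy; apply: (idealZ iI); apply: (idealD iI) => //; exact: (idealMl iI).
Qed.

(* An approximate unit at [j], built from the powers of [D = e - j j* / t]: the
   inequality [n g D ^ n <= e - D ^ n] for [g = e - D] bounds [g D ^ n]. *)
Lemma approximate_unit j (del : R) : 0 < del -> exists q : B,
  [/\ pos q, pos (e - q), N q <= 1, N (q ** j) <= del &
    forall I, ideal I -> I j -> I (e - q)].
Proof.
move=> del0; pose t := N j ^+ 2 + 1.
have t0 : 0 < t by rewrite /t; have := sqr_ge0 (N j); lra.
pose g := t^-1%:C *: (j ** star j).
have tV0 : 0 <= t^-1 by rewrite invr_ge0 ltW.
have pg : pos g by apply: posZ => //; rewrite -[j in j ** _]starK; exact: pos_starM.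
have Ng : N g <= 1.
  rewrite NZ ger0_norm// ler_pdivrMl// mulr1 -[j in j ** _]starK (uc_starM uc) N_star.
  by rewrite /t; lra.
pose D := e - g.
have sD : sa D by apply: saB; [exact: sa_e|exact: pos_sa].
have pD : pos D by rewrite /D -[e]scale1r -(rmorph1 (real_complex R)); apply: pos_sub => //; exact: pos_sa.
have ND : N D <= 1.
  by apply: pos_N_le => //; rewrite rmorph1 scale1r /D opprB addrC subrK.
have gD : D ** g = g ** D by rewrite /D !ucE.
have gDn n : pow D n ** g = g ** pow D n by exact: pow_commute.
have main n : pos (e - pow D n - n%:R%:C *: (g ** pow D n)).
  elim: n => [|n IH]; first by rewrite rmorph0 scale0r subr0 subrr; exact: pos0.
  have -> : e - pow D n.+1 - n.+1%:R%:C *: (g ** pow D n.+1) =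
    (e - pow D n - n%:R%:C *: (g ** pow D n)) +
    n.+1%:R%:C *: (g ** g ** pow D n).
    have -> : pow D n.+1 = pow D n - g ** pow D n by rewrite /= {1}/D !ucE.
    by rewrite -natr1; set c := n%:R; nc R B.
  apply: posD => //; apply: posZ => //.
  apply: posM; [by apply: posM|exact: pos_pow|].
  by rewrite -amulA -gDn amulA -gDn -amulA.
have NgD n : (0 < n)%N -> N (g ** pow D n) <= n%:R^-1.
  move=> n0; have n0' : 0 < n%:R :> R by rewrite ltr0n.
  have pgD : pos (g ** pow D n) by apply: posM => //; exact: pos_pow.
  rewrite -[leRHS]mulr1 ler_pdivlMl//.
  have -> : n%:R * N (g ** pow D n) = N (n%:R%:C *: (g ** pow D n)).
    by rewrite NZ ger0_norm.
  apply: pos_N_le => //; first by apply: posZ.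
  rewrite rmorph1 scale1r.
  have -> : e - n%:R%:C *: (g ** pow D n)
     = (e - pow D n - n%:R%:C *: (g ** pow D n)) + pow D n by nc R B.
  by apply: posD; [exact: main|exact: pos_pow].
(* [N (D ^ n j) ^ 2 <= t N (g D ^ n) <= t / n], and this [n] brings it below [del ^ 2]. *)
pose n := (Num.truncn (t / del ^+ 2)).+1.
have hn : t / del ^+ 2 < n%:R by exact: truncnS_gt.
have ND' : N (pow D n) <= 1 by exact: N_pow.
exists (pow D n); split.
- exact: pos_pow.
- rewrite -[e]scale1r -(rmorph1 (real_complex R)); apply: pos_sub => //; exact: sa_pow.
- by [].
- have sn := sa_pow n sD.
  rewrite -N_star -(@ler_pXn2r _ 2)// ?nnegrE ?N_ge0 ?(ltW del0)//.
  rewrite -(uc_starM uc) starK.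
  have -> : pow D n ** j ** star (pow D n ** j) = t%:C *: (g ** pow D n ** pow D n).
    rewrite starM sn -gDn /g !ucE scalerA -rmorphM /= divff ?gt_eqF// rmorph1 scale1r.
    by rewrite !amulA.
  rewrite NZ gtr0_norm// -ler_pdivlMl//.
  have := NM (NgD n isT) ND'; rewrite mulr1 => h; apply: (le_trans h).
  rewrite mulrC -[leLHS]mulr1 ler_pdivrMl ?ltr0n// mulrA.
  rewrite -ler_pdivrMr; last by rewrite invr_gt0.
  by rewrite invrK mul1r -ler_pdivrMr ?exprn_gt0// ltW.
- move=> I iI Ij; elim: n {hn ND'} => [|n IH] /=; first by rewrite subrr; exact: (ideal0 iI).
  have -> : e - D ** pow D n = (e - pow D n) + g ** pow D n.
    by rewrite {1}/D amulDl salgNl (uc1l uc); nc R B.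
  apply: (idealD iI) => //; rewrite /g; apply: (idealMr iI); apply: (idealZ iI); exact: (idealMr iI).
Qed.
End uc.

(** * Completion of a positive semidefinite hermitian form *)

Definition cabs (R : realType) (z : R[i]) : R := complex.Re `|z|.

Section cabs.
Variable R : realType.
Implicit Types (z w : R[i]).

Lemma cabsE z : (cabs z)%:C = `|z|.
Proof. by rewrite /cabs RRe_real// ger0_real. Qed.

Lemma cabs_ge0 z : 0 <= cabs z.
Proof. by rewrite -ler0c cabsE. Qed.

Lemma cabsD z w : cabs (z + w) <= cabs z + cabs w.
Proof. by rewrite -lecR rmorphD /= !cabsE ler_normD. Qed.

Lemma cabsM z w : cabs (z * w) = cabs z * cabs w.
Proof. by apply: complexI; rewrite rmorphM /= !cabsE normrM. Qed.

Lemma cabsN z : cabs (- z) = cabs z.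
Proof. by rewrite /cabs normrN. Qed.

Lemma cabsC z w : cabs (z - w) = cabs (w - z).
Proof. by rewrite /cabs distrC. Qed.

Lemma cabs_conj z : cabs (Num.conj z) = cabs z.
Proof. by rewrite /cabs norm_conjC. Qed.

Lemma cabs_real (r : R) : cabs r%:C = `|r|.
Proof. exact: Re_normr_real. Qed.

Lemma cabs0 : cabs (0 : R[i]) = 0.
Proof. by rewrite /cabs normr0. Qed.

Lemma cabs_eq0 z : cabs z = 0 -> z = 0.
Proof. by move=> h; apply/eqP; rewrite -normr_eq0 -cabsE h. Qed.

Lemma cabs_le0 z : (forall eps, 0 < eps -> cabs z <= eps) -> z = 0.
Proof.
move=> h; apply: cabs_eq0; apply/eqP; rewrite eq_le cabs_ge0 andbT.
by apply/ler_addgt0Pr => eps eps0; rewrite add0r h.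
Qed.

Lemma Re_le_cabs z : `|complex.Re z| <= cabs z.
Proof. by rewrite -lecR cabsE normc_ge_Re. Qed.

Lemma cabs_sq z : z * Num.conj z = (cabs z ^+ 2)%:C.
Proof. by rewrite rmorphXn /= cabsE normCK. Qed.

Lemma conjCM z w : Num.conj (z * w) = Num.conj z * Num.conj w.
Proof. exact: rmorphM. Qed.

Lemma Re_conjc z : complex.Re (Num.conj z) = complex.Re z.
Proof. by case: z. Qed.

Lemma cabs_triangle z w v : cabs (z - v) <= cabs (z - w) + cabs (w - v).
Proof. by have := cabsD (z - w) (w - v); rewrite addrA subrK. Qed.

Lemma cabs_i : cabs ('i%C : R[i]) = 1.
Proof. by rewrite /cabs normc_def /= expr0n add0r expr1n sqrtr1. Qed.

Lemma cabs_le_ReIm z : cabs z <= `|complex.Re z| + `|complex.Im z|.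
Proof.
rewrite {1}(complexE z); apply: (le_trans (cabsD _ _)).
by rewrite cabsM !cabs_real cabs_i mul1r.
Qed.

Lemma Im_le_cabs z : `|complex.Im z| <= cabs z.
Proof.
rewrite -[cabs z]mulr1 -cabs_i -cabsM; apply: le_trans (Re_le_cabs _).
by rewrite ReiNIm normrN.
Qed.

Definition clim_to (u : nat -> R[i]) z := forall eps, 0 < eps ->
  exists n0, forall n, (n0 <= n)%N -> cabs (u n - z) <= eps.

(** The default [0] is harmless: limits are taken of Cauchy sequences only. *)
Definition clim u : R[i] := xget 0 [set z | clim_to u z].

Definition ccauchy (u : nat -> R[i]) := forall eps, 0 < eps ->
  exists n0, forall m n, (n0 <= m)%N -> (n0 <= n)%N -> cabs (u m - u n) <= eps.

Lemma real_cauchy (u : nat -> R) : (forall eps, 0 < eps -> exists n0,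
    forall m n, (n0 <= m)%N -> (n0 <= n)%N -> `|u m - u n| <= eps) ->
  exists l, forall eps, 0 < eps -> exists n0, forall n, (n0 <= n)%N -> `|u n - l| <= eps.
Proof.
move=> cu; have : cauchy (u @ \oo).
  apply: cauchy_exP => eps eps0; have [n0 h] := cu (eps / 2) ltac:(lra).
  exists (u n0); exists n0 => // n /= hn; rewrite /ball /=.
  by have := h _ _ (leqnn n0) hn; lra.
move=> cauchy_u; have : cvg (u @ \oo) by exact: R_complete.
move=> /cvg_ex[l /cvgrPdist_le ul]; exists l => eps /ul[n0 _ h].
by exists n0 => n /h; rewrite distrC.
Qed.

Lemma clim_ex u : ccauchy u -> clim_to u (clim u).
Proof.
move=> cu; suff ex : exists z, clim_to u z by exact: (xgetPex 0 ex).
have [|a ha] := @real_cauchy (fun n => complex.Re (u n)).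
  move=> eps /cu[n0 h]; exists n0 => m n hm hn.
  by apply: le_trans (h m n hm hn); rewrite -raddfB /=; exact: Re_le_cabs.
have [|b hb] := @real_cauchy (fun n => complex.Im (u n)).
  move=> eps /cu[n0 h]; exists n0 => m n hm hn.
  by apply: le_trans (h m n hm hn); rewrite -raddfB /=; exact: Im_le_cabs.
exists (a +i* b)%C => eps eps0.
have [n0 h] := ha (eps / 2) ltac:(lra); have [n1 h'] := hb (eps / 2) ltac:(lra).
exists (maxn n0 n1) => n; rewrite geq_max => /andP[/h h1 /h' h2].
apply: (le_trans (cabs_le_ReIm _)); rewrite !raddfB /=; lra.
Qed.

Lemma clim_unique u z w : clim_to u z -> clim_to u w -> z = w.
Proof.
move=> uz uw; apply/eqP; rewrite -subr_eq0; apply/eqP/cabs_le0 => eps eps0.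
have [n0 h] := uz (eps / 2) ltac:(lra); have [n1 h'] := uw (eps / 2) ltac:(lra).
have := h _ (leq_maxl n0 n1); have := h' _ (leq_maxr n0 n1).
have := cabs_triangle z (u (maxn n0 n1)) w; rewrite (cabsC z (u _)); lra.
Qed.

Lemma climE u z : clim_to u z -> clim u = z.
Proof.
by move=> uz; apply: (clim_unique _ uz); apply: (xgetPex 0); exists z.
Qed.

Lemma clim_lin u v z w (k : R[i]) : clim_to u z -> clim_to v w ->
  clim_to (fun n => k * u n + v n) (k * z + w).
Proof.
move=> uz vw eps eps0; have k1 : 0 < cabs k + 1 by have := cabs_ge0 k; lra.
have [n0 h] := uz (eps / 2 / (cabs k + 1)) ltac:(by rewrite divr_gt0//; lra).
have [n1 h'] := vw (eps / 2) ltac:(lra).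
exists (maxn n0 n1) => n; rewrite geq_max => /andP[/h h1 /h' h2].
have -> : k * u n + v n - (k * z + w) = k * (u n - z) + (v n - w) by ring.
apply: (le_trans (cabsD _ _)); rewrite cabsM.
have : (cabs k + 1) * cabs (u n - z) <= eps / 2 by rewrite mulrC -ler_pdivlMr.
rewrite mulrDl mul1r; have := cabs_ge0 (u n - z); lra.
Qed.

Lemma clim_near u v z : clim_to u z -> (forall eps, 0 < eps ->
    exists n0, forall n, (n0 <= n)%N -> cabs (u n - v n) <= eps) -> clim_to v z.
Proof.
move=> uz uv eps eps0.
have [n0 h] := uz (eps / 2) ltac:(lra); have [n1 h'] := uv (eps / 2) ltac:(lra).
exists (maxn n0 n1) => n; rewrite geq_max => /andP[/h h1 /h' h2].
have := cabs_triangle (v n) (u n) z; rewrite (cabsC (v n) (u n)); lra.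
Qed.

Lemma clim_conj u z : clim_to u z -> clim_to (fun n => Num.conj (u n)) (Num.conj z).
Proof.
by move=> uz eps /uz[n0 h]; exists n0 => n /h; rewrite -rmorphB /= cabs_conj.
Qed.

Lemma inv_nat_small (eps : R) : 0 < eps -> exists n0, forall n, (n0 <= n)%N -> n.+1%:R^-1 <= eps.
Proof.
move=> eps0; exists (Num.truncn eps^-1).+1 => n hn.
rewrite -[leRHS]invrK lef_pV2 ?posrE ?invr_gt0//.
apply/ltW/(lt_le_trans (truncnS_gt _)); rewrite ler_nat; exact: leqW.
Qed.

End cabs.

Record psd_form (R : realType) (V : lmodType R[i]) (F : V -> V -> R[i]) : Prop := PsdForm {
  pfDZ : forall (k : R[i]) x y z, F (k *: x + y) z = k * F x z + F y z;
  pfC : forall x y, F y x = Num.conj (F x y);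
  pf_ge0 : forall x, 0 <= F x x
}.

Section psd.
Variables (R : realType) (V : lmodType R[i]) (F : V -> V -> R[i]).
Hypothesis hF : psd_form F.
Implicit Types (x y z : V) (k : R[i]).

Definition seminorm x : R := Num.sqrt (complex.Re (F x x)).

Lemma pf0l z : F 0 z = 0.
Proof. by have := pfDZ hF (-1) 0 0 z; rewrite scaler0 addr0 mulN1r addNr. Qed.

Lemma pfD x y z : F (x + y) z = F x z + F y z.
Proof. by have := pfDZ hF 1 x y z; rewrite scale1r mul1r. Qed.

Lemma pfZ k x z : F (k *: x) z = k * F x z.
Proof. by have := pfDZ hF k x 0 z; rewrite addr0 pf0l addr0. Qed.

Lemma pfN x z : F (- x) z = - F x z.
Proof. by rewrite -scaleN1r pfZ mulN1r. Qed.

Lemma pfDr x y z : F x (y + z) = F x y + F x z.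
Proof. by rewrite (pfC hF) pfD rmorphD /= -!(pfC hF). Qed.

Lemma pfZr k x z : F x (k *: z) = Num.conj k * F x z.
Proof. by rewrite (pfC hF) pfZ rmorphM /= -!(pfC hF). Qed.

Lemma pfNr x z : F x (- z) = - F x z.
Proof. by rewrite -scaleN1r pfZr rmorphN1 mulN1r. Qed.

Lemma seminorm_ge0 x : 0 <= seminorm x.
Proof. exact: sqrtr_ge0. Qed.

Lemma seminorm_sq x : (seminorm x ^+ 2)%:C = F x x.
Proof.
have := pf_ge0 hF x; rewrite /seminorm => h; rewrite sqr_sqrtr ?RRe_real ?ger0_real//.
by rewrite -lecR RRe_real ?ger0_real.
Qed.

Lemma cauchy_schwarz x y : cabs (F x y) <= seminorm x * seminorm y.
Proof.
set c := cabs (F x y); set a := seminorm x; set b := seminorm y.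
have c0 : 0 <= c := cabs_ge0 _.
have [a0 b0] : 0 <= a /\ 0 <= b by split; exact: seminorm_ge0.
have key (t : R) : 0 <= a ^+ 2 - 2 * t * c ^+ 2 + t ^+ 2 * c ^+ 2 * b ^+ 2.
  rewrite -lecR; pose k := t%:C * F x y.
  have := pf_ge0 hF (x - k *: y); congr (_ <= _).
  rewrite pfD !pfDr pfN !pfNr pfN pfZ !pfZr pfZ -!seminorm_sq -/a -/b (pfC hF x y).
  have cc := cabs_sq (F x y); rewrite -/c in cc.
  rewrite /k conjCM conj_real; move: cc; set z := F x y; set w := Num.conj z => cc.
  move: cc; move: (c ^+ 2) (a ^+ 2) (b ^+ 2) => c2 a2 b2 cc.
  rewrite expr2 rmorphD rmorphB /= !rmorphM /= -cc rmorph_nat; ring.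
rewrite leNgt; apply/negP => lt.
have cp : 0 < c by apply: le_lt_trans lt; exact: mulr_ge0.
have c2 : 0 < c ^+ 2 by exact: exprn_gt0.
(* The form may be degenerate. If [y] has seminorm zero, the quadratic in [key] is affine in [t] and
   the chosen [t] gives it the value [-1]; otherwise [t = b ^ -2] minimises it. *)
have [b00|bN0] := eqVneq b 0.
  have := key ((a ^+ 2 + 1) / (2 * c ^+ 2)).
  rewrite b00 expr0n /= mulr0 addr0.
  have -> : 2 * ((a ^+ 2 + 1) / (2 * c ^+ 2)) * c ^+ 2 = a ^+ 2 + 1 by field; rewrite gt_eqF.
  lra.
have := key (b ^- 2).
have -> : a ^+ 2 - 2 * b ^- 2 * c ^+ 2 + b ^- 2 ^+ 2 * c ^+ 2 * b ^+ 2 = a ^+ 2 - c ^+ 2 / b ^+ 2.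
  by field.
have b2 : 0 < b ^+ 2 by rewrite exprn_gt0// lt_neqAle eq_sym bN0.
rewrite subr_ge0 ler_pdivrMr// -exprMn => h.
have : (a * b) ^+ 2 < c ^+ 2 by rewrite ltr_pXn2r// ?nnegrE// mulr_ge0.
lra.
Qed.

Lemma seminormD x y : seminorm (x + y) <= seminorm x + seminorm y.
Proof.
rewrite -(@ler_pXn2r _ 2)// ?nnegrE ?addr_ge0 ?seminorm_ge0//.
rewrite -lecR seminorm_sq pfD !pfDr -!seminorm_sq (pfC hF x y).
have E : F x y + Num.conj (F x y) = (2 * complex.Re (F x y))%:C.
  by rewrite rmorphM /= rmorph_nat -addcJ; case: (F x y).
have -> : (seminorm x ^+ 2)%:C + F x y + (Num.conj (F x y) + (seminorm y ^+ 2)%:C) =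
  (seminorm x ^+ 2 + 2 * complex.Re (F x y) + seminorm y ^+ 2)%:C.
  by rewrite !rmorphD /= -E; ring.
rewrite lecR sqrrD; have := cauchy_schwarz x y; have := Re_le_cabs (F x y).
have := ler_norm (complex.Re (F x y)).
rewrite -mulr_natl; lra.
Qed.

Lemma seminormZ k x : seminorm (k *: x) = cabs k * seminorm x.
Proof.
rewrite [LHS]/seminorm pfZ pfZr mulrA cabs_sq -seminorm_sq -rmorphM /=.
by rewrite /= -exprMn sqrtr_sqr ger0_norm ?mulr_ge0 ?cabs_ge0 ?seminorm_ge0.
Qed.

Lemma seminorm_le_of_sq x r : 0 <= r -> cabs (F x x) <= r * seminorm x -> seminorm x <= r.
Proof.
move=> r0; rewrite -seminorm_sq cabs_real ger0_norm ?sqr_ge0// expr2 => h.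
have [s0|s0] := ltP 0 (seminorm x); first by rewrite -(ler_pM2r s0).
exact: le_trans r0.
Qed.

End psd.

Section completion.
Variables (R : realType) (V : lmodType R[i]) (F : V -> V -> R[i]).

(* The completion is realised inside the anti-dual of [V]: it consists of the
   functions [h] on [V] that are limits, uniformly on the unit ball of the
   seminorm, of the functions [F w]. *)
Definition approximates (h : V -> R[i]^o) (eps : R) (w : V) :=
  forall v, cabs (h v - F w v) <= eps * seminorm F v.

Definition completion_pred (hF : psd_form F) : {pred V -> R[i]^o} :=
  fun h => `[< forall eps, 0 < eps -> exists w, approximates h eps w >].

Lemma completion_submod (hF : psd_form F) : submod_closed (completion_pred hF).
Proof.
split.
  apply/asboolP => eps eps0; exists 0 => v.
  have -> : (0 : V -> R[i]^o) v - F 0 v = 0 by rewrite pf0l// subr0.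
  by rewrite cabs0 mulr_ge0 ?seminorm_ge0// ltW.
move=> k g h /asboolP gP /asboolP hP; apply/asboolP => eps eps0.
have k1 : 0 < cabs k + 1 by have := cabs_ge0 k; lra.
have [w gw] := gP (eps / 2 / (cabs k + 1)) ltac:(by rewrite divr_gt0//; lra).
have [z hz] := hP (eps / 2) ltac:(lra).
exists (k *: w + z) => v; rewrite (pfDZ hF).
have -> : (k *: g + h) v - (k * F w v + F z v) = k * (g v - F w v) + (h v - F z v).
  by change ((k *: g + h) v) with (k * g v + h v); ring.
apply: (le_trans (cabsD _ _)); rewrite cabsM.
have s0 := seminorm_ge0 F v.
have h1 := gw v; have h2 := hz v.
have : (cabs k + 1) * cabs (g v - F w v) <= eps / 2 * seminorm F v.
  by rewrite -ler_pdivlMl// mulrA (mulrC _ (eps / 2)).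
rewrite mulrDl mul1r; have := cabs_ge0 (g v - F w v); lra.
Qed.

HB.instance Definition _ (hF : psd_form F) :=
  GRing.isSubmodClosed.Build _ _ (completion_pred hF) (completion_submod hF).

Record completion (hF : psd_form F) := Completion {
  completion_fun :> V -> R[i]^o;
  completionP : completion_fun \in completion_pred hF
}.

HB.instance Definition _ hF := [isSub for @completion_fun hF].
HB.instance Definition _ hF := [Choice of completion hF by <:].
HB.instance Definition _ hF := [SubChoice_isSubLmodule of completion hF by <:].

End completion.

Section completion_inner.
Variables (R : realType) (V : lmodType R[i]) (F : V -> V -> R[i]).
Hypothesis hF : psd_form F.
Local Notation H := (completion hF).
Local Notation sn := (seminorm F).
Implicit Types (g h : H) (u v w : V) (k : R[i]).

Lemma completion_approx h eps : 0 < eps -> exists w, approximates F h eps w.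
Proof. by move=> eps0; have /asboolP := completionP h; exact. Qed.

Lemma completion_eq g h : (forall v, g v = h v) -> g = h.
Proof. by move=> gh; apply/val_inj/funext. Qed.

Lemma embed_in v : (F v : V -> R[i]^o) \in completion_pred hF.
Proof.
apply/asboolP => eps eps0; exists v => w.
by rewrite subrr cabs0 mulr_ge0 ?seminorm_ge0// ltW.
Qed.

Definition embed v : H := Completion (embed_in v).

Lemma completionDZ k g h v : (k *: g + h) v = k * g v + h v.
Proof. by []. Qed.

Lemma approx_seq_ex h : exists w : nat -> V, forall n, approximates F h n.+1%:R^-1 (w n).
Proof.
have /boolp.choice[w hw] : forall n, exists w, approximates F h n.+1%:R^-1 w.
  by move=> n; exact: completion_approx.
by exists w.
Qed.

Definition approx_seq h : nat -> V := projT1 (cid (approx_seq_ex h)).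

Lemma approx_seqP h n v : cabs (h v - F (approx_seq h n) v) <= n.+1%:R^-1 * sn v.
Proof. exact: (projT2 (cid (approx_seq_ex h)) n v). Qed.

Lemma inv_nat_scaled (C eps : R) : 0 <= C -> 0 < eps ->
  exists n0, forall n, (n0 <= n)%N -> n.+1%:R^-1 * C <= eps.
Proof.
move=> C0 eps0; have C1 : 0 < C + 1 by lra.
have [n0 h] := inv_nat_small (divr_gt0 eps0 C1); exists n0 => n /h.
rewrite ler_pdivlMr//; apply: le_trans; rewrite ler_wpM2l ?invr_ge0//; lra.
Qed.

Lemma approx_lim h v : clim_to (fun n => F (approx_seq h n) v) (h v).
Proof.
move=> eps eps0; have [n0 hn] := inv_nat_scaled (seminorm_ge0 F v) eps0.
by exists n0 => n /hn; rewrite cabsC; apply: le_trans; exact: approx_seqP.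
Qed.

Lemma completionZD h k u v : h (k *: u + v) = Num.conj k * h u + h v.
Proof.
apply: (clim_unique (approx_lim h _)).
have := clim_lin (Num.conj k) (approx_lim h u) (approx_lim h v).
by congr clim_to; apply/funext => n; rewrite pfDr// pfZr.
Qed.

Lemma completionB h u v : h (u - v) = h u - h v.
Proof.
by have := completionZD h (-1) v u; rewrite rmorphN1 scaleN1r addrC => ->; rewrite mulN1r addrC.
Qed.

Lemma approx_seq_cauchy h m n :
  sn (approx_seq h m - approx_seq h n) <= m.+1%:R^-1 + n.+1%:R^-1.
Proof.
set u := _ - _; apply: (seminorm_le_of_sq hF); first by rewrite addr_ge0// invr_ge0.
have -> : F u u = (F (approx_seq h m) u - h u) + (h u - F (approx_seq h n) u).
  by rewrite [in LHS]/u pfD// pfN// addrA subrK.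
apply: (le_trans (cabsD _ _)); rewrite cabsC mulrDl.
by apply: lerD; exact: approx_seqP.
Qed.

Lemma completion_bounded h : exists2 C, 0 <= C & forall v, cabs (h v) <= C * sn v.
Proof.
exists (1 + sn (approx_seq h 0)); first by rewrite addr_ge0// seminorm_ge0.
move=> v; have := approx_seqP h 0 v; rewrite invr1.
have := cauchy_schwarz hF (approx_seq h 0) v.
have := cabsD (h v - F (approx_seq h 0) v) (F (approx_seq h 0) v).
rewrite subrK; lra.
Qed.

Lemma approx_seq_bounded h : exists2 C, 0 <= C & forall n, sn (approx_seq h n) <= C.
Proof.
exists (2 + sn (approx_seq h 0)); first by rewrite addr_ge0// seminorm_ge0.
move=> n; have := seminormD hF (approx_seq h n - approx_seq h 0) (approx_seq h 0).
rewrite subrK; have := approx_seq_cauchy h n 0; rewrite invr1.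
have : (n.+1%:R^-1 : R) <= 1 by rewrite invf_le1// ler1n.
set c := (n.+1%:R^-1 : R); set a := sn _; set b := sn _; set d := sn _. lra.
Qed.

(** Only [h] is approximated, which makes linearity in [g] immediate; the symmetric description,
    with both arguments approximated, is [cinner_near]. *)
Definition cinner g h : R[i] := clim (fun n => g (approx_seq h n)).

Lemma cinner_lim g h : clim_to (fun n => g (approx_seq h n)) (cinner g h).
Proof.
apply: clim_ex => eps eps0; have [C C0 hC] := completion_bounded g.
have e2 : 0 < eps / 2 by lra.
have [n0 hn] := inv_nat_scaled C0 e2; exists n0 => m n /hn hm /hn hn'.
rewrite -completionB; apply: (le_trans (hC _)).
have := ler_wpM2l C0 (approx_seq_cauchy h m n); rewrite mulrDr.
rewrite !(mulrC C); move: hm hn'; move: (_ * C) (_ * C) => a b; lra.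
Qed.

Lemma cinnerDZ k g h l : cinner (k *: g + h) l = k * cinner g l + cinner h l.
Proof.
by apply: climE; have := clim_lin k (cinner_lim g l) (cinner_lim h l).
Qed.

Lemma cinner_near g h : clim_to (fun n => F (approx_seq g n) (approx_seq h n)) (cinner g h).
Proof.
apply: (clim_near (cinner_lim g h)) => eps eps0.
have [C C0 hC] := approx_seq_bounded h.
have [n0 hn] := inv_nat_scaled C0 eps0; exists n0 => n /hn; apply: le_trans.
by apply: (le_trans (approx_seqP _ _ _)); rewrite ler_wpM2l ?invr_ge0.
Qed.

Lemma cinnerC g h : cinner h g = Num.conj (cinner g h).
Proof.
apply: (clim_unique (cinner_near h g)).
have := clim_conj (cinner_near g h).
by congr clim_to; apply/funext => n; rewrite -(pfC hF).
Qed.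

Lemma cinner_ge0 h : 0 <= cinner h h.
Proof.
have l := cinner_near h h.
have cE : Num.conj (cinner h h) = cinner h h by rewrite -cinnerC.
have real_h : cinner h h \is Num.real by apply/CrealP.
rewrite -(RRe_real real_h) ler0c leNgt; apply/negP => lt.
have [n0 /(_ _ (leqnn _))] := l (- complex.Re (cinner h h) / 2) ltac:(lra).
set z := F _ _; have z0 : 0 <= z by exact: (pf_ge0 hF).
have := Re_le_cabs (z - cinner h h); rewrite raddfB /=.
have : 0 <= complex.Re z by rewrite -ler0c RRe_real// ger0_real.
move=> h1 h2; rewrite ger0_norm in h2; lra.
Qed.

Lemma cinner_psd : psd_form cinner.
Proof.
by split; [move=> *; exact: cinnerDZ|move=> *; exact: cinnerC|exact: cinner_ge0].
Qed.

Lemma cinner_embed g v : cinner g (embed v) = g v.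
Proof.
apply: climE => eps eps0; have [C C0 hC] := completion_bounded g.
have [n0 hn] := inv_nat_scaled C0 eps0; exists n0 => n /hn; apply: le_trans.
rewrite -completionB; apply: (le_trans (hC _)); rewrite mulrC ler_wpM2r//.
apply: (seminorm_le_of_sq hF); first by rewrite invr_ge0.
rewrite pfD// pfN// cabsC; have := approx_seqP (embed v) n; exact.
Qed.

Definition cnorm h : R[i] := (seminorm cinner h)%:C.

Lemma cnorm_eq0 h : cnorm h = 0 -> h = 0.
Proof.
move=> /complexI h0; apply: completion_eq => v.
have := cauchy_schwarz cinner_psd h (embed v); rewrite h0 mul0r cinner_embed => hv.
by apply: cabs_eq0; apply/eqP; rewrite eq_le hv cabs_ge0.
Qed.

Lemma cnormD g h : cnorm (g + h) <= cnorm g + cnorm h.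
Proof. by rewrite /cnorm -rmorphD lecR; exact: seminormD cinner_psd _ _. Qed.

Lemma cnormZ k h : cnorm (k *: h) = `|k| * cnorm h.
Proof. by rewrite /cnorm seminormZ ?rmorphM /= ?cabsE//; exact: cinner_psd. Qed.

(** Evaluating [h] at its own approximants [W n] bounds [sn (W n)] by [eps + 1 / (n + 1)], and
    [cinner h h] is the limit of [h (W n)]. Thus uniform closeness on the unit ball is closeness in
    norm. *)
Lemma cnorm_le h eps : 0 <= eps -> (forall v, cabs (h v) <= eps * sn v) ->
  seminorm cinner h <= eps.
Proof.
move=> eps0 hb; pose W := approx_seq h.
have snW n : sn (W n) <= eps + n.+1%:R^-1.
  apply: (seminorm_le_of_sq hF); first by rewrite addr_ge0// invr_ge0.
  have := cabs_triangle (F (W n) (W n)) (h (W n)) 0; rewrite !subr0 => h1.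
  apply: (le_trans h1); rewrite addrC mulrDl; apply: lerD => //.
  by rewrite cabsC; exact: approx_seqP.
have le2 : cabs (cinner h h) <= eps ^+ 2.
  apply/ler_addgt0Pr => del del0; have d2 : 0 < del / 2 by lra.
  have [n0 h0] := cinner_lim h h d2; have [n1 h1] := inv_nat_scaled eps0 d2.
  pose n := maxn n0 n1; have := h0 n (leq_maxl _ _); have := h1 n (leq_maxr _ _).
  have := ler_wpM2l eps0 (snW n); rewrite mulrDr (mulrC eps n.+1%:R^-1).
  have := hb (W n); rewrite -/W cabsC; have := cabs_triangle (cinner h h) (h (W n)) 0.
  rewrite !subr0 expr2; move: (n.+1%:R^-1 * eps) (eps * sn (W n)) => a b; lra.
rewrite -(@ler_pXn2r _ 2)// ?nnegrE ?seminorm_ge0//.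
by move: le2; rewrite -seminorm_sq ?cabs_real ?ger0_norm ?sqr_ge0//; exact: cinner_psd.
Qed.

End completion_inner.

HB.instance Definition _ (R : realType) (V : lmodType R[i]) (F : V -> V -> R[i])
    (hF : psd_form F) :=
  Lmodule_isNormed.Build R[i] (completion hF) (@cnormD R V F hF) (@cnormZ R V F hF)
    (@cnorm_eq0 R V F hF).

(* The norm is complex valued in the hierarchy; [hnorm] is its real version. *)
Definition hnorm (R : realType) (H : normedModType R[i]) (x : H) : R := complex.Re `|x|.

Section hnorm.
Variables (R : realType) (H : normedModType R[i]).
Implicit Types (x y z : H).

Lemma hnormE x : (hnorm x)%:C = `|x|.
Proof. by rewrite /hnorm RRe_real// ger0_real. Qed.

Lemma hnorm_ge0 x : 0 <= hnorm x.
Proof. by rewrite -ler0c hnormE. Qed.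

Lemma hnormD x y : hnorm (x + y) <= hnorm x + hnorm y.
Proof. by rewrite -lecR rmorphD /= !hnormE ler_normD. Qed.

Lemma hnormZ k x : hnorm (k *: x) = cabs k * hnorm x.
Proof. by apply: complexI; rewrite rmorphM /= !hnormE cabsE normrZ. Qed.

Lemma hnormN x : hnorm (- x) = hnorm x.
Proof. by rewrite /hnorm normrN. Qed.

Lemma hnormC x y : hnorm (x - y) = hnorm (y - x).
Proof. by rewrite /hnorm distrC. Qed.

Lemma hnorm0 : hnorm (0 : H) = 0.
Proof. by rewrite /hnorm normr0. Qed.

Lemma hnorm_eq0 x : hnorm x = 0 -> x = 0.
Proof. by move=> h; apply/eqP; rewrite -normr_eq0 -hnormE h. Qed.

Lemma hnorm_le0 x : (forall eps, 0 < eps -> hnorm x <= eps) -> x = 0.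
Proof.
move=> h; apply: hnorm_eq0; apply/eqP; rewrite eq_le hnorm_ge0 andbT.
by apply/ler_addgt0Pr => eps eps0; rewrite add0r h.
Qed.

Lemma hnorm_triangle x y z : hnorm (x - z) <= hnorm (x - y) + hnorm (y - z).
Proof. by have := hnormD (x - y) (y - z); rewrite addrA subrK. Qed.

Lemma hnorm_le_add x y : hnorm x <= hnorm (x - y) + hnorm y.
Proof. by have := hnormD (x - y) y; rewrite subrK. Qed.

Lemma hnorm_nbhs x (U : set H) : nbhs x U <->
  exists2 eps, 0 < eps & forall y, hnorm (x - y) <= eps -> U y.
Proof.
split=> [/nbhs_ballP[e /= e0 eU]|[eps eps0 h]].
  have e_real : e \is Num.real by exact: gtr0_real.
  have Re0 : 0 < complex.Re e by rewrite -ltcR RRe_real.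
  exists (complex.Re e / 2); first by rewrite divr_gt0.
  move=> y hy; apply: eU; rewrite -ball_normE /= -hnormE -(RRe_real e_real) ltcR; lra.
apply/nbhs_ballP; exists eps%:C; rewrite /= ?ltcR//.
by move=> y; rewrite -ball_normE /= -hnormE ltcR => /ltW; exact: h.
Qed.

Lemma hnorm_closure (S : set H) x : closure S x <->
  forall eps, 0 < eps -> exists2 y, S y & hnorm (x - y) <= eps.
Proof.
split=> [cl eps eps0|h U /hnorm_nbhs[eps eps0 hU]].
  have [|y [Sy hy]] := cl [set y | hnorm (x - y) <= eps]; last by exists y.
  by apply/hnorm_nbhs; exists eps.
by have [y Sy hy] := h _ eps0; exists y; split=> //; exact: hU.
Qed.

End hnorm.

Lemma hnorm_continuous (R : realType) (H K : normedModType R[i]) (f : H -> K) :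
  (exists C, forall x y, hnorm (f x - f y) <= C * hnorm (x - y)) -> continuous f.
Proof.
move=> [C hC] x U nU; have [eps eps0 hU] := (hnorm_nbhs _ _).1 nU.
suff : nbhs x (f @^-1` U) by [].
apply/hnorm_nbhs.
have C1 : 0 < `|C| + 1 by have := normr_ge0 C; lra.
exists (eps / (`|C| + 1)); first exact: divr_gt0.
move=> y hy; apply: hU; apply: (le_trans (hC _ _)).
have : C * hnorm (x - y) <= (`|C| + 1) * hnorm (x - y).
  by apply: ler_wpM2r; [exact: hnorm_ge0|have := ler_norm C; lra].
have := hy; rewrite ler_pdivlMr// mulrC; lra.
Qed.

Lemma hnorm_complete (R : realType) (H : completeNormedModType R[i]) (u : nat -> H) :
  (forall eps, 0 < eps -> exists n0, forall m n, (n0 <= m)%N -> (n0 <= n)%N ->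
    hnorm (u m - u n) <= eps) ->
  exists l, forall eps, 0 < eps -> exists n0, forall n, (n0 <= n)%N -> hnorm (u n - l) <= eps.
Proof.
move=> cu; have cu' : cauchy (u @ \oo).
  apply: cauchy_exP => eps eps0.
  have e_real : eps \is Num.real by exact: gtr0_real.
  have Re0 : 0 < complex.Re eps by rewrite -ltcR RRe_real.
  have [n0 h] := cu (complex.Re eps / 2) ltac:(lra).
  exists (u n0); exists n0 => // n /= hn.
  rewrite -ball_normE /= -hnormE -(RRe_real e_real) ltcR.
  by have := h _ _ (leqnn n0) hn; lra.
have : cvg (u @ \oo) by exact: cauchy_cvg.
move=> /cvg_ex[l ul]; exists l => eps eps0.
have /ul[n0 _ h] : nbhs l [set y | hnorm (l - y) <= eps] by apply/hnorm_nbhs; exists eps.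
by exists n0 => n /h /=; rewrite hnormC.
Qed.

Section completion_complete.
Variables (R : realType) (V : lmodType R[i]) (F : V -> V -> R[i]).
Hypothesis hF : psd_form F.
Local Notation H := (completion hF).
Implicit Types (g h : H) (v w : V).

Lemma completion_normE h : hnorm h = seminorm (@cinner R V F hF) h.
Proof. by []. Qed.

Lemma completion_norm_le h eps : 0 <= eps ->
  (forall v, cabs (h v) <= eps * seminorm F v) -> hnorm h <= eps.
Proof. exact: cnorm_le. Qed.

Lemma completion_eval_le h v : cabs (h v) <= hnorm h * seminorm F v.
Proof.
have := cauchy_schwarz (cinner_psd hF) h (embed hF v); rewrite cinner_embed.
congr (_ <= _ * _); rewrite /seminorm cinner_embed //.
Qed.

Lemma completion_dense h eps : 0 < eps -> exists w, hnorm (h - embed hF w) <= eps.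
Proof.
move=> eps0; have [w hw] := completion_approx h eps0; exists w.
by apply: completion_norm_le; [exact: ltW|exact: hw].
Qed.

(** The filter contains a ball of radius [1 / (n + 1)] around some [u n]. The functions [u n]
    converge uniformly on the unit ball of the seminorm, so their limit [l] is again approximable by
    elements of [V]. *)
Lemma completion_complete (G : set_system H) : ProperFilter G -> cauchy G -> cvg G.
Proof.
move=> PG cG.
have /boolp.choice[u hu] : forall n : nat, exists x : H, G [set y | hnorm (x - y) <= n.+1%:R^-1].
  move=> n; have e0 : (0 : R[i]) < (n.+1%:R^-1)%:C by rewrite ltcR invr_gt0.
  have cex : cauchy_ex G by exact/cauchyP.
  have [x Gx] := cex _ e0; exists x.
  apply: filterS Gx => y; rewrite -ball_normE /= -hnormE ltcR; exact: ltW.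
have hd m n : hnorm (u m - u n) <= m.+1%:R^-1 + n.+1%:R^-1.
  have [y [h1 h2]] := filter_ex (filterI (hu m) (hu n)).
  have := hnorm_triangle (u m) y (u n); rewrite (hnormC y).
  by move=> h; apply: (le_trans h); exact: lerD.
have /boolp.choice[w hw] : forall n, exists w, approximates F (u n) n.+1%:R^-1 w.
  by move=> n; apply: completion_approx.
have cv v : ccauchy (fun n => u n v).
  move=> eps eps0; have e2 : 0 < eps / 2 by lra.
  have [n0 hn] := inv_nat_scaled (seminorm_ge0 F v) e2; exists n0 => m n /hn hm /hn hn'.
  have := completion_eval_le (u m - u n) v.
  have -> : (u m - u n) v = u m v - u n v by [].
  move=> h; apply: (le_trans h); apply: le_trans (_ : (m.+1%:R^-1 + n.+1%:R^-1) * seminorm F v <= _).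
    by apply: ler_wpM2r => //; exact: seminorm_ge0.
  rewrite mulrDl; move: hm hn'; set a := m.+1%:R^-1 * _; set b := n.+1%:R^-1 * _; lra.
pose l v : R[i]^o := clim (fun n => u n v).
have ul n v : cabs (u n v - l v) <= n.+1%:R^-1 * seminorm F v.
  apply/ler_addgt0Pr => eps eps0; have e2 : 0 < eps / 2 by lra.
  have [n0 h0] := clim_ex (cv v) e2.
  have [n1 h1] := inv_nat_scaled (seminorm_ge0 F v) e2.
  pose m := maxn n0 n1; have := h0 m (leq_maxl _ _); have := h1 m (leq_maxr _ _).
  have := cabs_triangle (u n v) (u m v) (l v).
  have : cabs (u n v - u m v) <= (n.+1%:R^-1 + m.+1%:R^-1) * seminorm F v.
    apply: (le_trans (completion_eval_le (u n - u m) v)).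
    by apply: ler_wpM2r => //; exact: seminorm_ge0.
  rewrite mulrDl -/(l v); set a := m.+1%:R^-1 * _; set b := n.+1%:R^-1 * _; lra.
have lin : l \in completion_pred hF.
  apply/asboolP => eps eps0.
  have e2 : 0 < eps / 2 by lra.
  have [n0 /(_ _ (leqnn _)) hn] := inv_nat_small e2.
  exists (w n0) => v; have := cabs_triangle (l v) (u n0 v) (F (w n0) v).
  have := hw n0 v; have := ul n0 v; rewrite (cabsC (l v) (u n0 v)).
  have s0 := seminorm_ge0 F v; have := ler_wpM2r s0 hn.
  set a := n0.+1%:R^-1 * _; lra.
apply/cvg_ex; exists (Completion lin) => U /hnorm_nbhs[eps eps0 hU].
have e2 : 0 < eps / 2 by lra.
have [n0 /(_ _ (leqnn _)) hn] := inv_nat_small e2.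
apply: filterS (hu n0) => y hy; apply: hU.
have h1 : hnorm (u n0 - Completion lin) <= n0.+1%:R^-1.
  by apply: completion_norm_le; [rewrite invr_ge0|exact: ul].
have := hnorm_triangle (Completion lin) (u n0) y; rewrite (hnormC (Completion lin) (u n0)).
have hy' : hnorm (u n0 - y) <= n0.+1%:R^-1 := hy.
move: h1 hy' hn; set a := n0.+1%:R^-1; move: (hnorm _) (hnorm (u n0 - y)) (hnorm _) => b c d; lra.
Qed.

HB.instance Definition _ := Uniform_isComplete.Build H completion_complete.

Lemma cinner_norm h : cinner h h = `|h| ^+ 2.
Proof. by rewrite -hnormE completion_normE -rmorphXn /= seminorm_sq//; exact: cinner_psd. Qed.

HB.instance Definition _ := NormedModule_isHilbert.Build R H
  (@cinnerDZ R V F hF) (@cinnerC R V F hF) cinner_norm.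

End completion_complete.

(** * Hilbert spaces *)

Section hilbert.
Variables (R : realType) (H : hilbertType R).
Implicit Types (x y z : H) (k : R[i]).

Lemma inner_psd : psd_form (@inner R H).
Proof.
split; [exact: innerDZl|exact: innerC|].
by move=> x; rewrite inner_norm exprn_ge0.
Qed.

Definition innerD := pfD inner_psd.
Definition innerN := pfN inner_psd.
Definition innerZ := pfZ inner_psd.
Definition innerDr := pfDr inner_psd.
Definition innerNr := pfNr inner_psd.
Definition innerZr := pfZr inner_psd.
Definition inner0l := pf0l inner_psd.

Lemma hnorm_sq x : (hnorm x ^+ 2)%:C = inner x x.
Proof. by rewrite rmorphXn /= hnormE inner_norm. Qed.

Lemma Re_inner_self x : complex.Re (inner x x) = hnorm x ^+ 2.
Proof. by rewrite -hnorm_sq. Qed.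

Lemma hilbert_seminorm x : seminorm (@inner R H) x = hnorm x.
Proof. by rewrite /seminorm Re_inner_self sqrtr_sqr ger0_norm// hnorm_ge0. Qed.

Lemma inner_CS x y : cabs (inner x y) <= hnorm x * hnorm y.
Proof. by rewrite -!hilbert_seminorm; exact: cauchy_schwarz inner_psd _ _. Qed.

Lemma inner_eq0 x : inner x x = 0 -> x = 0.
Proof.
rewrite -hnorm_sq => /complexI /eqP; rewrite sqrf_eq0 => /eqP; exact: hnorm_eq0.
Qed.

Lemma Re_innerC x y : complex.Re (inner x y) = complex.Re (inner y x).
Proof. by rewrite innerC Re_conjc. Qed.

Lemma hnorm_sqD x y :
  hnorm (x + y) ^+ 2 = hnorm x ^+ 2 + 2 * complex.Re (inner x y) + hnorm y ^+ 2.
Proof.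
rewrite -!Re_inner_self innerD !innerDr !raddfD /= (Re_innerC y x); ring.
Qed.

Lemma hnorm_sqB x y :
  hnorm (x - y) ^+ 2 = hnorm x ^+ 2 - 2 * complex.Re (inner x y) + hnorm y ^+ 2.
Proof. by rewrite hnorm_sqD hnormN innerNr raddfN /=; ring. Qed.

Lemma parallelogram x y :
  hnorm (x - y) ^+ 2 = 2 * hnorm x ^+ 2 + 2 * hnorm y ^+ 2 - hnorm (x + y) ^+ 2.
Proof. by rewrite hnorm_sqB hnorm_sqD; ring. Qed.

Section projection.
Variable K : set H.
Hypothesis cK : closed_subspace K.

Lemma csD x y : K x -> K y -> K (x + y).
Proof. by move=> Kx Ky; have := csDZ cK 1 Kx Ky; rewrite scale1r. Qed.

Lemma csZ k x : K x -> K (k *: x).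
Proof. by move=> Kx; have := csDZ cK k Kx (cs0 cK); rewrite addr0. Qed.

Lemma csB x y : K x -> K y -> K (x - y).
Proof. by move=> Kx Ky; apply: csD => //; rewrite -scaleN1r; exact: csZ. Qed.

Lemma cs_lim x : (forall eps, 0 < eps -> exists2 y, K y & hnorm (x - y) <= eps) -> K x.
Proof. by move=> h; apply: (cs_closed cK); apply/hnorm_closure. Qed.

Lemma projection_exists x : exists2 y, K y & forall z, K z -> inner (x - y) z = 0.
Proof.
pose S := [set r | exists2 z, K z & r = hnorm (x - z) ^+ 2].
have lbS : has_inf S.
  split; first by exists (hnorm (x - 0) ^+ 2), 0 => //; exact: cs0 cK.
  by exists 0 => _ [z _ ->]; exact: sqr_ge0.
pose d := inf S.
have dle z : K z -> d <= hnorm (x - z) ^+ 2.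
  by move=> Kz; apply: ge_inf; [exact: lbS.2|exists z].
have /boolp.choice[u hu] : forall n, exists z, K z /\ hnorm (x - z) ^+ 2 <= d + n.+1%:R^-1.
  move=> n; have [|_ [z Kz ->] lt] := @inf_adherent _ S n.+1%:R^-1 _ lbS.
    by rewrite invr_gt0.
  by exists z; split=> //; exact: ltW.
have cauchy_u m n : hnorm (u m - u n) ^+ 2 <= 2 * m.+1%:R^-1 + 2 * n.+1%:R^-1.
  have [Km hm] := hu m; have [Kn hn] := hu n.
  have := parallelogram (x - u n) (x - u m).
  have -> : x - u n - (x - u m) = u m - u n by lin R[i] H.
  move=> ->.
  have Kmid : K (2^-1 *: (u m + u n)) by apply/csZ/csD.
  have := dle _ Kmid.
  have -> : x - u n + (x - u m) = 2 *: (x - 2^-1 *: (u m + u n)).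
    by lin R[i] H; field.
  rewrite (hnormZ 2) exprMn.
  have -> : cabs (2 : R[i]) = 2 by rewrite -(rmorph_nat (real_complex R)) cabs_real ger0_norm.
  move: hm hn; set a := m.+1%:R^-1; set b := n.+1%:R^-1; lra.
have [|y uy] := @hnorm_complete R H u.
  move=> eps eps0; have e4 : 0 < eps ^+ 2 / 4 by rewrite divr_gt0// exprn_gt0.
  have [n0 h] := inv_nat_small e4; exists n0 => m n /h hm /h hn.
  rewrite -(@ler_pXn2r _ 2)// ?nnegrE ?hnorm_ge0 ?(ltW eps0)//.
  apply: (le_trans (cauchy_u m n)).
  by move: hm hn; set a := m.+1%:R^-1; set b := n.+1%:R^-1; lra.
have Ky : K y.
  apply: cs_lim => eps /uy[n0 /(_ _ (leqnn _)) h]; exists (u n0); first exact: (hu n0).1.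
  by rewrite hnormC.
have hy : hnorm (x - y) ^+ 2 <= d.
  apply/ler_addgt0Pr => eps eps0; pose M := 2 * hnorm (x - y) + 1.
  have M0 : 0 < M by rewrite /M; have := hnorm_ge0 (x - y); lra.
  pose del := Num.min 1 (eps / (2 * M)).
  have del0 : 0 < del by rewrite lt_min ltr01 divr_gt0// mulr_gt0.
  have [n0 h0] := uy _ del0; have e2 : 0 < eps / 2 by lra.
  have [n1 h1] := inv_nat_small e2; pose n := maxn n0 n1.
  have h2 := h0 n (leq_maxl _ _); have h3 := h1 n (leq_maxr _ _).
  have [_ h4] := hu n.
  have h5 : hnorm (x - y) <= hnorm (x - u n) + del.
    by apply: le_trans (hnorm_triangle _ (u n) _) _; rewrite lerD2l.
  have d1 : del <= 1 by rewrite ge_min lexx.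
  have d2 : del * M <= eps / 2.
    rewrite -ler_pdivlMr// -mulrA -invfM; rewrite ge_min; apply/orP; right; exact: lexx.
  have h6 := hnorm_ge0 (x - u n); have h7 := hnorm_ge0 (x - y).
  have h8 : hnorm (x - y) ^+ 2 <= hnorm (x - u n) ^+ 2 + del * M.
    have [le|lt] := leP (hnorm (x - y)) del.
      rewrite /M expr2; have : hnorm (x - y) * hnorm (x - y) <= del * hnorm (x - y).
        by rewrite ler_wpM2r.
      have := sqr_ge0 (hnorm (x - u n)); nra.
    have : (hnorm (x - y) - del) ^+ 2 <= hnorm (x - u n) ^+ 2.
      by rewrite ler_pXn2r// ?nnegrE; lra.
    rewrite /M; nra.
  move: h4 h3; set a := n.+1%:R^-1; lra.
exists y => // z Kz; set w := x - y.
have key (t : R) : 0 <= - (2 * t * cabs (inner w z) ^+ 2) + t ^+ 2 * (cabs (inner w z) * hnorm z) ^+ 2.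
  have Kyz : K (y + (t%:C * inner w z) *: z) by apply: csD => //; exact: csZ.
  have := le_trans hy (dle _ Kyz).
  rewrite opprD addrA -/w (hnorm_sqB w) hnormZ innerZr conjCM conj_real.
  rewrite -mulrA (mulrC (Num.conj _)) cabs_sq -rmorphM cabsM cabs_real.
  rewrite -mulrA exprMn real_normK ?num_real// /=; lra.
apply: cabs_eq0; apply/eqP; rewrite eq_le cabs_ge0 andbT leNgt; apply/negP => c0.
set c := cabs _ in key c0; pose b := hnorm z ^+ 2.
have b0 : 0 <= b by exact: sqr_ge0.
(* With this step length the variation of the squared distance is [- c ^ 2 (b + 2) / (b + 1) ^ 2];
   taking [b + 1] rather than [b] also covers [z = 0]. *)
have := key (b + 1)^-1; rewrite exprMn -/b.
have c2 : 0 < c ^+ 2 by exact: exprn_gt0.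
have -> : - (2 * (b + 1)^-1 * c ^+ 2) + (b + 1)^-1 ^+ 2 * (c ^+ 2 * b) =
  - (c ^+ 2 * (b + 2) / (b + 1) ^+ 2).
  by field; rewrite gt_eqF//; lra.
rewrite oppr_ge0 leNgt; apply/negP; rewrite negbK.
by rewrite divr_gt0// ?mulr_gt0// ?exprn_gt0//; lra.
Qed.

End projection.

Section dense.
Variable D : set H.
Hypothesis dD : forall z eps, 0 < eps -> exists2 d, D d & hnorm (z - d) <= eps.

Lemma dense_form_ge0 (T : H -> H) (C : R) : 0 <= C ->
  (forall x y, T (x - y) = T x - T y) -> (forall x, hnorm (T x) <= C * hnorm x) ->
  (forall d, D d -> 0 <= complex.Re (inner (T d) d)) ->
  forall z, 0 <= complex.Re (inner (T z) z).
Proof.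
move=> C0 TB TC TD z; apply/ler_addgt0Pr => eps eps0.
have nz := hnorm_ge0 z.
pose M := 2 * C * (hnorm z + 1) + 1.
have M0 : 0 < M by rewrite /M ltr_wpDl// !mulr_ge0//; lra.
pose del := Num.min 1 (eps / M).
have del0 : 0 < del by rewrite lt_min ltr01 divr_gt0.
have [w Dw hw] := dD z del0.
have d1 : del <= 1 by rewrite ge_min lexx.
have d2 : del * M <= eps by rewrite -ler_pdivlMr// ge_min lexx orbT.
have ew := TD _ Dw.
have -> : inner (T z) z = inner (T w) w + (inner (T (z - w)) z + inner (T w) (z - w)).
  by rewrite TB innerD innerN innerDr innerNr; ring.
set u := z - w in hw *; rewrite raddfD /=.
have h4 := Re_le_cabs (inner (T u) z + inner (T w) u).
have h3 := cabsD (inner (T u) z) (inner (T w) u).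
have h2 := inner_CS (T u) z; have h1 := inner_CS (T w) u.
have hu := TC u; have hT := TC w.
have nw : hnorm w <= hnorm z + 1.
  have -> : w = z - u by rewrite /u opprB addrC subrK.
  apply: le_trans (hnormD _ _) _; rewrite hnormN; lra.
have e1 : hnorm (T u) * hnorm z <= C * del * (hnorm z + 1).
  apply: ler_pM; rewrite ?hnorm_ge0//; last lra.
  by apply: le_trans hu _; exact: ler_wpM2l.
have e2 : hnorm (T w) * hnorm u <= C * (hnorm z + 1) * del.
  apply: ler_pM; rewrite ?hnorm_ge0//.
  by apply: le_trans hT _; exact: ler_wpM2l.
have := ler_norm (- complex.Re (inner (T u) z + inner (T w) u)).
rewrite normrN; move: d2; rewrite /M; lra.
Qed.

Lemma dense_adjoint (S T : H -> H) (C C' : R) :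
  (forall x y, T (x - y) = T x - T y) ->
  (forall x, hnorm (S x) <= C * hnorm x) -> (forall x, hnorm (T x) <= C' * hnorm x) ->
  (forall g d, D d -> inner (S g) d = inner g (T d)) ->
  forall g h, inner (S g) h = inner g (T h).
Proof.
move=> TB SC TC ST g h; apply/eqP; rewrite -subr_eq0; apply/eqP/cabs_le0 => eps eps0.
pose M := (`|C| + `|C'|) * hnorm g + 1.
have M0 : 0 < M.
  by rewrite /M ltr_wpDl// mulr_ge0 ?hnorm_ge0// addr_ge0.
have [w Dw hw] := dD h (divr_gt0 eps0 M0).
have -> : inner (S g) h - inner g (T h) = inner (S g) (h - w) - inner g (T (h - w)).
  rewrite TB !innerDr !innerNr (ST g w Dw); ring.
apply: le_trans (cabsD _ _) _; rewrite cabsN.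
apply: le_trans (_ : M * hnorm (h - w) <= _); last by rewrite mulrC -ler_pdivlMr.
rewrite /M mulrDl mul1r; set u := h - w.
have h3 := inner_CS (S g) u; have h4 := inner_CS g (T u).
have n0 := hnorm_ge0 u; have g0 := hnorm_ge0 g.
have h1 : hnorm (S g) <= `|C| * hnorm g.
  by apply: le_trans (SC g) _; rewrite ler_wpM2r// ler_norm.
have h2 : hnorm (T u) <= `|C'| * hnorm u.
  by apply: le_trans (TC u) _; rewrite ler_wpM2r// ler_norm.
have := ler_wpM2r n0 h1; have := ler_wpM2l g0 h2; lra.
Qed.

End dense.

End hilbert.

(** * Norm bounds for star representations *)

Section representation.
Variables (R : realType) (B : starAlgType R) (H : hilbertType R) (pi : B -> H -> H).
Hypothesis rep : star_representation pi.
Implicit Types (a b c : B) (x y z : H) (k : R[i]).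

Lemma repD b x y : pi b (x + y) = pi b x + pi b y.
Proof. by have := rep_linear rep b 1 x y; rewrite !scale1r. Qed.

Lemma rep0r b : pi b 0 = 0.
Proof. by have := rep_linear rep b (-1) 0 0; rewrite scaler0 addr0 scaleN1r addNr. Qed.

Lemma repZ b k x : pi b (k *: x) = k *: pi b x.
Proof. by have := rep_linear rep b k x 0; rewrite addr0 rep0r addr0. Qed.

Lemma repN b x : pi b (- x) = - pi b x.
Proof. by rewrite -scaleN1r repZ scaleN1r. Qed.

Lemma repB b x y : pi b (x - y) = pi b x - pi b y.
Proof. by rewrite repD repN. Qed.

Lemma rep0l x : pi 0 x = 0.
Proof. by have := repDZ rep (-1) 0 0 x; rewrite scaler0 addr0 scaleN1r addNr. Qed.

Lemma repDl a b x : pi (a + b) x = pi a x + pi b x.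
Proof. by have := repDZ rep 1 a b x; rewrite !scale1r. Qed.

Lemma repZl k a x : pi (k *: a) x = k *: pi a x.
Proof. by have := repDZ rep k a 0 x; rewrite addr0 rep0l addr0. Qed.

Lemma repNl a x : pi (- a) x = - pi a x.
Proof. by rewrite -scaleN1r repZl scaleN1r. Qed.

Lemma repBl a b x : pi (a - b) x = pi a x - pi b x.
Proof. by rewrite repDl repNl. Qed.

Lemma rep_starr b x y : inner x (pi (star b) y) = inner (pi b x) y.
Proof. by rewrite innerC (rep_star rep) -innerC. Qed.

Lemma rep_starM_norm a x : inner (pi (star a ** a) x) x = (hnorm (pi a x) ^+ 2)%:C.
Proof. by rewrite (repM rep) (rep_star rep) hnorm_sq. Qed.

Section bounded.
Variables (e : B) (N : B -> R).
Hypothesis uc : ucstar e N.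

Lemma rep_pos h x : pos h -> 0 <= inner (pi h x) x.
Proof.
move=> [k sk ->]; rewrite -{1}sk rep_starM_norm ler0c; exact: sqr_ge0.
Qed.

(** The representation may be degenerate: [pi e] is only a projection, with
    [|e x| ^ 2 = (e x, x)]. *)
Lemma rep_e_contract x : hnorm (pi e x) <= hnorm x.
Proof.
have := rep_starM_norm e x; rewrite (star_e uc) (uc1l uc) => h.
have := inner_CS (pi e x) x; rewrite h cabs_real ger0_norm ?sqr_ge0// expr2.
have [e0|e0] := ltP 0 (hnorm (pi e x)); first by rewrite ler_pM2l.
by move=> _; apply: le_trans e0 (hnorm_ge0 _).
Qed.

Lemma rep_le a s x : pos (s%:C *: e - a) -> 0 <= s ->
  complex.Re (inner (pi a x) x) <= s * hnorm x ^+ 2.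
Proof.
move=> /(rep_pos x); rewrite repBl repZl innerD innerN innerZ.
have -> : inner (pi e x) x = (hnorm (pi e x) ^+ 2)%:C.
  by rewrite -rep_starM_norm (star_e uc) (uc1l uc).
rewrite -rmorphM lecE /= => /andP[_]; rewrite raddfB /= subr_ge0 => h s0.
apply: le_trans h _; rewrite ler_wpM2l// ler_pXn2r ?nnegrE ?hnorm_ge0//.
exact: rep_e_contract.
Qed.

(** A representation comes with continuity of each operator but with no bound in terms of [N]. The
    bound follows from the positivity of [N b ^ 2 - b* b], which representations preserve. *)
Lemma rep_contract b x : hnorm (pi b x) <= N b * hnorm x.
Proof.
rewrite -(@ler_pXn2r _ 2)// ?nnegrE ?mulr_ge0 ?hnorm_ge0 ?(N_ge0 uc)//.
have := rep_le x (pos_N_sq uc b) (sqr_ge0 _).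
by rewrite rep_starM_norm /= exprMn.
Qed.

End bounded.
Lemma vector_state_le (e a : B) (z : H) (u r : R) : (forall x, pi e x = x) -> 0 <= u ->
  hnorm z ^+ 2 <= r ->
  0 <= complex.Re (inner (pi (u%:C *: e - 2^-1%:C *: (a + star a)) z) z) ->
  complex.Re (inner (pi a z) z) <= r * u.
Proof.
move=> pe u0 zr; rewrite repBl !repZl repDl pe innerD innerN !innerZ innerD.
rewrite (rep_star rep) (innerC (pi a z) z) -hnorm_sq.
case: (inner (pi a z) z) => x y /=.
rewrite ?(mul0r, mulr0, subr0) => h; have := ler_wpM2r u0 zr; lra.
Qed.

End representation.

(** * Irreducibility from extremality *)

Section extreme_irreducible.
Variables (R : realType) (B : starAlgType R) (H : hilbertType R) (pi : B -> H -> H).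
Hypothesis rep : star_representation pi.
Variables (f p : B -> R) (eta : H).
Hypotheses (fE0 : forall a, f a = complex.Re (inner (pi a eta) eta))
  (ext : convex_extreme p f)
  (dense : forall (z : H) eps, 0 < eps -> exists b, hnorm (z - pi b eta) <= eps)
  (eta_norm : hnorm eta ^+ 2 <= 1)
  (om_le : forall (z : H) r, 0 < r -> hnorm z ^+ 2 <= r ->
    below (fun a => r^-1 * complex.Re (inner (pi a z) z)) p)
  (nonzero : exists b, pi b eta != 0).

(* An invariant subspace [L] splits the vector state of [eta] into those of the
   components [eta1] and [eta2]. Extremality makes the first proportional to
   the whole, so the projection on [L] is a scalar on a dense set. *)
Lemma extreme_irreducible : irreducible_rep pi.
Proof.
split; first by have [b hb] := nonzero; exists b, eta.
move=> L cL invL.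
have [eta1 L1 orth] := projection_exists cL eta.
set eta2 := eta - eta1 in orth.
have etaE : eta = eta1 + eta2 by rewrite /eta2 addrC subrK.
clearbody eta2.
have orth2 b (z : H) : L z -> inner (pi b eta2) z = 0.
  by move=> Lz; rewrite -(starK b) (rep_star rep) orth//; exact: invL.
have orth2' b (z : H) : L z -> inner z (pi b eta2) = 0.
  by move=> Lz; rewrite innerC orth2// rmorph0.
have split_eta b : pi b eta = pi b eta1 + pi b eta2.
  by rewrite -(repD rep) -etaE.
(* [pi b eta1] is the projection on [L] of [pi b eta]. A vector [z] of [L] near [pi b eta] is at
   least as near to this projection, so a factor [r < 1] gives [hnorm z <= r * hnorm z] up to the
   error. *)
have dense_zero (r : R) : 0 <= r < 1 ->
    (forall b, hnorm (pi b eta1) <= r * hnorm (pi b eta)) -> L = [set 0].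
  move=> /andP[r0 r1] hr; apply/seteqP; split=> [z Lz|_ ->]; last exact: (cs0 cL).
  apply: hnorm_le0 => eps eps0; pose del := eps * (1 - r) / 2.
  have del0 : 0 < del by rewrite divr_gt0// mulr_gt0//; lra.
  have [b hb] := dense z del0.
  have Lb : L (pi b eta1) by exact: invL.
  have pyth : hnorm (z - pi b eta1) <= hnorm (z - pi b eta).
    rewrite -(@ler_pXn2r _ 2)// ?nnegrE ?hnorm_ge0//.
    have -> : z - pi b eta = (z - pi b eta1) - pi b eta2.
      by rewrite split_eta opprD addrA.
    rewrite (hnorm_sqB (z - pi b eta1)) orth2' /=.
      by rewrite mulr0 subr0 lerDl sqr_ge0.
    exact: (csB cL).
  have n1 := hnorm_le_add z (pi b eta1).
  have n2 := hnorm_le_add (pi b eta) z; rewrite hnormC in n2.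
  have n3 := hr b; have n4 := ler_wpM2l r0 n2.
  have n5 := ler_wpM2l r0 hb; have n6 := ler_wpM2r (ltW del0) (ltW r1).
  have : (1 - r) * hnorm z <= (1 - r) * eps.
    have E : 2 * del = eps * (1 - r) by rewrite /del; field.
    move: (del) (hnorm z) (hnorm (pi b eta)) E pyth hb n1 n2 n3 n4 n5 n6.
    move: (hnorm (pi b eta1)) (hnorm (z - pi b eta)) (hnorm (z - pi b eta1)).
    move=> a1 a2 a3 a4 a5 a6; lra.
  by rewrite ler_pM2l//; lra.
pose t := hnorm eta1 ^+ 2; pose s := hnorm eta2 ^+ 2.
have ts : t + s <= 1.
  apply: le_trans eta_norm; rewrite etaE hnorm_sqD Re_innerC orth//=.
  by rewrite mulr0 addr0.
have t0 : 0 <= t := sqr_ge0 _. have s0 : 0 <= s := sqr_ge0 _.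
(* Extremality speaks of [0 < t < 1] only; at the two ends a component of [eta] vanishes and [L] is
   zero or everything. *)
have [t00|tN0] := eqVneq t 0.
  left; apply: (dense_zero 0); first by rewrite lexx ltr01.
  move=> b; move/eqP: t00; rewrite sqrf_eq0 => /eqP /hnorm_eq0 ->.
  by rewrite (rep0r rep) hnorm0 mul0r.
have tp : 0 < t by rewrite lt_neqAle eq_sym tN0.
have [t1|t1] := leP 1 t.
  right; have : s <= 0 by lra.
  have -> : (s <= 0) = (s == 0) by rewrite eq_le s0 andbT.
  rewrite sqrf_eq0 => /eqP /hnorm_eq0 eta20.
  apply/seteqP; split=> // z _; apply: (cs_lim cL) => eps /(dense z)[b hb].
  exists (pi b eta) => //; rewrite split_eta eta20 (rep0r rep) addr0; exact: invL.
pose om (z : H) a := complex.Re (inner (pi a z) z).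
have om_lin z r : rlinear (fun a => r^-1 * om z a).
  split=> [a b|u a]; rewrite /om.
    by rewrite (repDl rep) innerD raddfD /= mulrDr.
  rewrite (repZl rep) innerZ; case: (inner _ _) => x y /=.
  by rewrite mul0r subr0 mulrCA.
have t1' : 0 < 1 - t by lra.
have fE a : f a = t * (t^-1 * om eta1 a) + (1 - t) * ((1 - t)^-1 * om eta2 a).
  rewrite !mulrA !divff ?gt_eqF// !mul1r fE0 [in LHS]etaE (repD rep) innerD !innerDr.
  have -> : inner (pi a eta1) eta2 = 0.
    by rewrite innerC orth ?rmorph0//; exact: invL.
  by rewrite (orth2 a _ L1) addr0 add0r raddfD.
have eta2_le : hnorm eta2 ^+ 2 <= 1 - t by rewrite -/s; lra.
(* Extremality gives [hnorm (pi b eta1) ^ 2 = t * hnorm (pi b eta) ^ 2], a contraction by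
   [sqrt t < 1]. *)
left; have := ext _ (om_lin eta1 t) (om_lin eta2 (1 - t)) (om_le tp (lexx _))
  (om_le t1' eta2_le) fE.
move=> /(_ ltac:(rewrite tp t1)) fE1.
apply: (dense_zero (Num.sqrt t)).
  by rewrite sqrtr_ge0 -sqrtr1 ltr_sqrt.
move=> b; rewrite -(@ler_pXn2r _ 2)// ?nnegrE ?mulr_ge0 ?sqrtr_ge0 ?hnorm_ge0//.
rewrite exprMn sqr_sqrtr//.
have -> : hnorm (pi b eta) ^+ 2 = f (star b ** b).
  by rewrite fE0 (rep_starM_norm rep).
have -> : f (star b ** b) = t^-1 * om eta1 (star b ** b) by rewrite -fE1.
rewrite mulrA divff// mul1r /om.
by rewrite (rep_starM_norm rep).
Qed.

End extreme_irreducible.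

(** * The Gelfand-Naimark-Segal representation of an extreme state *)

Section gns.
Variables (R : realType) (B : starAlgType R) (e : B) (N : B -> R).
Hypothesis uc : ucstar e N.
Variable K : set B.
Hypotheses (iK : ideal K) (cK : ucclosed N K).
Implicit Types (a b c h k x y z : B) (r s t : R).

(** Positivity in the quotient of [B] by [K], expressed without forming the quotient. *)
Definition pos_mod h := exists2 k, K k & pos (h + k).

Definition rea a := 2^-1%:C *: (a + star a).

Lemma rea_sa a : sa (rea a).
Proof. by apply: saZ; rewrite /sa starD starK addrC. Qed.

Lemma sa_rea a : sa a -> rea a = a.
Proof. by move=> sa_a; rewrite /rea sa_a; nc R B. Qed.

Lemma reaD a b : rea (a + b) = rea a + rea b.
Proof. by rewrite /rea starD; nc R B. Qed.

Lemma reaZ t a : rea (t%:C *: a) = t%:C *: rea a.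
Proof. by rewrite /rea starZr; nc R B. Qed.

Lemma pos_mod_pos h : pos h -> pos_mod h.
Proof. by move=> ph; exists 0; [exact: (ideal0 iK)|rewrite addr0]. Qed.

Lemma pos_modD g h : pos_mod g -> pos_mod h -> pos_mod (g + h).
Proof.
move=> [k Kk pk] [l Kl pl]; exists (k + l); first exact: (idealD iK).
by rewrite addrACA; exact: (posD uc).
Qed.

Lemma pos_modZ t h : 0 <= t -> pos_mod h -> pos_mod (t%:C *: h).
Proof.
move=> t0 [k Kk pk]; exists (t%:C *: k); first exact: (idealZ iK).
by rewrite -scalerDr; exact: posZ.
Qed.

Lemma pos_mod_conj x h : pos_mod h -> pos_mod (star x ** h ** x).
Proof.
move=> [k Kk pk]; exists (star x ** k ** x).
  by apply: (idealMr iK); apply: (idealMl iK).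
by rewrite -amulDl -amulDr; exact: (pos_conj uc).
Qed.

(** Its infimum [upper a] plays the role of the norm of the positive part of [rea a] in the quotient
    by [K]. With nonnegative bounds only, a real-linear functional below [upper] is positive modulo
    [K] and at most 1 at [e]. *)
Definition bound_set a := [set s | 0 <= s /\ pos_mod (s%:C *: e - rea a)].
Definition upper a : R := inf (bound_set a).

Lemma bound_set_has_inf a : has_inf (bound_set a).
Proof.
split; last by exists 0 => s [].
exists (N (rea a)); split; first exact: (N_ge0 uc).
by apply/pos_mod_pos/(pos_sub uc) => //; exact: rea_sa.
Qed.

Lemma upper_le a s : 0 <= s -> pos_mod (s%:C *: e - rea a) -> upper a <= s.
Proof. by move=> s0 ps; apply: ge_inf; [exact: (bound_set_has_inf a).2|split]. Qed.

Lemma le_upper a r : (forall s : R, 0 <= s -> pos_mod (s%:C *: e - rea a) -> r <= s) ->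
  r <= upper a.
Proof.
move=> h; apply: lb_le_inf; first exact: (bound_set_has_inf a).1.
by move=> s [s0 ps]; exact: h.
Qed.

Lemma upper_ge0 a : 0 <= upper a.
Proof. exact: le_upper. Qed.

Lemma upper_sublinear : sublinear upper.
Proof.
split=> [a b|t a t0].
  rewrite -lerBlDr; apply: le_upper => s s0 ps; rewrite lerBlDl -lerBlDr.
  apply: le_upper => r r0 pr; rewrite lerBlDr; apply: upper_le; first exact: addr_ge0.
  have -> : (r + s)%:C *: e - rea (a + b) = (s%:C *: e - rea a) + (r%:C *: e - rea b).
    by rewrite reaD; nc R B.
  exact: pos_modD.
have [->|tN0] := eqVneq t 0.
  rewrite mul0r scale0r; apply/eqP; rewrite eq_le upper_ge0 andbT.
  apply: upper_le => //; rewrite scale0r sub0r sa_rea ?oppr0; last exact: star0.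
  exact/pos_mod_pos/pos0.
have tp : 0 < t by rewrite lt_neqAle eq_sym tN0.
have scl s : t%:C *: (s%:C *: e - rea a) = (t * s)%:C *: e - rea (t%:C *: a).
  by rewrite reaZ; nc R B.
apply/eqP; rewrite eq_le; apply/andP; split.
  rewrite -ler_pdivrMl//; apply: le_upper => s s0 ps; rewrite ler_pdivrMl//.
  apply: upper_le; first exact: mulr_ge0.
  by rewrite -scl; exact: pos_modZ.
apply: le_upper => s s0 ps; rewrite -ler_pdivlMl//; apply: upper_le.
  by rewrite mulr_ge0// invr_ge0.
have -> : (t^-1 * s)%:C *: e - rea a = t^-1%:C *: (s%:C *: e - rea (t%:C *: a)).
  rewrite -[in RHS](divfK tN0 s) [in RHS](mulrC _ t) -scl scalerA -rmorphM /=.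
  by rewrite mulVf// rmorph1 scale1r mulrC.
by apply: pos_modZ => //; rewrite invr_ge0.
Qed.

Lemma upper_e : upper e <= 1.
Proof.
apply: upper_le => //; rewrite sa_rea ?rmorph1 ?scale1r ?subrr; last exact: (star_e uc).
exact/pos_mod_pos/pos0.
Qed.

(* If [b* b <= s + k] with [k] in [K], cutting down by an approximate unit of
   [k] gives [dist (b, K) ^ 2 <= s]. *)
Lemma upper_gt0 b : ~ K b -> 0 < upper (star b ** b).
Proof.
move=> Kb; have [del del0 hdel] : exists2 del, 0 < del & forall k, K k -> del <= N (b - k).
  apply: contrapT => nex; apply: Kb.
  have /boolp.choice[u hu] : forall n, exists k, K k /\ N (b - k) <= n.+1%:R^-1.
    move=> n; apply: contrapT => nk; apply: nex; exists n.+1%:R^-1; first by rewrite invr_gt0.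
    move=> k Kk; rewrite leNgt; apply/negP => lt; apply: nk; exists k; split=> //; exact: ltW.
  apply: (cK (u := u)) => [n|eps eps0]; first exact: (hu n).1.
  have [n0 h] := inv_nat_small eps0; exists n0 => n /h; rewrite (NC uc).
  by apply: le_trans; exact: (hu n).2.
apply: (@lt_le_trans _ _ (del ^+ 2)); first exact: exprn_gt0.
apply: le_upper => s s0 [k Kk]; rewrite sa_rea; last exact: sa_starM.
move=> pk; apply/ler_addgt0Pr => eps eps0.
have [q [pq _ Nq qk hq]] := approximate_unit uc k eps0.
have sq := pos_sa pq.
have Kbq : K (b ** (e - q)) by apply: (idealMl iK); exact: hq.
have d1 : del <= N (b ** q).
  by have := hdel _ Kbq; rewrite !(ucE uc) opprB addrC subrK.
have := pos_conj uc q pk; rewrite sq.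
have -> : q ** (s%:C *: e - star b ** b + k) ** q =
  (s%:C *: (q ** q) + q ** k ** q) - star (b ** q) ** (b ** q).
  by rewrite starM sq !(ucE uc); nc R B.
move=> /(pos_N_mono uc (pos_starM uc _)); rewrite (uc_starM uc) => le1.
have le2 : N (s%:C *: (q ** q) + q ** k ** q) <= s + eps.
  apply: le_trans (ucD uc _ _) _; apply: lerD.
    by rewrite (NZ uc) ger0_norm// ler_piMr//; have := NM uc Nq Nq; rewrite mulr1.
  by have := NM uc qk Nq; rewrite mulr1.
apply: le_trans (le_trans le1 le2).
by rewrite ler_pXn2r// ?nnegrE ?(N_ge0 uc)// ltW.
Qed.

Section state.
Variable f : B -> R.
Hypotheses (lf : rlinear f) (fp : below f upper).

Lemma stateN a : f (- a) = - f a.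
Proof. by have := lf.2 (-1) a; rewrite rmorphN1 scaleN1r mulN1r. Qed.

Lemma state_pos h : sa h -> pos_mod h -> 0 <= f h.
Proof.
move=> sh ph; rewrite -oppr_le0 -stateN; apply: le_trans (fp _) _.
by apply: upper_le => //; rewrite scale0r sub0r sa_rea ?opprK//; exact: saN.
Qed.

Lemma state_rea0 a : rea a = 0 -> f a = 0.
Proof.
move=> ra; have le0 b : rea b = 0 -> f b <= 0.
  move=> rb; apply: le_trans (fp _) _; apply: upper_le => //.
  by rewrite scale0r rb subrr; exact/pos_mod_pos/pos0.
apply/eqP; rewrite eq_le le0// -oppr_le0 -stateN le0//.
have := reaZ (-1) a; rewrite rmorphN1 !scaleN1r => ->; by rewrite ra oppr0.
Qed.

Lemma state_star a : f (star a) = f a.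
Proof.
apply/eqP; rewrite -subr_eq0 -stateN -lf.1; apply/eqP/state_rea0.
by rewrite /rea starB starK addrC subrKA subrr scaler0.
Qed.

(** The complex-linear functional with real part [f]; extreme functionals were found over the
    reals. *)
Definition state a : R[i] := Complex (f a) (- f ('i *: a)).

Lemma stateD a b : state (a + b) = state a + state b.
Proof.
by rewrite /state scalerDr !lf.1 opprD.
Qed.

Lemma stateZr t a : state (t%:C *: a) = t%:C * state a.
Proof.
rewrite /state scalerA mulrC -scalerA !lf.2; apply/eqP; rewrite eq_complex /=.
by rewrite !mul0r subr0 addr0 mulrN !eqxx.
Qed.

Lemma stateZi a : state ('i *: a) = 'i * state a.
Proof.
rewrite -complexiE /state; apply/eqP; rewrite eq_complex /= complexiE.
by rewrite scalerA -expr2 sqrCi scaleN1r stateN !mul0r !mul1r sub0r !opprK add0r !eqxx.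
Qed.

Lemma stateZ (k : R[i]) a : state (k *: a) = k * state a.
Proof.
rewrite (complexE k) complexiE scalerDl -scalerA stateD stateZi !stateZr.
by rewrite mulrDl mulrA.
Qed.

Lemma state_conj a : state (star a) = Num.conj (state a).
Proof.
rewrite /state state_star; apply/eqP; rewrite eq_complex /= eqxx /=.
have -> : 'i *: star a = star (- ('i *: a)).
  by rewrite starN starZ conjCi scaleNr opprK.
by rewrite state_star stateN.
Qed.

Lemma state_sa h : sa h -> state h = (f h)%:C.
Proof.
move=> sh; rewrite /state; congr Complex.
have : f (star ('i *: h)) = f ('i *: h) by exact: state_star.
rewrite starZ conjCi scaleNr sh stateN; lra.
Qed.

Definition gns_form x y : R[i] := state (star y ** x).

Lemma gns_psd : psd_form gns_form.
Proof.
split=> [k x y z|x y|x]; rewrite /gns_form.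
- by rewrite amulDr amulZr stateD stateZ.
- by rewrite -state_conj starM starK.
- rewrite state_sa; last exact: sa_starM.
  rewrite ler0c; apply: state_pos; first exact: sa_starM.
  exact/pos_mod_pos/(pos_starM uc).
Qed.

Local Notation H := (completion gns_psd).
Local Notation sn := (seminorm gns_form).
Local Notation em := (embed gns_psd).

Lemma gns_seminorm_sq x : sn x ^+ 2 = f (star x ** x).
Proof.
apply: complexI; rewrite seminorm_sq; last exact: gns_psd.
by rewrite /gns_form state_sa//; exact: sa_starM.
Qed.

Lemma gns_seminormM b x : sn (b ** x) <= N b * sn x.
Proof.
rewrite -(@ler_pXn2r _ 2)// ?nnegrE ?mulr_ge0 ?seminorm_ge0 ?(N_ge0 uc)//.
rewrite exprMn !gns_seminorm_sq -lf.2 -subr_ge0 -stateN -lf.1.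
have -> : (N b ^+ 2)%:C *: (star x ** x) - star (b ** x) ** (b ** x) =
    star x ** ((N b ^+ 2)%:C *: e - star b ** b) ** x.
  by rewrite starM amulDr amulDl amulZr (uc1r uc) salgNr; nc R B.
apply: state_pos; last exact/pos_mod_pos/(pos_conj uc)/(pos_N_sq uc).
rewrite /sa !starM starK -amulA; congr (_ ** (_ ** _)).
rewrite starB starZr (star_e uc); by rewrite sa_starM.
Qed.

(** Elements of the completion are functions on [B], so [b] acts on all of them at once by
    precomposition with [star b], with no extension by continuity. What remains is that an
    approximant [w] of [h] yields the approximant [b ** w]. *)
Lemma gns_rep_in b (h : H) :
  ((fun v => h (star b ** v)) : B -> R[i]^o) \in completion_pred gns_psd.
Proof.
apply/asboolP => eps eps0; pose C := N (star b) + 1.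
have C0 : 0 < C by rewrite /C; have := N_ge0 uc (star b); lra.
have [w hw] := completion_approx h (divr_gt0 eps0 C0).
exists (b ** w) => v.
have -> : gns_form (b ** w) v = gns_form w (star b ** v).
  by rewrite /gns_form starM starK amulA.
apply: le_trans (hw _) _; rewrite mulrAC ler_pdivrMr// -mulrA ler_pM2l// mulrC.
apply: le_trans (gns_seminormM _ _) _; apply: ler_wpM2r; first exact: seminorm_ge0.
by rewrite /C; lra.
Qed.

Definition gns_rep b (h : H) : H := Completion (gns_rep_in b h).

Lemma gns_repE b (h : H) v : gns_rep b h v = h (star b ** v).
Proof. by []. Qed.

Lemma gns_rep_embed b x : gns_rep b (em x) = em (b ** x).
Proof.
apply: completion_eq => v; rewrite gns_repE /= /gns_form starM starK.
by rewrite -amulA.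
Qed.

Lemma gns_rep_le b (h : H) : hnorm (gns_rep b h) <= N b * hnorm h.
Proof.
apply: completion_norm_le; first by rewrite mulr_ge0 ?(N_ge0 uc)// hnorm_ge0.
move=> v; rewrite gns_repE; apply: le_trans (completion_eval_le _ _) _.
rewrite -mulrA mulrCA ler_wpM2l ?hnorm_ge0// -(N_star uc b).
exact: gns_seminormM.
Qed.

Lemma gns_repB b (g h : H) : gns_rep b (g - h) = gns_rep b g - gns_rep b h.
Proof. by apply: completion_eq => v. Qed.

Lemma gns_star_rep : star_representation gns_rep.
Proof.
split=> [b|b k g h|k b c h|b c h|b g h].
- apply: hnorm_continuous; exists (N b) => g h; rewrite -gns_repB.
  exact: gns_rep_le.
- by apply: completion_eq.
- apply: completion_eq => v; rewrite completionDZ !gns_repE starD starZ amulDl amulZl.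
  by rewrite completionZD conjCK.
- by apply: completion_eq => v; rewrite !gns_repE starM -amulA.
- apply: (@dense_adjoint _ _ (range em) _ (gns_rep (star b)) (gns_rep b) (N (star b)) (N b)).
  + by move=> l eps eps0; have [w hw] := completion_dense l eps0; exists (em w) => //; exists w.
  + exact: gns_repB.
  + exact: gns_rep_le.
  + exact: gns_rep_le.
  move=> g' _ [w _ <-].
  rewrite gns_rep_embed.
  have -> : inner (gns_rep (star b) g') (em w) = gns_rep (star b) g' w by exact: cinner_embed.
  have -> : inner g' (em (b ** w)) = g' (b ** w) by exact: cinner_embed.
  by rewrite gns_repE starK.
Qed.

Hypothesis ext : convex_extreme upper f.
Variable b0 : B.
Hypothesis fb0 : 0 < f (star b0 ** b0).
Local Notation eta := (em e).

Lemma gns_cyclic b : gns_rep b eta = em b.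
Proof. by rewrite gns_rep_embed (uc1r uc). Qed.

Lemma em_hnorm x : hnorm (em x) ^+ 2 = f (star x ** x).
Proof.
apply: complexI; rewrite hnorm_sq.
have -> : inner (em x) (em x) = gns_form x x by exact: cinner_embed.
by rewrite /gns_form state_sa//; exact: sa_starM.
Qed.

Lemma em_nonzero : em b0 != 0.
Proof.
apply/eqP => eb0; have := em_hnorm b0; rewrite eb0 hnorm0 expr0n /= => h.
by move: fb0; rewrite -h ltxx.
Qed.

Lemma eta_norm : hnorm eta ^+ 2 <= 1.
Proof.
rewrite em_hnorm (star_e uc) (uc1l uc); exact: le_trans (fp e) upper_e.
Qed.

Lemma gns_state a : f a = complex.Re (inner (gns_rep a eta) eta).
Proof.
rewrite gns_cyclic; have -> : inner (em a) eta = gns_form a e by exact: cinner_embed.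
by rewrite /gns_form (star_e uc) (uc1l uc).
Qed.

Lemma gns_rep_e (h : H) : gns_rep e h = h.
Proof. by apply: completion_eq => v; rewrite gns_repE (star_e uc) (uc1l uc). Qed.

Lemma gns_vector_ge0 h (z : H) : sa h -> pos_mod h ->
  0 <= complex.Re (inner (gns_rep h z) z).
Proof.
move=> sh ph; apply: (@dense_form_ge0 _ _ (range em) _ (gns_rep h) (N h)).
- by move=> l eps eps0; have [w hw] := completion_dense l eps0; exists (em w) => //; exists w.
- exact: (N_ge0 uc).
- exact: gns_repB.
- exact: gns_rep_le.
move=> _ [w _ <-].
rewrite gns_rep_embed.
have -> : inner (em (h ** w)) (em w) = gns_form (h ** w) w by exact: cinner_embed.
rewrite /gns_form amulA /=; apply: state_pos; last exact: pos_mod_conj.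
by rewrite /sa !starM starK sh amulA.
Qed.

(** The functionals against which extremality is tested must themselves lie below [upper]; they do
    because positivity modulo [K] passes to every vector of the representation. *)
Lemma gns_om_le (z : H) r : 0 < r -> hnorm z ^+ 2 <= r ->
  below (fun a => r^-1 * complex.Re (inner (gns_rep a z) z)) upper.
Proof.
move=> r0 zr a; apply: le_upper => u u0 pu; rewrite ler_pdivrMl//.
have ph := gns_vector_ge0 z (saB (saZ u (star_e uc)) (rea_sa a)) pu.
apply: (vector_state_le gns_star_rep gns_rep_e u0 zr ph).
Qed.

Lemma gns_irreducible : irreducible_rep gns_rep.
Proof.
apply: (extreme_irreducible gns_star_rep gns_state ext) => [z eps eps0| | |].
- have [b hb] := completion_dense z eps0; exists b; rewrite gns_cyclic; exact: hb.
- exact: eta_norm.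
- exact: gns_om_le.
- exists b0; rewrite gns_cyclic; exact: em_nonzero.
Qed.

Lemma gns_kernel k (h : H) : K k -> gns_rep k h = 0.
Proof.
move=> Kk; apply: hnorm_le0 => eps eps0; have C0 : 0 < N k + 1.
  by have := N_ge0 uc k; lra.
have [w hw] := completion_dense h (divr_gt0 eps0 C0).
have kw : gns_rep k (em w) = 0.
  rewrite gns_rep_embed; apply: hnorm_eq0; apply/eqP; rewrite -sqrf_eq0 em_hnorm.
  have Ky : K (star (k ** w) ** (k ** w)).
    by apply: (idealMl iK); apply: (idealMr iK).
  have sy := sa_starM (k ** w); apply/eqP.
  apply/eqP; rewrite eq_le state_pos ?andbT//; last exact/pos_mod_pos/(pos_starM uc).
  rewrite -oppr_ge0 -stateN; apply: state_pos; first exact: saN.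
  by exists (star (k ** w) ** (k ** w)) => //; rewrite addNr; exact: pos0.
have -> : gns_rep k h = gns_rep k (h - em w) by rewrite gns_repB kw subr0.
apply: le_trans (gns_rep_le _ _) _.
have : (N k + 1) * hnorm (h - em w) <= eps by rewrite mulrC -ler_pdivlMr.
have := hnorm_ge0 (h - em w); nra.
Qed.

End state.

(** An extreme [f] with [f (b* b) = upper (b* b) > 0] has an irreducible representation that kills
    [K], since [f] is positive modulo [K], but in which [b] moves the cyclic vector to a nonzero
    one. *)
Lemma primitive_separation b : ~ K b -> exists2 Q : prim B, K `<=` Q & ~ (Q : set B) b.
Proof.
move=> Kb; have b0 := upper_gt0 Kb.
have [f [lf fp fb ext]] := extreme_exists (star b ** b) upper_sublinear.
rewrite -fb in b0.
pose pi := @gns_rep f lf fp.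
have prQ : primitive [set c | forall v : completion (gns_psd lf fp), pi c v = 0].
  exists (completion (gns_psd lf fp) : hilbertType R), pi; split=> //.
    exact: gns_star_rep.
  exact: (gns_irreducible lf fp ext b0).
exists (Prim prQ) => [k Kk h|/= /(_ (embed (gns_psd lf fp) e))].
  exact: gns_kernel.
by rewrite /pi gns_cyclic => h; have := em_nonzero lf fp b0; rewrite h eqxx.
Qed.

End gns.

(** * The multiplier algebra as a unital C*-algebra *)

(** The Baire argument done by hand: an unbounded [p] allows nested closed balls with [p >= n] on
    the [n]-th one, and [p] would be infinite at their common point. *)
Lemma lsc_seminorm_bounded (R : realType) (H : completeNormedModType R[i]) (p : H -> R) :
  (forall x y, p (x + y) <= p x + p y) ->
  (forall (k : R[i]) x, p (k *: x) = cabs k * p x) ->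
  (forall x r, r < p x ->
    exists2 del, 0 < del & forall y, hnorm (y - x) <= del -> r <= p y) ->
  exists C, forall x, p x <= C * hnorm x.
Proof.
move=> pD pZ lsc; apply: contrapT => unb.
have p0 : p 0 = 0 by rewrite -(scale0r (0 : H)) pZ cabs0 mul0r.
have pN x : p (- x) = p x by rewrite -scaleN1r pZ cabsN /cabs normr1 mul1r.
have step (s : nat * (H * R)) : exists t : H * R, 0 < s.2.2 ->
    [/\ hnorm (t.1 - s.2.1) <= s.2.2, 0 < t.2 <= s.2.2 / 2 &
      forall y, hnorm (y - t.1) <= 2 * t.2 -> s.1%:R <= p y].
  case: s => n [x eps] /=; have [eps0|eps0] := ltP 0 eps; last by exists (x, 0).
  have [x0 hx0] : exists x0, (n%:R + 1) / eps * hnorm x0 < p x0.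
    apply: contrapT => nx; apply: unb; exists ((n%:R + 1) / eps) => z.
    by rewrite leNgt; apply/negP => lt; apply: nx; exists z.
  have nx0 : 0 < hnorm x0.
    rewrite lt_neqAle hnorm_ge0 andbT eq_sym; apply/eqP => /hnorm_eq0 x00.
    by move: hx0; rewrite x00 p0 hnorm0 mulr0 ltxx.
  pose h := (eps / hnorm x0)%:C *: x0.
  have e0 : 0 < eps / hnorm x0 by exact: divr_gt0.
  have nh : hnorm h = eps.
    by rewrite hnormZ cabs_real gtr0_norm// divfK// gt_eqF.
  have ph : n%:R + 1 < p h.
    rewrite pZ cabs_real gtr0_norm// mulrC mulrA ltr_pdivlMr// mulrC.
    by rewrite mulrAC ltr_pdivrMr// in hx0; rewrite mulrC [X in _ < X]mulrC mulrC.
  (* [p (2 h) > 2 n + 2] is at most [p (x + h) + p (x - h)], so one of the two points has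
     [p > n]. *)
  have [x' [hx' px']] : exists x', hnorm (x' - x) <= eps /\ n%:R < p x'.
    have [le|lt] := leP (p (x + h)) n%:R; last first.
      by exists (x + h); rewrite addrC addKr nh.
    exists (x - h); rewrite addrC addKr hnormN nh; split=> //.
    have := pD (x + h) (- (x - h)); rewrite pN.
    have -> : x + h + - (x - h) = 2 *: h by lin R[i] H.
    have c2 : cabs (2 : R[i]) = 2 by rewrite -(rmorph_nat (real_complex R)) cabs_real ger0_norm.
    rewrite pZ c2; lra.
  have [del del0 hdel] := lsc _ _ px'.
  (* Radii at least halve, so later centres stay within twice the current radius; hence [p >= n] is
     asked on the ball of double radius, which is at most [del]. *)
  exists (x', Num.min (eps / 2) (del / 2)) => _; split=> //=.
    by rewrite lt_min !divr_gt0//= ge_min lexx.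
  move=> y hy; apply: hdel; apply: le_trans hy _.
  have : Num.min (eps / 2) (del / 2) <= del / 2 by rewrite ge_min lexx orbT.
  lra.
have [F hF] := boolp.choice step.
pose s := fix s n : H * R := if n is n.+1 then F (n, s n) else (0, 1).
have sp n : 0 < (s n).2.
  by elim: n => [|n IH]; [exact: ltr01|have [_ /andP[]] := hF (n, s n) IH].
have d1 n : hnorm ((s n.+1).1 - (s n).1) <= (s n).2.
  by have [] := hF (n, s n) (sp n).
have d2 n : (s n.+1).2 <= (s n).2 / 2.
  by have [_ /andP[]] := hF (n, s n) (sp n).
have d3 n y : hnorm (y - (s n.+1).1) <= 2 * (s n.+1).2 -> n%:R <= p y.
  by have [_ _] := hF (n, s n) (sp n); exact.
have small n : (s n).2 <= n.+1%:R^-1.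
  elim: n => [|n IH]; first by rewrite invr1.
  apply: le_trans (d2 n) _; rewrite ler_pdivrMr//; apply: le_trans IH _.
  rewrite mulrC ler_pdivlMr ?ltr0n// mulrC ler_pdivrMr ?ltr0n// -natrM ler_nat; lia.
have tail n k : hnorm ((s (k + n)%N).1 - (s n).1) <= 2 * (s n).2 - 2 * (s (k + n)%N).2.
  elim: k => [|k IH]; first by rewrite add0n !subrr hnorm0.
  have := hnorm_triangle (s (k.+1 + n)%N).1 (s (k + n)%N).1 (s n).1.
  have := d1 (k + n)%N; have := d2 (k + n)%N; rewrite addSn; lra.
have tail' m n : (n <= m)%N -> hnorm ((s m).1 - (s n).1) <= 2 * (s n).2.
  move=> /subnK <-; have := tail n (m - n)%N; have := sp ((m - n) + n)%N; lra.
have [|y hy] := @hnorm_complete R H (fun n => (s n).1).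
  move=> eps eps0; have e2 : 0 < eps / 4 by lra.
  have [n0 h] := inv_nat_small e2; exists n0 => m n hm hn.
  have := hnorm_triangle (s m).1 (s n0).1 (s n).1; rewrite (hnormC (s n0).1).
  have := tail' _ _ hm; have := tail' _ _ hn; have := small n0; have := h n0 (leqnn _).
  set a := n0.+1%:R^-1; lra.
have py n : n%:R <= p y.
  apply: (d3 n); apply/ler_addgt0Pr => eps eps0; have [n0 h] := hy _ eps0.
  pose m := maxn n0 n.+1.
  have := hnorm_triangle y (s m).1 (s n.+1).1; rewrite (hnormC y (s m).1).
  have := h m (leq_maxl _ _); have := tail' m n.+1 (leq_maxr _ _); lra.
have := py (Num.truncn (p y)).+1; rewrite leNgt => /negP; apply; exact: truncnS_gt.
Qed.

Section cstar_norm.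
Variables (R : realType) (A : cstarAlgType R).
Implicit Types (a b c : A).

Lemma cs_normM a b : hnorm (a ** b) <= hnorm a * hnorm b.
Proof. by rewrite -lecR rmorphM /= !hnormE norm_amul. Qed.

Lemma cs_norm_starM a : hnorm (star a ** a) = hnorm a ^+ 2.
Proof. by apply: complexI; rewrite rmorphXn /= !hnormE norm_star_amul. Qed.

Lemma cs_norm_star a : hnorm (star a) = hnorm a.
Proof.
have le b : hnorm b <= hnorm (star b).
  have [->|b0] := eqVneq b 0; first by rewrite hnorm0 hnorm_ge0.
  have bp : 0 < hnorm b.
    rewrite lt_neqAle hnorm_ge0 andbT eq_sym; apply/eqP => /hnorm_eq0 b00.
    by rewrite b00 eqxx in b0.
  by have := cs_normM (star b) b; rewrite cs_norm_starM expr2 ler_pM2r.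
by apply/eqP; rewrite eq_le le /= -[X in _ <= hnorm X]starK le.
Qed.

Lemma cs_norm_le_amul a r : 0 <= r -> (forall b, hnorm (a ** b) <= r * hnorm b) -> hnorm a <= r.
Proof.
move=> r0 h; have := h (star a); rewrite cs_norm_star -[X in hnorm (X ** _)]starK cs_norm_starM.
rewrite cs_norm_star expr2; have [a0|a0] := ltP 0 (hnorm a); first by rewrite ler_pM2r.
by move=> _; exact: le_trans r0.
Qed.

End cstar_norm.

Section multiplier_norm.
Variables (R : realType) (A : cstarAlgType R).
Implicit Types (a b c x y : A) (m n : multiplier A) (k : R[i]) (r s : R).

Lemma mul_lD m a b : mul_l m (a + b) = mul_l m a + mul_l m b.
Proof. by have := mul_lDZ m 1 a b; rewrite !scale1r. Qed.

Lemma mul_l0 m : mul_l m 0 = 0.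
Proof. by have := mul_lDZ m (-1) 0 0; rewrite scaler0 addr0 scaleN1r addNr. Qed.

Lemma mul_lZ m k a : mul_l m (k *: a) = k *: mul_l m a.
Proof. by have := mul_lDZ m k a 0; rewrite !addr0 mul_l0 addr0. Qed.

Lemma mul_lB m a b : mul_l m (a - b) = mul_l m a - mul_l m b.
Proof. by rewrite mul_lD -scaleN1r mul_lZ scaleN1r. Qed.

Lemma mul_l_amul m a b : mul_l m (a ** b) = mul_l m a ** b.
Proof. by apply: amul_inj_l => c; rewrite multiplierP !amulA multiplierP. Qed.

Lemma mul_l_star m a : mul_l (star m) a = star (mul_r (star a) m).
Proof. by []. Qed.

Lemma mul_r_star m a : mul_r a (star m) = star (mul_l m (star a)).
Proof. by []. Qed.

Lemma mul_l_mul m n a : mul_l (m ** n) a = mul_l m (mul_l n a).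
Proof. by []. Qed.

Lemma mul_r_mul m n a : mul_r a (m ** n) = mul_r (mul_r a m) n.
Proof. by []. Qed.

Lemma mul_l_add m n a : mul_l (m + n) a = mul_l m a + mul_l n a.
Proof. by []. Qed.

Lemma mul_l_sub m n a : mul_l (m - n) a = mul_l m a - mul_l n a.
Proof. by []. Qed.

Lemma mul_l_scale k m a : mul_l (k *: m) a = k *: mul_l m a.
Proof. by []. Qed.

Lemma mul_r_sub m n a : mul_r a (m - n) = mul_r a m - mul_r a n.
Proof. by []. Qed.

(** A double centralizer is not assumed continuous. Lower semicontinuity of [a |-> hnorm (m a)]
    comes from moving [m] to the other side: for fixed [c = star (m a)] the product
    [c ** m b = (c m) ** b] is continuous in [b], and at [b = a] its norm is [hnorm (m a) ^ 2]. *)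
Lemma multiplier_bounded m : exists C, forall a, hnorm (mul_l m a) <= C * hnorm a.
Proof.
apply: (lsc_seminorm_bounded (p := fun a => hnorm (mul_l m a))) => [a b|k a|a r ra].
- by rewrite mul_lD hnormD.
- by rewrite mul_lZ hnormZ.
pose s := hnorm (mul_l m a); have [s0|s0] := ltP 0 s; last first.
  exists 1 => // b _; apply: le_trans (ltW ra) _; apply: le_trans s0 _; exact: hnorm_ge0.
pose c := star (mul_l m a); pose C := hnorm (mul_r c m) + 1.
have C0 : 0 < C by rewrite /C; have := hnorm_ge0 (mul_r c m); lra.
exists ((s - r) * s / C); first by rewrite divr_gt0// mulr_gt0// subr_gt0.
move=> b; rewrite ler_pdivlMr// => hb.
rewrite -(ler_pM2l s0).
have h1 : hnorm (c ** mul_l m b) <= s * hnorm (mul_l m b).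
  by have := cs_normM c (mul_l m b); rewrite /c cs_norm_star.
have h2 : hnorm (c ** mul_l m (b - a)) <= hnorm (b - a) * C.
  rewrite multiplierP; apply: le_trans (cs_normM _ _) _; rewrite mulrC.
  by apply: ler_wpM2l; [exact: hnorm_ge0|rewrite /C; lra].
have h3 : hnorm (c ** mul_l m a) = s * s by rewrite /c cs_norm_starM expr2.
have h4 := hnorm_le_add (c ** mul_l m a) (c ** mul_l m b).
rewrite hnormC in h4; have E : c ** mul_l m b - c ** mul_l m a = c ** mul_l m (b - a).
  by rewrite mul_lB amulDr salgNr.
rewrite E h3 in h4; lra.
Qed.

Definition mnorm m : R := inf [set r | 0 <= r /\ forall a, hnorm (mul_l m a) <= r * hnorm a].

Let mnorm_has_inf m : has_inf [set r | 0 <= r /\ forall a, hnorm (mul_l m a) <= r * hnorm a].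
Proof.
split; last by exists 0 => r [].
have [C hC] := multiplier_bounded m; exists `|C|; split=> // a.
by apply: le_trans (hC a) _; rewrite ler_wpM2r ?hnorm_ge0// ler_norm.
Qed.

Lemma mnorm_ge0 m : 0 <= mnorm m.
Proof. by apply: lb_le_inf => [|r []//]; exact: (mnorm_has_inf m).1. Qed.

Lemma mnorm_le m r : 0 <= r -> (forall a, hnorm (mul_l m a) <= r * hnorm a) -> mnorm m <= r.
Proof. by move=> r0 h; apply: ge_inf; [exact: (mnorm_has_inf m).2|split]. Qed.

Lemma le_mnorm m a : hnorm (mul_l m a) <= mnorm m * hnorm a.
Proof.
have [->|a0] := eqVneq a 0; first by rewrite mul_l0 hnorm0 mulr0.
have ap : 0 < hnorm a.
  rewrite lt_neqAle hnorm_ge0 andbT eq_sym; apply/eqP => /hnorm_eq0 a00.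
  by rewrite a00 eqxx in a0.
rewrite -ler_pdivrMr//; apply: lb_le_inf; first exact: (mnorm_has_inf m).1.
by move=> r [r0 hr]; rewrite ler_pdivrMr.
Qed.

Definition mone : multiplier A :=
  @Multiplier R A (id, id) (introT (asboolP _) (fun a b => erefl)).

Lemma mul_l_one a : mul_l mone a = a. Proof. by []. Qed.

Lemma mul_r_one a : mul_r a mone = a. Proof. by []. Qed.

Let mnorm_starM_ge m : mnorm m ^+ 2 <= mnorm (star m ** m).
Proof.
have S0 := mnorm_ge0 (star m ** m).
rewrite -(sqr_sqrtr S0) ler_pXn2r// ?nnegrE ?mnorm_ge0 ?sqrtr_ge0//.
apply: mnorm_le; first exact: sqrtr_ge0.
move=> a; rewrite -(@ler_pXn2r _ 2)// ?nnegrE ?mulr_ge0 ?sqrtr_ge0 ?hnorm_ge0//.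
rewrite exprMn sqr_sqrtr// -cs_norm_starM multiplierP.
have -> : mul_r (star (mul_l m a)) m = star (mul_l (star m ** m) a).
  by rewrite mul_l_mul mul_l_star starK.
apply: le_trans (cs_normM _ _) _; rewrite cs_norm_star expr2 mulrA.
by rewrite ler_wpM2r ?hnorm_ge0// le_mnorm.
Qed.

Lemma mnormM m n : mnorm (m ** n) <= mnorm m * mnorm n.
Proof.
apply: mnorm_le; first by rewrite mulr_ge0 ?mnorm_ge0.
move=> a; rewrite mul_l_mul; apply: le_trans (le_mnorm _ _) _.
by rewrite -mulrA ler_wpM2l ?mnorm_ge0// le_mnorm.
Qed.

Let mnorm_eq0 m : mnorm m = 0 -> m = 0.
Proof.
move=> m0; apply: multiplier_eq => a; apply: hnorm_eq0; apply/eqP.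
by rewrite eq_le hnorm_ge0 andbT; have := le_mnorm m a; rewrite m0 mul0r.
Qed.

Let mnorm0 : mnorm 0 = 0.
Proof.
apply/eqP; rewrite eq_le mnorm_ge0 andbT; apply: mnorm_le => // a.
by rewrite (_ : mul_l 0 a = 0)// hnorm0 mul0r.
Qed.

Let mnorm_le_star m : mnorm m <= mnorm (star m).
Proof.
have [->|m0] := eqVneq m 0; first by rewrite mnorm0 mnorm_ge0.
have mp : 0 < mnorm m.
  rewrite lt_neqAle mnorm_ge0 andbT eq_sym; apply/eqP => /mnorm_eq0 m00.
  by rewrite m00 eqxx in m0.
have := le_trans (mnorm_starM_ge m) (mnormM _ _).
by rewrite expr2 ler_pM2r.
Qed.

Lemma mnorm_star m : mnorm (star m) = mnorm m.
Proof.
by apply/eqP; rewrite eq_le mnorm_le_star andbT -[X in _ <= mnorm X]starK mnorm_le_star.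
Qed.

Lemma le_mnorm_r m a : hnorm (mul_r a m) <= mnorm m * hnorm a.
Proof.
have -> : mul_r a m = star (mul_l (star m) (star a)) by rewrite mul_l_star !starK.
by rewrite cs_norm_star -(cs_norm_star a) -(mnorm_star m) le_mnorm.
Qed.

Definition hlim (v : nat -> A) l := forall eps, 0 < eps ->
  exists i0 : nat, forall i : nat, (i0 <= i)%N -> hnorm (v i - l) <= eps.

Definition hcauchy (v : nat -> A) := forall eps, 0 < eps ->
  exists i0 : nat, forall i j : nat, (i0 <= i)%N -> (i0 <= j)%N -> hnorm (v i - v j) <= eps.

(** Sequential completeness of the strict topology: it yields both the norm completeness of the
    multiplier algebra and, later, the sums of strictly convergent series. *)
Lemma strict_complete (u : nat -> multiplier A) :
  (forall a, hcauchy (fun i => mul_l (u i) a)) ->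
  (forall a, hcauchy (fun i => mul_r a (u i))) ->
  exists m, forall a, hlim (fun i => mul_l (u i) a) (mul_l m a) /\
    hlim (fun i => mul_r a (u i)) (mul_r a m).
Proof.
move=> cul cur.
have cl a : exists l, hlim (fun i => mul_l (u i) a) l by exact: hnorm_complete (cul a).
have cr a : exists l, hlim (fun i => mul_r a (u i)) l by exact: hnorm_complete (cur a).
have [L hL] := boolp.choice cl; have [S hS] := boolp.choice cr.
have dc : (L, S) \in dc_pred.
  apply/asboolP => a b /=; apply/eqP; rewrite -subr_eq0; apply/eqP/hnorm_le0 => eps eps0.
  pose M := hnorm a + hnorm b + 1.
  have [na nb] := (hnorm_ge0 a, hnorm_ge0 b).
  have M0 : 0 < M by rewrite /M; lra.
  have [n0 h0] := hL b _ (divr_gt0 eps0 M0); have [n1 h1] := hS a _ (divr_gt0 eps0 M0).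
  pose n := maxn n0 n1; have := h0 n (leq_maxl _ _); have := h1 n (leq_maxr _ _).
  rewrite !ler_pdivlMr// => {}h1 {}h0.
  have -> : a ** L b - S a ** b = (mul_r a (u n) - S a) ** b - a ** (mul_l (u n) b - L b).
    have := multiplierP (u n) a b => E.
    by rewrite amulDl amulDr salgNl salgNr E; nc R A.
  apply: le_trans (hnormD _ _) _; rewrite hnormN.
  have := cs_normM (mul_r a (u n) - S a) b; have := cs_normM a (mul_l (u n) b - L b).
  move: h1 h0 na nb (hnorm_ge0 (mul_r a (u n) - S a)) (hnorm_ge0 (mul_l (u n) b - L b)).
  rewrite /M; nra.
by exists (Multiplier dc) => a; split; [exact: hL|exact: hS].
Qed.

Lemma multiplier_ucstar : ucstar mone mnorm.
Proof.
split=> [m|m|m n|k m|//|m n|m|u cu].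
- exact: multiplier_eq.
- exact: multiplier_eq.
- apply: mnorm_le; first by rewrite addr_ge0 ?mnorm_ge0.
  move=> a; rewrite mul_l_add mulrDl; apply: le_trans (hnormD _ _) _.
  by apply: lerD; exact: le_mnorm.
- rewrite -/(cabs k); have le l (n : multiplier A) : mnorm (l *: n) <= cabs l * mnorm n.
    apply: mnorm_le; first by rewrite mulr_ge0 ?mnorm_ge0 ?cabs_ge0.
    by move=> a; rewrite mul_l_scale hnormZ -mulrA ler_wpM2l ?cabs_ge0// le_mnorm.
  apply/eqP; rewrite eq_le le /=.
  have [->|k0] := eqVneq k 0; first by rewrite cabs0 mul0r mnorm_ge0.
  have kp : 0 < cabs k by rewrite -ltcR cabsE normr_gt0.
  have := le k^-1 (k *: m); rewrite scalerA mulVf// scale1r.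
  have c1 : cabs (1 : R[i]) = 1.
    by have := cabs_real (1 : R); rewrite rmorph1 normr1.
  have -> : cabs k^-1 = (cabs k)^-1.
    by apply: (mulfI (lt0r_neq0 kp)); rewrite -cabsM (divff k0) (divff (lt0r_neq0 kp)).
  by rewrite ler_pdivlMl.
- exact: mnormM.
- apply/eqP; rewrite eq_le mnorm_starM_ge andbT.
  by have := mnormM (star m) m; rewrite mnorm_star -expr2.
have [||m hm] := @strict_complete u.
- move=> a eps eps0; have a1 : 0 < hnorm a + 1 by have := hnorm_ge0 a; lra.
  have [n0 h] := cu _ (divr_gt0 eps0 a1); exists n0 => i j hi hj.
  rewrite -mul_l_sub; apply: le_trans (le_mnorm _ _) _.
  have := h i j hi hj; rewrite ler_pdivlMr//.
  have := mnorm_ge0 (u i - u j); nra.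
- move=> a eps eps0; have a1 : 0 < hnorm a + 1 by have := hnorm_ge0 a; lra.
  have [n0 h] := cu _ (divr_gt0 eps0 a1); exists n0 => i j hi hj.
  rewrite -mul_r_sub; apply: le_trans (le_mnorm_r _ _) _.
  have := h i j hi hj; rewrite ler_pdivlMr//.
  have := mnorm_ge0 (u i - u j); nra.
exists m => eps eps0; have [n0 h] := cu _ eps0; exists n0 => n hn.
apply: mnorm_le; first exact: ltW.
move=> a; rewrite mul_l_sub; apply/ler_addgt0Pr => del del0.
have [n1 h1] := (hm a).1 _ del0; pose j := maxn n0 n1.
have := hnorm_triangle (mul_l (u n) a) (mul_l (u j) a) (mul_l m a).
have := h1 j (leq_maxr _ _); have := le_mnorm (u n - u j) a; rewrite mul_l_sub.
have := ler_wpM2r (hnorm_ge0 a) (h n j hn (leq_maxl _ _)); lra.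
Qed.

Lemma minj_subproof a : (fun b => a ** b, fun b => b ** a) \in dc_pred.
Proof. by apply/asboolP => b c /=; rewrite amulA. Qed.

Definition minj a : multiplier A := Multiplier (minj_subproof a).

Lemma mul_l_minj a b : mul_l (minj a) b = a ** b. Proof. by []. Qed.

Lemma mul_r_minj a b : mul_r b (minj a) = b ** a. Proof. by []. Qed.

Lemma minj_mul_l m a : m ** minj a = minj (mul_l m a).
Proof. by apply: multiplier_eq => b; rewrite mul_l_mul !mul_l_minj mul_l_amul. Qed.

Lemma minj_mul_r m a : minj a ** m = minj (mul_r a m).
Proof. by apply: multiplier_eq => b; rewrite mul_l_mul !mul_l_minj multiplierP. Qed.

Lemma minjM a b : minj (a ** b) = minj a ** minj b.
Proof. by apply: multiplier_eq => c; rewrite mul_l_mul !mul_l_minj amulA. Qed.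

Lemma minjDZ k a b : minj (k *: a + b) = k *: minj a + minj b.
Proof. by apply: multiplier_eq => c; rewrite mul_l_minj amulDl amulZl. Qed.

Lemma minjD a b : minj (a + b) = minj a + minj b.
Proof. by have := minjDZ 1 a b; rewrite !scale1r. Qed.

Lemma minj0 : minj 0 = 0.
Proof. by apply: multiplier_eq => c; rewrite mul_l_minj amul0l. Qed.

Lemma minjZ k a : minj (k *: a) = k *: minj a.
Proof. by have := minjDZ k a 0; rewrite minj0 !addr0. Qed.

Lemma minjB a b : minj (a - b) = minj a - minj b.
Proof. by rewrite minjD -scaleN1r minjZ scaleN1r. Qed.

Lemma minj_star a : minj (star a) = star (minj a).
Proof.
by apply: multiplier_eq => c; rewrite mul_l_star mul_r_minj starM starK.
Qed.

Lemma minj_inj a b : minj a = minj b -> a = b.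
Proof.
move=> ab; apply: amul_inj_r => c.
by have := congr1 (mul_l^~ c) ab; rewrite !mul_l_minj.
Qed.

Lemma mnorm_minj a : mnorm (minj a) = hnorm a.
Proof.
apply/eqP; rewrite eq_le; apply/andP; split.
  by apply: mnorm_le; [exact: hnorm_ge0|move=> b; exact: cs_normM].
by apply: cs_norm_le_amul; [exact: mnorm_ge0|move=> b; exact: (le_mnorm (minj a))].
Qed.

End multiplier_norm.

(** * Primitive ideals of an algebra and of its multiplier algebra *)

Section irreducible.
Variables (R : realType) (B : starAlgType R) (H : hilbertType R) (pi : B -> H -> H).
Hypotheses (rep : star_representation pi) (irr : irreducible_rep pi).
Implicit Types (a b c : B) (x y z : H).

Lemma rep_cont b x eps : 0 < eps -> exists2 del, 0 < del &
  forall y, hnorm (x - y) <= del -> hnorm (pi b x - pi b y) <= eps.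
Proof.
move=> eps0; have nU : nbhs (pi b x) [set z | hnorm (pi b x - z) <= eps].
  by apply/hnorm_nbhs; exists eps.
have /hnorm_nbhs[del del0 h] := rep_continuous rep nU.
by exists del.
Qed.

Lemma irreducible_nondegenerate y : (forall a, pi a y = 0) -> y = 0.
Proof.
have [[b [x nz]] inv] := irr; move=> h.
pose K := [set z | forall a, pi a z = 0].
have csK : closed_subspace K.
  split=> [z /hnorm_closure clz a|a|k z w Kz Kw a].
  - apply: hnorm_le0 => eps eps0; have [del del0 hd] := rep_cont a z eps0.
    by have [w Kw hw] := clz _ del0; have := hd _ hw; rewrite Kw subr0.
  - exact: (rep0r rep).
  - by rewrite (rep_linear rep) Kz Kw scaler0 addr0.
have [|K0|KT] := inv K csK.
- by move=> a z Kz c; rewrite Kz (rep0r rep).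
- by have : K y by []; rewrite K0.
- by have : K x by [rewrite KT]; move=> /(_ b) b0; rewrite b0 eqxx in nz.
Qed.

Lemma irreducible_cyclic x : x != 0 ->
  forall z eps, 0 < eps -> exists a, hnorm (z - pi a x) <= eps.
Proof.
move=> x0 z eps eps0; have [_ inv] := irr.
pose K := closure (range (pi^~ x)).
have csK : closed_subspace K.
  apply: closed_subspace_closure; first by exists 0 => //; exact: (rep0l rep).
  by move=> k _ _ [a _ <-] [b _ <-]; exists (k *: a + b) => //; rewrite (repDZ rep).
have [|K0|KT] := inv K csK.
- move=> b y Ky U /(rep_continuous rep) /Ky[_ [[c _ <-] Uc]].
  by exists (pi b (pi c x)); split=> //; exists (b ** c); rewrite // (repM rep).
- have : x = 0; last by move=> x00; rewrite x00 eqxx in x0.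
  apply: irreducible_nondegenerate => a.
  have : K (pi a x) by apply: subset_closure; exists a.
  by rewrite K0.
- have : K z by rewrite KT.
  by move=> /hnorm_closure /(_ _ eps0)[_ [a _ <-] h]; exists a.
Qed.

Lemma irreducible_vector : exists x : H, x != 0.
Proof.
have [[b [x nz]] _] := irr; exists x; apply: contraNneq nz => ->.
by rewrite (rep0r rep).
Qed.

End irreducible.

Lemma prim_ideal_ideal (R : realType) (B : starAlgType R) (P : prim B) : ideal (P : set B).
Proof.
have [H [pi [rep _ ->]]] := prim_primitive P.
split=> /= [x|a b pa pb x|k a pa x|a b pb x|a b pa x].
- exact: (rep0l rep).
- by rewrite (repDl rep) pa pb addr0.
- by rewrite (repZl rep) pa scaler0.
- by rewrite (repM rep) pb (rep0r rep).
- by rewrite (repM rep) pa.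
Qed.

Lemma prim_closed (R : realType) (B : starAlgType R) (e : B) (N : B -> R) (P : prim B) :
  ucstar e N -> ucclosed N (P : set B).
Proof.
move=> uc u l Pu ul; have [H [pi [rep _ EP]]] := prim_primitive P.
rewrite EP => x; apply: hnorm_le0 => eps eps0.
have x1 : 0 < hnorm x + 1 by have := hnorm_ge0 x; lra.
have [n /(_ _ (leqnn _)) hn] := ul _ (divr_gt0 eps0 x1).
have un : pi (u n) x = 0 by have := Pu n; rewrite EP; exact.
have -> : pi l x = - pi (u n - l) x by rewrite (repBl rep) un sub0r opprK.
rewrite hnormN; apply: le_trans (rep_contract rep uc _ _) _.
move: hn; rewrite ler_pdivlMr//; have := N_ge0 uc (u n - l); nra.
Qed.

(** * Extension of an irreducible representation from [A] to [multiplier A] *)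

Section extend_rep.
Variables (R : realType) (A : cstarAlgType R) (H : hilbertType R) (pi : A -> H -> H).
Hypotheses (rep : star_representation pi) (irr : irreducible_rep pi).
Local Notation M := (multiplier A).
Implicit Types (a b c : A) (m n : M) (x y z : H).

Lemma star_mul_l m a b : star (mul_l m a) ** b = star a ** mul_l (star m) b.
Proof. by rewrite multiplierP mul_r_star starK. Qed.

(** The multiplier [mnorm m ^ 2 - m* m] is a square [k ** k], and [d = k c] is in [A], where [pi] is
    defined; the claim is the positivity of [d* d] under [pi]. *)
Lemma rep_mul_l_le m c x : hnorm (pi (mul_l m c) x) <= mnorm m * hnorm (pi c x).
Proof.
rewrite -(@ler_pXn2r _ 2)// ?nnegrE ?mulr_ge0 ?hnorm_ge0 ?mnorm_ge0//.
have [k sk kE] := pos_N_sq (multiplier_ucstar A) m.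
pose d := mul_l k c.
have dE : star d ** d = (mnorm m ^+ 2)%:C *: (star c ** c) - star (mul_l m c) ** mul_l m c.
  rewrite /d !star_mul_l sk -mul_l_mul -kE mul_l_sub mul_l_scale mul_l_one mul_l_mul.
  by rewrite amulDr amulZr salgNr.
have := sqr_ge0 (hnorm (pi d x)); rewrite -ler0c -(rep_starM_norm rep) dE.
rewrite (repBl rep) (repZl rep) innerD innerN innerZ !(rep_starM_norm rep).
by rewrite -rmorphM -rmorphB ler0c subr_ge0 exprMn.
Qed.

Lemma extend_unique y z : (forall a, pi a y = pi a z) -> y = z.
Proof.
move=> yz; apply/eqP; rewrite -subr_eq0; apply/eqP/(irreducible_nondegenerate rep irr) => a.
by rewrite (repB rep) yz subrr.
Qed.

(** [x] is a limit of vectors [pi c x0] of a cyclic orbit, and [y] is the limit of the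
    [pi (m c) x0]. The equations [pi a y = pi (a m) x] determine [y] by nondegeneracy, so the
    choices do not matter. *)
Lemma extend_exists m x : exists y,
  (forall a, pi a y = pi (mul_r a m) x) /\ hnorm y <= mnorm m * hnorm x.
Proof.
have [x0 nx0] := irreducible_vector rep irr.
have m1 : 0 < mnorm m + 1 by have := mnorm_ge0 m; lra.
have /boolp.choice[c hc] : forall j : nat, exists c, hnorm (x - pi c x0) <= j.+1%:R^-1.
  by move=> j; apply: (irreducible_cyclic rep irr nx0); rewrite invr_gt0.
pose y j := pi (mul_l m (c j)) x0.
have yd i j : hnorm (y i - y j) <= mnorm m * (i.+1%:R^-1 + j.+1%:R^-1).
  rewrite /y -(repBl rep) -mul_lB; apply: le_trans (rep_mul_l_le _ _ _) _.
  apply: ler_wpM2l; first exact: mnorm_ge0.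
  rewrite (repBl rep); apply: le_trans (hnorm_triangle _ x _) _.
  by apply: lerD => //; rewrite hnormC.
have [|l hl] := @hnorm_complete R H y.
  move=> eps eps0; have e2 : 0 < eps / 2 by lra.
  have [n0 h] := inv_nat_scaled (mnorm_ge0 m) e2; exists n0 => i j /h hi /h hj.
  apply: le_trans (yd i j) _; rewrite mulrDr !(mulrC (mnorm m)).
  move: hi hj; set u := i.+1%:R^-1 * _; set v := j.+1%:R^-1 * _; lra.
exists l; split.
  move=> a; apply/eqP; rewrite -subr_eq0; apply/eqP/hnorm_le0 => eps eps0.
  have e2 : 0 < eps / 2 by lra.
  have [d1 d10 h1] := rep_cont rep a l e2.
  have [d2 d20 h2] := rep_cont rep (mul_r a m) x e2.
  have [n1 g1] := hl _ d10; have [n2 g2] := inv_nat_small d20.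
  pose j := maxn n1 n2.
  have k1 := h1 (y j); rewrite hnormC in k1; have {}k1 := k1 (g1 _ (leq_maxl _ _)).
  have k2 := h2 (pi (c j) x0) (le_trans (hc j) (g2 _ (leq_maxr _ _))).
  have E : pi a (y j) = pi (mul_r a m) (pi (c j) x0).
    by rewrite /y -!(repM rep) multiplierP.
  have := hnorm_triangle (pi a l) (pi a (y j)) (pi (mul_r a m) x).
  by rewrite E in k1 *; rewrite hnormC in k2; lra.
apply/ler_addgt0Pr => eps eps0.
have e2 : 0 < eps / 2 by lra.
have [n1 g1] := hl _ e2; have [n2 g2] := inv_nat_scaled (mnorm_ge0 m) e2.
pose j := maxn n1 n2; have := g1 j (leq_maxl _ _); have := g2 j (leq_maxr _ _).
have := hnorm_le_add l (y j); rewrite (hnormC l).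
have := rep_mul_l_le m (c j) x0; rewrite -/(y j).
have : hnorm (pi (c j) x0) <= hnorm x + j.+1%:R^-1.
  have := hnorm_le_add (pi (c j) x0) x; rewrite hnormC; have := hc j.
  set u := j.+1%:R^-1; lra.
move=> /(ler_wpM2l (mnorm_ge0 m)); rewrite mulrDr (mulrC (mnorm m) _^-1).
set u := j.+1%:R^-1 * _; lra.
Qed.

Definition extend_rep m x : H := projT1 (cid (extend_exists m x)).

Lemma extend_repP m x a : pi a (extend_rep m x) = pi (mul_r a m) x.
Proof. by rewrite /extend_rep; case: cid => y /= []. Qed.

Lemma extend_rep_le m x : hnorm (extend_rep m x) <= mnorm m * hnorm x.
Proof. by rewrite /extend_rep; case: cid => y /= []. Qed.

Lemma extend_rep_mul_l m c x : extend_rep m (pi c x) = pi (mul_l m c) x.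
Proof. by apply: extend_unique => a; rewrite extend_repP -!(repM rep) multiplierP. Qed.

Lemma extend_rep_minj a x : extend_rep (minj a) x = pi a x.
Proof. by apply: extend_unique => b; rewrite extend_repP mul_r_minj (repM rep). Qed.

Lemma extend_repB m x y : extend_rep m (x - y) = extend_rep m x - extend_rep m y.
Proof. by apply: extend_unique => a; rewrite (repB rep) !extend_repP (repB rep). Qed.

Lemma extend_star_rep : star_representation extend_rep.
Proof.
have [x0 nx0] := irreducible_vector rep irr.
split=> [m|m k x y|k m n x|m n x|m x y].
- apply: hnorm_continuous; exists (mnorm m) => x y; rewrite -extend_repB.
  exact: extend_rep_le.
- by apply: extend_unique => a; rewrite (rep_linear rep) !extend_repP (rep_linear rep).
- apply: extend_unique => a; rewrite (rep_linear rep) !extend_repP -(repDZ rep).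
  by [].
- by apply: extend_unique => a; rewrite !extend_repP.
- apply: (@dense_adjoint _ _ (range (pi^~ x0)) _ (extend_rep (star m)) (extend_rep m)
    (mnorm (star m)) (mnorm m)).
  + move=> z eps eps0; have [a ha] := irreducible_cyclic rep irr nx0 z eps0.
    by exists (pi a x0) => //; exists a.
  + exact: extend_repB.
  + exact: extend_rep_le.
  + exact: extend_rep_le.
  move=> g _ [c _ <-]; rewrite extend_rep_mul_l -{1}(starK c) (rep_starr rep).
  by rewrite extend_repP mul_r_star starK -(rep_starr rep) starK.
Qed.

Lemma extend_irreducible : irreducible_rep extend_rep.
Proof.
have [[b [x nz]] inv] := irr; split; first by exists (minj b), x; rewrite extend_rep_minj.
move=> K cK invK; apply: inv => // a y Ky; rewrite -extend_rep_minj; exact: invK.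
Qed.

Lemma extend_kernel : [set m | forall x, extend_rep m x = 0] =
  tilde [set a | forall x, pi a x = 0].
Proof.
apply/seteqP; split=> m /= h.
  by move=> a; split=> x; [rewrite -extend_rep_mul_l|rewrite -extend_repP h (rep0r rep)].
move=> x; apply: (irreducible_nondegenerate rep irr) => a.
by rewrite extend_repP; exact: (h a).2.
Qed.

End extend_rep.

Section ideal_closure.
Variables (R : realType) (B : starAlgType R) (e : B) (N : B -> R).
Hypothesis uc : ucstar e N.

Definition norm_closure (I : set B) : set B :=
  [set m | forall del, 0 < del -> exists2 k, I k & N (m - k) <= del].

Lemma subset_norm_closure (I : set B) : I `<=` norm_closure I.
Proof. by move=> m Im del del0; exists m; rewrite // subrr (N0 uc) ltW. Qed.

Lemma ideal_norm_closure (I : set B) : ideal I -> ideal (norm_closure I).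
Proof.
move=> iI; have pert (C : R) del : 0 <= C -> 0 < del -> exists2 d, 0 < d & C * d <= del.
  move=> C0 del0; exists (del / (C + 1)); first by rewrite divr_gt0//; lra.
  by rewrite mulrA ler_pdivrMr; [nra|lra].
split=> [|x y Kx Ky del del0|k x Kx del del0|x y Ky del del0|x y Kx del del0].
- exact/subset_norm_closure/(ideal0 iI).
- have d2 : 0 < del / 2 by lra.
  have [k Ik hk] := Kx _ d2; have [l Il hl] := Ky _ d2.
  exists (k + l); first exact: (idealD iI).
  rewrite opprD addrACA; have := ucD uc (x - k) (y - l); lra.
- have [d d0 hd] := pert (cabs k) _ (cabs_ge0 k) del0.
  have [l Il hl] := Kx _ d0; exists (k *: l); first exact: (idealZ iI).
  rewrite -scalerBr (ucZ uc) -/(cabs k); apply: le_trans hd.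
  by rewrite ler_wpM2l ?cabs_ge0.
- have [d d0 hd] := pert (N x) _ (N_ge0 uc x) del0.
  have [l Il hl] := Ky _ d0; exists (x ** l); first exact: (idealMl iI).
  have -> : x ** y - x ** l = x ** (y - l) by rewrite amulDr salgNr.
  by apply: le_trans (ucM uc _ _) _; apply: le_trans hd; rewrite ler_wpM2l ?(N_ge0 uc).
- have [d d0 hd] := pert (N y) _ (N_ge0 uc y) del0.
  have [l Il hl] := Kx _ d0; exists (l ** y); first exact: (idealMr iI).
  have -> : x ** y - l ** y = (x - l) ** y by rewrite amulDl salgNl.
  by apply: le_trans (ucM uc _ _) _; apply: le_trans hd; rewrite mulrC ler_wpM2l ?(N_ge0 uc).
Qed.

Lemma ucclosed_norm_closure (I : set B) : ucclosed N (norm_closure I).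
Proof.
move=> u l Ku ul del del0; have d2 : 0 < del / 2 by lra.
have [n /(_ _ (leqnn _)) hn] := ul _ d2; have [k Ik hk] := Ku n _ d2.
exists k => //; apply: le_trans (N_triangle uc l (u n) k) _; rewrite (NC uc l (u n)).
move: hn hk; set x1 := N _; set x2 := N _; lra.
Qed.

End ideal_closure.

Section prim_multiplier.
Variables (R : realType) (A : cstarAlgType R).
Local Notation M := (multiplier A).
Implicit Types (a b : A) (m : M) (P : prim A) (Q : prim M).

Lemma tilde_primitive P : exists Q, (Q : set M) = tilde P.
Proof.
have [H [pi [rep irr EP]]] := prim_primitive P.
have pQ : primitive (tilde P).
  exists H, (extend_rep rep irr); split.
  - exact: extend_star_rep.
  - exact: extend_irreducible.
  - by rewrite EP extend_kernel.
by exists (Prim pQ).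
Qed.

Definition ptilde P : prim M := projT1 (cid (tilde_primitive P)).

Lemma ptildeE P : (ptilde P : set M) = tilde P.
Proof. by rewrite /ptilde; case: cid. Qed.

Lemma ptilde_minj P a : (ptilde P : set M) (minj a) <-> (P : set A) a.
Proof.
have [H [pi [rep irr EP]]] := prim_primitive P.
rewrite ptildeE EP -(extend_kernel rep irr) /=.
by split=> h x; [rewrite -(extend_rep_minj rep irr)|rewrite extend_rep_minj].
Qed.

Section restrict.
Variable Q : prim M.
Variables (a0 : A) (Qa0 : ~ (Q : set M) (minj a0)).

(** [A] is an ideal of [multiplier A], so for [x] nonzero the closure of the vectors
    [sig (minj a) x] is invariant under all multipliers and is everything. Hence the restriction to
    [A] stays irreducible as soon as it is nonzero. *)
Lemma restrict_primitive : exists P, (Q : set M) = tilde P.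
Proof.
have [H [sig [rep [_ inv] EQ]]] := prim_primitive Q.
pose pi a := sig (minj a).
have nondeg x : (forall a, pi a x = 0) -> x = 0.
  pose K := [set z | forall a, pi a z = 0].
  have csK : closed_subspace K.
    split=> [z /hnorm_closure clz a|a|k z w Kz Kw a].
    - apply: hnorm_le0 => eps eps0; have [del del0 hd] := rep_cont rep (minj a) z eps0.
      by have [w Kw hw] := clz _ del0; have := hd _ hw; rewrite -/(pi a w) Kw subr0.
    - exact: (rep0r rep).
    - by rewrite /pi (rep_linear rep) -!/(pi a _) Kz Kw scaler0 addr0.
  have [|K0|KT] := inv K csK.
  - by move=> m z Kz a; rewrite /pi -(repM rep) minj_mul_r; exact: Kz.
  - by move=> h; have : K x by []; rewrite K0.
  - move=> _; exfalso; apply: Qa0; rewrite EQ => z.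
    by have : K z by [rewrite KT]; exact.
have prep : star_representation pi.
  split=> [a|a k x y|k a b x|a b x|a x y]; rewrite /pi.
  - exact: (rep_continuous rep).
  - exact: (rep_linear rep).
  - by rewrite minjDZ (repDZ rep).
  - by rewrite minjM (repM rep).
  - by rewrite minj_star (rep_star rep).
have pirr : irreducible_rep pi.
  split.
    apply: contrapT => nex; apply: Qa0; rewrite EQ => z.
    by apply: contrapT => /eqP nz; apply: nex; exists a0, z.
  move=> K cK invK; have [K0|nK] := pselect (forall x, K x -> x = 0).
    by left; apply/seteqP; split=> [x /K0|_ ->] //; exact: (cs0 cK).
  right; have [x [Kx x0]] : exists x, K x /\ x <> 0.
    by apply: contrapT => nex; apply: nK => x Kx; apply: contrapT => x0; apply: nex; exists x.
  pose L := closure (range (pi^~ x)).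
  have csL : closed_subspace L.
    apply: closed_subspace_closure; first by exists 0 => //; exact: (rep0l prep).
    by move=> k _ _ [a _ <-] [b _ <-]; exists (k *: a + b) => //; rewrite (repDZ prep).
  have LK : L `<=` K.
    rewrite (closure_id K).1; last exact: (cs_closed cK).
    by apply: closureS => _ [a _ <-]; exact: invK.
  have [|L0|LT] := inv L csL.
  - move=> m y Ly U /(rep_continuous rep) /Ly[_ [[c _ <-] Uc]].
    exists (sig m (pi c x)); split=> //; exists (mul_l m c) => //.
    by rewrite /pi -minj_mul_l (repM rep).
  - exfalso; apply: x0; apply: nondeg => a.
    have : L (pi a x) by apply: subset_closure; exists a.
    by rewrite L0.
  - by apply/seteqP; split=> // y _; apply: LK; rewrite LT.
have pP : primitive [set a | forall x, pi a x = 0] by exists H, pi.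
exists (Prim pP); rewrite EQ; apply/seteqP; split=> m /= h.
  move=> a; split=> x.
    by rewrite /pi -minj_mul_l (repM rep) h.
  by rewrite /pi -minj_mul_r (repM rep) h (rep0r rep).
move=> x; apply: nondeg => a; rewrite /pi -(repM rep) minj_mul_r.
exact: (h a).2.
Qed.

End restrict.

Lemma prim_separation (J : set M) a : ideal J -> ucclosed (@mnorm R A) J -> ~ J (minj a) ->
  exists P, J `<=` ptilde P /\ ~ (P : set A) a.
Proof.
move=> iJ cJ Ja; have [Q JQ Qa] := primitive_separation (multiplier_ucstar A) iJ cJ Ja.
have [P QP] := restrict_primitive Qa.
exists P; rewrite ptildeE -QP; split=> //.
by move=> /ptilde_minj; rewrite ptildeE -QP.
Qed.

(** Each [m a] lies in every primitive ideal of [A], hence is zero. This is the density of the image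
    of [prim A] in [prim (multiplier A)]. *)
Lemma bigcap_ptilde m : (forall P, (ptilde P : set M) m) -> m = 0.
Proof.
move=> h; apply: multiplier_eq => a; apply: contrapT => /eqP nz.
have [| |nJ|P [_ Pa]] := @prim_separation [set 0] (mul_l m a).
- split=> [|x y -> ->|k x ->|x y ->|x y ->] //=.
  + by rewrite addr0.
  + by rewrite scaler0.
  + exact: salg0r.
  + exact: salg0l.
- move=> u l u0 ul /=; apply: (uclim_unique (multiplier_ucstar A) ul) => eps eps0.
  by exists 0 => n _; rewrite u0 subrr (N0 (multiplier_ucstar A)) ltW.
- move: nz; rewrite /= -minj0 in nJ; rewrite (minj_inj nJ).
  by rewrite (_ : mul_l 0 a = 0) ?eqxx.
- by apply: Pa; have := h P; rewrite ptildeE => /(_ a)[].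
Qed.

(* [Q] contains the directed union of the ideals [\bigcap_(P in T i) ptilde P];
   the distance hypothesis keeps [b] out of the closure of this union. *)
Lemma limit_primitive (I : Type) (i0 : I) (T : I -> set (prim A)) (b : M) (eps : R) :
  0 < eps -> (forall i j, exists k, T k `<=` T i `&` T j) -> (forall i, T i !=set0) ->
  (forall P k, (exists i, T i P) -> (ptilde P : set M) k -> eps <= mnorm (b - k)) ->
  exists Q : prim M, ~ (Q : set M) b /\
    forall i m, (forall P, T i P -> (ptilde P : set M) m) -> (Q : set M) m.
Proof.
move=> eps0 dir ne far; have uc := multiplier_ucstar A.
pose Ki i := [set m | forall P, T i P -> (ptilde P : set M) m].
have iKi i : ideal (Ki i).
  split=> [P _|x y Kx Ky P TP|k x Kx P TP|x y Ky P TP|x y Kx P TP].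
  - exact: ideal0 (prim_ideal_ideal _).
  - by apply: (idealD (prim_ideal_ideal _)); [exact: Kx|exact: Ky].
  - by apply: (idealZ (prim_ideal_ideal _)); exact: Kx.
  - by apply: (idealMl (prim_ideal_ideal _)); exact: Ky.
  - by apply: (idealMr (prim_ideal_ideal _)); exact: Kx.
have iK : ideal [set m | exists i, Ki i m].
  split=> [|x y [i Kx] [j Ky]|k x [i Kx]|x y [i Ky]|x y [i Kx]].
  - by exists i0; exact: ideal0 (iKi _).
  - have [n Tn] := dir i j; exists n.
    by apply: (idealD (iKi n)) => P /Tn[Ti Tj]; [exact: Kx|exact: Ky].
  - by exists i; exact: (idealZ (iKi i)).
  - by exists i; exact: (idealMl (iKi i)).
  - by exists i; exact: (idealMr (iKi i)).
have [|Q KQ Qb] := primitive_separation uc (ideal_norm_closure uc iK)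
    (@ucclosed_norm_closure _ _ _ _ uc _) (b := b).
  move=> /(_ (eps / 2) ltac:(lra))[k [i Kk] hk]; have [P TP] := ne i.
  have := far P k (ex_intro _ i TP) (Kk _ TP); lra.
exists Q; split=> // i m Km; apply/KQ/(subset_norm_closure uc); exists i; exact: Km.
Qed.

End prim_multiplier.

(** * Distances to primitive ideals *)

Lemma complex_Re_ge0 (R : realType) (z : R[i]) : 0 <= z -> 0 <= complex.Re z.
Proof. by rewrite lecE /= => /andP[]. Qed.

Section peak.
Variables (R : realType) (B : starAlgType R) (e : B) (N : B -> R).
Hypothesis uc : ucstar e N.
Implicit Types (h k m w y z : B) (Q : prim B).

Lemma irreducible_unit (H : hilbertType R) (sig : B -> H -> H) x :
  star_representation sig -> irreducible_rep sig -> sig e x = x.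
Proof.
move=> rep irr; apply/eqP; rewrite -subr_eq0; apply/eqP.
apply: (irreducible_nondegenerate rep irr) => a.
by rewrite (repB rep) -(repM rep) (uc1r uc) subrr.
Qed.

(** For [v = (w - z) x] one has [(w + z) v = 0]. Both quadratic forms are nonnegative, so they
    vanish at [v]; thus [w v = z v = 0], which forces [v = 0]. *)
Lemma abs_rep (H : hilbertType R) (sig : B -> H -> H) w z :
  star_representation sig -> pos w -> sa z -> w ** w = z ** z -> z ** w = w ** z ->
  (forall x, 0 <= complex.Re (inner (sig z x) x)) -> forall x, sig w x = sig z x.
Proof.
move=> rep pw sz ww zw z0 x; pose v := sig (w - z) x.
have sw := pos_sa pw.
have wzv : sig w v + sig z v = 0.
  rewrite -(repDl rep) /v -(repM rep).
  have -> : (w + z) ** (w - z) = 0.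
    by rewrite amulDl !amulDr !salgNr ww zw; nc R B.
  exact: (rep0l rep).
have wv : sig w v = 0.
  have [r sr rE] := pw.
  have E : inner (sig w v) v = (hnorm (sig r v) ^+ 2)%:C.
    by rewrite rE -{1}sr (rep_starM_norm rep).
  have h1 : 0 <= complex.Re (inner (sig w v) v) by rewrite E sqr_ge0.
  have h2 := z0 v.
  have h3 : complex.Re (inner (sig w v) v) + complex.Re (inner (sig z v) v) = 0.
    by rewrite -raddfD /= -innerD wzv inner0l.
  have : hnorm (sig r v) ^+ 2 = 0 by move: h1 h2 h3; rewrite E /=; lra.
  move=> /eqP; rewrite sqrf_eq0 => /eqP /hnorm_eq0 rv0.
  by rewrite rE (repM rep) rv0 (rep0r rep).
have zv : sig z v = 0 by move: wzv; rewrite wv add0r.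
have v0 : v = 0.
  apply: inner_eq0; rewrite {2}/v.
  have sd : star (w - z) = w - z by exact: saB.
  by rewrite -(rep_star rep) sd (repBl rep) wv zv subrr inner0l.
by apply/eqP; rewrite -subr_eq0 -(repBl rep) -/v v0.
Qed.

Lemma prim_starM Q m : (Q : set B) (star m ** m) -> (Q : set B) m.
Proof.
have [H [sig [rep _ ->]]] := prim_primitive Q; move=> /= h x.
apply: hnorm_eq0; apply/eqP; rewrite -sqrf_eq0; apply/eqP/complexI.
by rewrite -(rep_starM_norm rep) h inner0l.
Qed.

(* With [m1 = c m* m] a positive contraction and [z = eps - m1], the element
   [y = |z| - z] is twice the positive part of [m1 - eps]. *)
Lemma peak Q m : ~ (Q : set B) m -> exists (c eps : R) y, [/\ 0 < eps, ~ (Q : set B) y &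
  forall Q' : prim B, ~ (Q' : set B) y -> forall k, (Q' : set B) k ->
    eps <= N (c%:C *: (star m ** m) - k)].
Proof.
move=> Qm; pose s := N (star m ** m) + 1.
have s0 : 0 < s by rewrite /s; have := N_ge0 uc (star m ** m); lra.
pose m1 := s^-1%:C *: (star m ** m).
have pm1 : pos m1 by apply: posZ; [rewrite invr_ge0 ltW|exact: (pos_starM uc)].
have Nm1 : N m1 <= 1.
  by rewrite (NZ uc) gtr0_norm ?invr_gt0// ler_pdivrMl// mulr1 /s; lra.
have Qm1 : ~ (Q : set B) m1.
  move=> h; apply/Qm/prim_starM.
  rewrite -(realZ_inv (star m ** m) s0); exact: (idealZ (prim_ideal_ideal Q)).
pose z (eps : R) := eps%:C *: e - m1.
have sz eps : sa (z eps).
  by apply: saB; [apply/saZ/(star_e uc)|exact: pos_sa].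
have pem1 : pos (e - m1).
  rewrite -[e]scale1r -(rmorph1 (real_complex R)).
  by apply: (pos_sub uc) => //; exact: pos_sa.
have Nz eps : 0 < eps < 1 -> N (z eps) <= 1.
  move=> /andP[e0 e1]; apply: (N_le1 uc) => //.
    have -> : e - z eps = (1 - eps)%:C *: e + m1 by rewrite /z; nc R B.
    by apply: (posD uc) => //; apply: posZ; [lra|exact: (pos_e uc)].
  have -> : e + z eps = (e - m1) + eps%:C *: e by rewrite /z; nc R B.
  by apply: (posD uc) => //; apply: posZ; [lra|exact: (pos_e uc)].
have abs (eps : R) : exists w, 0 < eps < 1 ->
    [/\ pos w, w ** w = z eps ** z eps & z eps ** w = w ** z eps].
  case: (boolP (0 < eps < 1)) => he; last by exists 0.
  by have [w [? ? ? _]] := abs_exists uc (sz eps) (Nz _ he); exists w.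
have [w hw] := boolp.choice abs.
(* If [y] lay in [Q] for all [eps], then [m1 <= eps] would hold in the representation of [Q] for all
   [eps], and [m] would act as zero. *)
have [eps [he Qy]] : exists eps, 0 < eps < 1 /\ ~ (Q : set B) (w eps - z eps).
  apply: contrapT => nex; apply: Qm1.
  have [H [sig [rep irr EQ]]] := prim_primitive Q.
  have le eps x : 0 < eps < 1 -> complex.Re (inner (sig m1 x) x) <= eps * hnorm x ^+ 2.
    move=> he; have [pw _ _] := hw _ he.
    have Qy : (Q : set B) (w eps - z eps).
      by apply: contrapT => nQ; apply: nex; exists eps.
    rewrite EQ /= in Qy; have := Qy x; rewrite (repBl rep) => /eqP; rewrite subr_eq0 => /eqP E.
    have := complex_Re_ge0 (rep_pos rep x pw); rewrite E /z (repBl rep) (repZl rep).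
    rewrite (irreducible_unit x rep irr) innerD innerN innerZ -hnorm_sq -rmorphM.
    by rewrite raddfB /= subr_ge0.
  have sm1 : s^-1%:C *: (star m ** m) = m1 by [].
  apply: contrapT => nQ; apply: Qm; rewrite EQ => x.
  apply: hnorm_eq0; apply/eqP; rewrite -sqrf_eq0 eq_le sqr_ge0 andbT.
  apply/ler_addgt0Pr => del del0; rewrite add0r.
  pose M := s * (hnorm x ^+ 2 + 1); have x2 := sqr_ge0 (hnorm x).
  have M0 : 0 < M by rewrite mulr_gt0//; lra.
  pose eps := Num.min (2^-1) (del / M).
  have eps0 : 0 < eps by rewrite lt_min invr_gt0 ltr0n divr_gt0.
  have eps1 : eps < 1.
    by apply: (@le_lt_trans _ _ 2^-1); [rewrite ge_min lexx|lra].
  have epsM : eps * M <= del by rewrite -ler_pdivlMr// ge_min lexx orbT.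
  have := le eps x; rewrite eps0 eps1 => /(_ isT).
  rewrite -sm1 (repZl rep) innerZ (rep_starM_norm rep) -rmorphM /= ler_pdivrMl//.
  move=> h; apply: le_trans h _; apply: le_trans epsM.
  rewrite /M mulrCA ler_pM2l// ler_pM2l//; lra.
have [eps0 eps1] := andP he; have [pw ww zw] := hw _ he.
(* An element [k] of [Q'] closer than [eps] to [m1] would make [z = eps - m1] act positively, hence
   [y = |z| - z] act as zero. *)
exists s^-1, eps, (w eps - z eps); split=> // Q' Q'y k Q'k; rewrite leNgt; apply/negP => lt.
apply: Q'y; have [H [sig [rep irr EQ]]] := prim_primitive Q'.
rewrite EQ /= => x; rewrite (repBl rep).
rewrite (abs_rep rep pw (sz eps) ww zw) ?subrr// => {}x.
rewrite EQ in Q'k; have m1k : sig m1 x = sig (m1 - k) x by rewrite (repBl rep) Q'k subr0.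
rewrite /z (repBl rep) (repZl rep) (irreducible_unit x rep irr) innerD innerN innerZ m1k.
rewrite -hnorm_sq -rmorphM raddfB /= subr_ge0.
apply: le_trans (ler_norm _) _; apply: le_trans (Re_le_cabs _) _.
apply: le_trans (inner_CS _ _) _; rewrite expr2 mulrA ler_wpM2r ?hnorm_ge0//.
apply: le_trans (rep_contract rep uc _ _) _.
by rewrite ler_wpM2r ?hnorm_ge0// ltW.
Qed.

End peak.

Section ge0_at.
Variables (R : realType) (A : cstarAlgType R).
Local Notation M := (multiplier A).
Local Notation e := (mone A).
Let uc := multiplier_ucstar A.
Implicit Types (P : prim A) (h k m : M) (a : A).

(** Order in the quotient of [multiplier A] by [ptilde P], tested on the irreducible representations
    with this kernel. Comparing real parts only lets arbitrary, not necessarily self-adjoint,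
    elements of [ptilde P] be added. *)
Definition ge0_at P h := forall (H : hilbertType R) (sig : M -> H -> H),
  star_representation sig -> irreducible_rep sig ->
  (ptilde P : set M) = [set m | forall x, sig m x = 0] ->
  forall x, 0 <= complex.Re (inner (sig h x) x).

Definition far (eps : R) P h := forall k, (ptilde P : set M) k -> eps <= mnorm (h - k).

Lemma ge0_at_pos P h : pos h -> ge0_at P h.
Proof.
by move=> ph H sig rep _ _ x; exact/complex_Re_ge0/(rep_pos rep).
Qed.

Lemma ge0_atD P h k : ge0_at P h -> ge0_at P k -> ge0_at P (h + k).
Proof.
move=> ph pk H sig rep irr E x; rewrite (repDl rep) innerD raddfD addr_ge0//=.
  exact: ph.
exact: pk.
Qed.

Lemma ge0_at_eq P h k : ge0_at P h -> (ptilde P : set M) (k - h) -> ge0_at P k.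
Proof.
move=> ph Pk H sig rep irr E x; have := Pk; rewrite E => /= kx.
have -> : sig k x = sig h x by apply/eqP; rewrite -subr_eq0 -(repBl rep) kx.
exact: ph.
Qed.

Lemma ge0_at_N P h r : mnorm h <= r -> ge0_at P (r%:C *: e + h).
Proof.
move=> hr H sig rep irr _ x.
rewrite (repDl rep) (repZl rep) (irreducible_unit uc x rep irr) innerD innerZ.
rewrite -hnorm_sq -rmorphM raddfD /=.
have h1 := Re_le_cabs (inner (sig h x) x); have h2 := inner_CS (sig h x) x.
have h3 := rep_contract rep uc h x; have n0 := hnorm_ge0 x.
have h4 := ler_wpM2r n0 (le_trans h3 (ler_wpM2r n0 hr)).
have := ler_norm (- complex.Re (inner (sig h x) x)); rewrite normrN expr2; lra.
Qed.

Lemma ge0_at_Nneg P (r : R) : 0 < r -> ~ ge0_at P (- (r%:C *: e)).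
Proof.
move=> r0 h; have [H [sig [rep irr E]]] := prim_primitive (ptilde P).
have [x x0] := irreducible_vector rep irr.
have := h H sig rep irr E x.
rewrite (repNl rep) (repZl rep) (irreducible_unit uc x rep irr) innerN innerZ.
rewrite -hnorm_sq -rmorphM raddfN /= oppr_ge0 leNgt mulr_gt0// exprn_gt0//.
rewrite lt_neqAle hnorm_ge0 andbT eq_sym; apply: contraNneq x0 => /hnorm_eq0 ->.
by [].
Qed.

Lemma prim_proper P : exists a, ~ (P : set A) a.
Proof.
have [H [pi [rep [[b [x nz]] _] ->]]] := prim_primitive P; exists b => /(_ x) b0.
by rewrite b0 eqxx in nz.
Qed.

(* Vectors in the range of [A] are dense, and there the strict limit may be
   computed. *)
Lemma irreducible_minj_dense P (H : hilbertType R) (sig : M -> H -> H) :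
  star_representation sig -> irreducible_rep sig ->
  (ptilde P : set M) = [set m | forall x, sig m x = 0] ->
  forall z eps, 0 < eps ->
    exists2 d, [set y | exists a x, y = sig (minj a) x] d & hnorm (z - d) <= eps.
Proof.
move=> rep irr E z eps eps0; have [b Pb] := prim_proper P.
have [x bx] : exists x, sig (minj b) x <> 0.
  apply: contrapT => nex; apply/Pb/ptilde_minj; rewrite E => x.
  by apply: contrapT => bx; apply: nex; exists x.
have bx' : sig (minj b) x != 0 by apply/eqP.
have [m hm] := irreducible_cyclic rep irr bx' z eps0.
exists (sig m (sig (minj b) x)) => //.
by exists (mul_l m b), x; rewrite -(repM rep) minj_mul_l.
Qed.

End ge0_at.

(** * Strict convergence of series dominated by an approximate unit *)

Section strict_series.
Variables (R : realType) (A : cstarAlgType R).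
Local Notation M := (multiplier A).
Local Notation e := (mone A).
Let uc := multiplier_ucstar A.
Implicit Types (P : prim A) (a : A).

Lemma ge0_at_strict_lim P (h : nat -> M) (h0 : M) (k0 : nat) :
  (forall l : nat, (k0 <= l)%N -> ge0_at P (h l)) ->
  (forall a, hlim (fun l => mul_l (h l) a) (mul_l h0 a)) -> ge0_at P h0.
Proof.
move=> hpos hl H sig rep irr E.
apply: (dense_form_ge0 (irreducible_minj_dense rep irr E) (mnorm_ge0 h0)).
- exact: (repB rep).
- exact: (rep_contract rep uc).
move=> _ [a [z ->]]; set d := sig (minj a) z.
have nz := hnorm_ge0 z; have nd := hnorm_ge0 d.
apply/ler_addgt0Pr => eps eps0.
have C1 : 0 < hnorm z * hnorm d + 1 by have := mulr_ge0 nz nd; lra.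
have [i0 hi] := hl a _ (divr_gt0 eps0 C1).
have h1 := hi _ (leq_maxr k0 i0); set l := maxn k0 i0 in h1.
have h2 := hpos l (leq_maxl k0 i0) H sig rep irr E d.
have h3 : sig (h0 - h l) d = sig (minj (mul_l h0 a - mul_l (h l) a)) z.
  by rewrite -mul_l_sub -minj_mul_l (repM rep).
have h4 : `|complex.Re (inner (sig (h0 - h l) d) d)| <= eps.
  apply: le_trans (Re_le_cabs _) _; apply: le_trans (inner_CS _ _) _.
  rewrite h3; have h5 := rep_contract rep uc (minj (mul_l h0 a - mul_l (h l) a)) z.
  have h6 := le_trans (ler_wpM2r nd h5) _; apply: h6.
  rewrite mnorm_minj hnormC -mulrA.
  move: h1; rewrite ler_pdivlMr//; set x := hnorm _; have x0 : 0 <= x by exact: hnorm_ge0.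
  by apply: le_trans; rewrite ler_wpM2l//; lra.
have h5 : complex.Re (inner (sig h0 d) d) =
    complex.Re (inner (sig (h l) d) d) + complex.Re (inner (sig (h0 - h l) d) d).
  by rewrite -raddfD /= -innerD -(repDl rep) addrC subrK.
move: h4; rewrite ler_norml => /andP[h4 _]; rewrite h5; lra.
Qed.

(** [t ** t <= t <= w], so [|t a| ^ 2 = |a* t t a| <= |a* w a|]. *)
Lemma pos_sq_le (t w : M) a : pos t -> pos (w - t) -> pos (e - t) ->
  hnorm (mul_l t a) ^+ 2 <= hnorm a * hnorm (mul_l w a).
Proof.
move=> pt pwt pet; have st := pos_sa pt.
have ptt : pos (t - t ** t).
  have -> : t - t ** t = t ** (e - t) by rewrite amulDr salgNr (uc1r uc).
  apply: (posM uc) => //.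
  by rewrite amulDr amulDl salgNr salgNl (uc1r uc) (uc1l uc).
have pw : pos (w - t ** t) by rewrite -(subrK t w) -addrA; exact: (posD uc).
have -> : hnorm (mul_l t a) ^+ 2 = mnorm (star (minj a) ** (t ** t) ** minj a).
  by rewrite -cs_norm_starM -mnorm_minj minjM minj_star -minj_mul_l starM st !amulA.
have h : mnorm (star (minj a) ** (t ** t) ** minj a) <= mnorm (star (minj a) ** w ** minj a).
  apply: (pos_N_mono uc); first by apply: (pos_conj uc); exists t.
  have -> : star (minj a) ** w ** minj a - star (minj a) ** (t ** t) ** minj a =
      star (minj a) ** (w - t ** t) ** minj a by rewrite amulDr amulDl salgNr salgNl.
  exact: (pos_conj uc).
apply: le_trans h _; rewrite -amulA minj_mul_l -minj_star -minjM mnorm_minj.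
by apply: le_trans (cs_normM _ _) _; rewrite cs_norm_star.
Qed.

Section series.
Variables (D U : nat -> M).
Hypotheses (pD : forall n, pos (D n)) (pUD : forall n, pos (U n.+1 - U n - D n)).
Hypotheses (pU : forall n, pos (U n)) (peU : forall n, pos (e - U n)).
Hypothesis cU : forall a, hcauchy (fun n => mul_l (U n) a).
Let s n := \sum_(i < n) D i.

Lemma partial_sum_pos (n l : nat) : (n <= l)%N ->
  pos (s l - s n) /\ pos (U l - U n - (s l - s n)).
Proof.
elim: l => [|l IH]; first by rewrite leqn0 => /eqP ->; rewrite !subrr; split; exact: pos0.
rewrite leq_eqVlt => /orP[/eqP ->|]; first by rewrite !subrr; split; exact: pos0.
rewrite ltnS => /IH [p1 p2]; rewrite /s big_ord_recr /= -!/(s _); split.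
  by rewrite addrAC; exact: (posD uc).
have -> : U l.+1 - U n - (s l + D l - s n) =
    (U l.+1 - U l - D l) + (U l - U n - (s l - s n)).
  rewrite [RHS]addrACA [U l.+1 - U l + _]addrA subrK -opprD.
  by congr (_ - _); rewrite [RHS]addrCA [RHS]addrA.
exact: (posD uc).
Qed.

(** Apply [pos_sq_le] to [t = s l - s n] and [w = U l - U n]: the increments of the sum are
    dominated by those of [U]. The estimate is quadratic, hence the [eps ^ 2]. *)
Lemma partial_sum_cauchy a : hcauchy (fun n => mul_l (s n) a).
Proof.
move=> eps eps0; have a1 : 0 < hnorm a + 1 by have := hnorm_ge0 a; lra.
have [i0 hi] := cU a (divr_gt0 (exprn_gt0 2 eps0) a1).
suff le (n l : nat) : (i0 <= n)%N -> (n <= l)%N -> hnorm (mul_l (s n) a - mul_l (s l) a) <= eps.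
  exists i0 => n l i0n i0l; have [nl|/ltnW ln] := leqP n l; first exact: le.
  by rewrite hnormC; exact: le.
move=> i0n nl; rewrite hnormC -mul_l_sub.
rewrite -(@ler_pXn2r _ 2)// ?nnegrE ?hnorm_ge0 ?(ltW eps0)//.
have [p1 p2] := partial_sum_pos nl.
have p3 : pos (e - (s l - s n)).
  have -> : e - (s l - s n) = (e - U l) + (U n + (U l - U n - (s l - s n))).
    by rewrite [U n + _]addrA [U n + _]addrCA subrr addr0 addrA subrK.
  by apply: (posD uc) => //; exact: (posD uc).
apply: le_trans (pos_sq_le a p1 p2 p3) _.
have h := hi _ _ (leq_trans i0n nl) i0n; rewrite -mul_l_sub in h.
apply: (@le_trans _ _ ((hnorm a + 1) * (eps ^+ 2 / (hnorm a + 1)))).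
  by apply: ler_pM; rewrite ?hnorm_ge0//; lra.
by rewrite mulrC divfK// gt_eqF.
Qed.

Lemma strict_series : exists m, forall a,
  hlim (fun n => mul_l (s n) a) (mul_l m a) /\ hlim (fun n => mul_r a (s n)) (mul_r a m).
Proof.
apply: strict_complete => a; first exact: partial_sum_cauchy.
move=> eps eps0; have [i0 hi] := partial_sum_cauchy (star a) eps0.
have ss n : star (s n) = s n.
  by apply: pos_sa; have [] := partial_sum_pos (leq0n n); rewrite {2}/s big_ord0 subr0.
have E n : mul_r a (s n) = star (mul_l (s n) (star a)).
  by rewrite -{2}[s n]ss mul_l_star !starK.
exists i0 => i j i0i i0j; rewrite !E -[- star _]scaleN1r.
have := hi _ _ i0i i0j; rewrite -cs_norm_star starD -[- mul_l _ _]scaleN1r starZ.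
by rewrite rmorphN rmorph1.
Qed.

End series.
End strict_series.

(** * The base map on the primitive ideal space of the multiplier algebra *)

Lemma prim_closureP (R : realType) (B : starAlgType R) (S : set (prim B)) (P : prim B) :
  closure S P <-> forall b, (forall P', S P' -> (P' : set B) b) -> (P : set B) b.
Proof.
split=> [clP b Sb|h U [V [[T ->] PT VU]]].
  apply: contrapT => Pb.
  have [|P' [SP' nP']] := clP [set P' : prim B | ~ ([set b] `<=` P')].
    exists [set P' : prim B | ~ ([set b] `<=` P')]; split=> //; first by exists [set b].
    by move=> /(_ b erefl).
  by apply: nP' => _ ->; exact: Sb.
have [b Tb Pb] : exists2 b, T b & ~ (P : set B) b.
  by apply: contrapT => nex; apply: PT => b Tb; apply: contrapT => Pb; apply: nex; exists b.
apply: contrapT => nSU; apply: Pb; apply: h => P' SP'; apply: contrapT => P'b.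
by apply: nSU; exists P'; split=> //; apply: VU => /(_ b Tb).
Qed.

Lemma prim_open_notin (R : realType) (B : starAlgType R) (b : B) :
  open [set P : prim B | ~ (P : set B) b].
Proof.
exists [set b]; apply/seteqP; split=> P /= Pb; first by move=> /(_ b erefl).
by move=> h; apply: Pb => _ ->.
Qed.

(** * Separation of points in the Stone-Cech compactification *)

Section stone_cech_facts.
Variables (R : realType) (X : topologicalType).
Hypotheses (hsdf : hausdorff_space X) (lcpt : locally_compact [set: X]).

Lemma bump (x : X) (N : set X) : nbhs x N ->
  exists f : @unit_fun R X, sval f x = 0 /\ forall y, ~ N y -> sval f y = 1.
Proof.
move=> /nbhs_interior /nbhs_singleton Nx.
have cr := @locally_compact_completely_regular X R lcpt hsdf.
have sep := cr x (~` N°) (open_closedC (open_interior N)) (fun h => h Nx).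
pose g := @Urysohn X R [set x] (~` N°).
have hg : continuous g /\ forall y, 0 <= g y <= 1.
  split=> [|y]; first exact: Urysohn_continuous.
  by have := @Urysohn_range X R [set x] (~` N°) (g y); rewrite /= in_itv /=; apply; exists y.
exists (exist _ g hg); split=> /= [|y Ny].
  by apply: (Urysohn_sub0 sep); exists x.
by apply: (Urysohn_sub1 sep); exists y => // /interior_subset.
Qed.

Lemma to_stone_cech_inj (x y : X) : to_stone_cech R x = to_stone_cech R y -> x = y.
Proof.
move=> xy; apply: hsdf => U V Ux Vy; apply: contrapT => nUV.
have [f [f0 f1]] := bump Ux.
have : sval f x = sval f y by have := congr1 (fun z => sval z f) xy.
rewrite f0 f1 => [/eqP|Uy]; first by rewrite eq_sym oner_eq0.
by apply: nUV; exists y; split=> //; exact: nbhs_singleton.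
Qed.

Lemma stone_cech_eval_continuous (f : @unit_fun R X) :
  continuous (fun z : stone_cech R X => (sval z : unit_fun -> R) f).
Proof.
move=> z; apply: (@continuous_comp (stone_cech R X) {ptws unit_fun -> R} R
  sval (fun g => g f)); first exact: initial_continuous.
exact: (@proj_continuous _ (fun=> R) f).
Qed.

End stone_cech_facts.

(** The sums [j + i] form an ideal. If its closure missed some [a], a primitive ideal containing
    both kernels would be adherent to both [S1] and [S2]. *)
Lemma separated_dense (R : realType) (A : cstarAlgType R) (S1 S2 : set (prim A)) :
  (forall P, closure S1 P -> closure S2 P -> False) ->
  forall (a : A) (del : R), 0 < del -> exists j i, [/\ forall P, S1 P -> (P : set A) j,
    forall P, S2 P -> (P : set A) i & hnorm (a - (j + i)) <= del].
Proof.
move=> disj a del del0; have uc := multiplier_ucstar A.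
pose ker (S : set (prim A)) : set A := [set j | forall P, S P -> (P : set A) j].
have ker_mul_l S m j : ker S j -> ker S (mul_l m j).
  move=> Sj P SP; apply/ptilde_minj; rewrite -minj_mul_l.
  by apply: (idealMl (prim_ideal_ideal _)); apply/ptilde_minj; exact: Sj.
have ker_mul_r S m j : ker S j -> ker S (mul_r j m).
  move=> Sj P SP; apply/ptilde_minj; rewrite -minj_mul_r.
  by apply: (idealMr (prim_ideal_ideal _)); apply/ptilde_minj; exact: Sj.
have kerD S j i : ker S j -> ker S i -> ker S (j + i).
  by move=> Sj Si P SP; apply: (idealD (prim_ideal_ideal _)); [exact: Sj|exact: Si].
have kerZ S k j : ker S j -> ker S (k *: j).
  by move=> Sj P SP; apply: (idealZ (prim_ideal_ideal _)); exact: Sj.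
have ker0 S : ker S 0 by move=> P _; exact: ideal0 (prim_ideal_ideal _).
pose I := [set m : multiplier A | exists j i, [/\ ker S1 j, ker S2 i & m = minj (j + i)]].
have iI : ideal I.
  split=> [|_ _ [j [i [hj hi ->]]] [j' [i' [hj' hi' ->]]]|k _ [j [i [hj hi ->]]]
    |x _ [j [i [hj hi ->]]]|_ x [j [i [hj hi ->]]]].
  - by exists 0, 0; rewrite addr0 minj0; split.
  - exists (j + j'), (i + i'); rewrite -minjD addrACA.
    by split=> //; exact: kerD.
  - by exists (k *: j), (k *: i); rewrite -minjZ scalerDr; split=> //; exact: kerZ.
  - exists (mul_l x j), (mul_l x i); rewrite minj_mul_l mul_lD.
    by split=> //; exact: ker_mul_l.
  - exists (mul_r j x), (mul_r i x).
    have -> : mul_r j x + mul_r i x = mul_r (j + i) x.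
      by have := mul_rDZ x 1 j i; rewrite !scale1r.
    by rewrite minj_mul_r; split=> //; exact: ker_mul_r.
have [Ia|Ia] := pselect (norm_closure (@mnorm R A) I (minj a)).
  have [_ [j [i [hj hi ->]]] h] := Ia _ del0.
  by exists j, i; split=> //; rewrite -mnorm_minj minjB.
have [P [IP Pa]] := prim_separation (ideal_norm_closure uc iI)
  (@ucclosed_norm_closure _ _ _ _ uc _) Ia.
case: (disj P); apply/prim_closureP => b hb; apply/ptilde_minj/IP/(subset_norm_closure uc).
  by exists b, 0; rewrite addr0; split.
by exists 0, b; rewrite add0r; split.
Qed.

Lemma cvg_hlim (R : realType) (A : cstarAlgType R) (v : nat -> A) l : v @ \oo --> l -> hlim v l.
Proof.
move=> vl eps eps0; have [|i0 _ hi] := vl [set y | hnorm (l - y) <= eps].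
  by apply/hnorm_nbhs; exists eps.
by exists i0 => i i0i; rewrite hnormC; exact: (hi i).
Qed.

(** Write [b] nearly as [j + i], with [j] vanishing on [S1] and [i] on [S2], and take [q] with [q j]
    small and [1 - q] in every ideal containing [j]. Then [D = b* (1 - q) b] vanishes on [S1], while
    [b* b - D = b* q b] is close to [b* q i], which vanishes on [S2]. *)
Lemma split_conj (R : realType) (A : cstarAlgType R) (S1 S2 : set (prim A)) (b : A) (eps : R) :
  (forall P, closure S1 P -> closure S2 P -> False) -> 0 < eps ->
  exists D : multiplier A, [/\ pos D, pos (minj (star b ** b) - D),
    forall P, S1 P -> (ptilde P : set (multiplier A)) D &
    forall P, S2 P -> exists2 k, (ptilde P : set (multiplier A)) k &
      mnorm (minj (star b ** b) - D - k) <= eps].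
Proof.
move=> disj eps0; have uc := multiplier_ucstar A.
have b0 := hnorm_ge0 b; have b1 : 0 < 2 * (hnorm b + 1) by lra.
(* Two errors of size [hnorm b * del] occur, one from [q j] and one from [b - (j + i)]. *)
pose del := eps / (2 * (hnorm b + 1)); have del0 : 0 < del by exact: divr_gt0.
have [j [i [hj hi hr]]] := separated_dense disj b del0.
have [q [pq peq Nq Nqj hq]] := approximate_unit uc (minj j) del0.
have E : minj (star b ** b) - star (minj b) ** (mone A - q) ** minj b =
    star (minj b) ** q ** minj b.
  rewrite minjM minj_star amulDr amulDl salgNr salgNl (uc1r uc) opprB.
  by rewrite addrCA subrr addr0.
exists (star (minj b) ** (mone A - q) ** minj b); rewrite E; split=> [||P SP|P SP].
- exact: (pos_conj uc).
- exact: (pos_conj uc).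
- have iP := prim_ideal_ideal (ptilde P).
  by apply/(idealMr iP)/(idealMl iP)/(hq _ iP)/ptilde_minj; exact: hj.
exists (star (minj b) ** q ** minj i).
  by apply: (idealMl (prim_ideal_ideal _)); exact/ptilde_minj/hi.
have -> : star (minj b) ** q ** minj b - star (minj b) ** q ** minj i =
    star (minj b) ** (q ** minj j) + star (minj b) ** (q ** minj (b - (j + i))).
  rewrite minjB minjD !amulDr !salgNr !amulDr !amulA opprD.
  set t1 := _ ** minj b; set t2 := _ ** minj i; set t3 := _ ** minj j.
  by rewrite [RHS]addrCA [t3 + _]addrA subrr add0r.
apply: le_trans (ucD uc _ _) _.
have n1 : mnorm (star (minj b)) = hnorm b by rewrite mnorm_star mnorm_minj.
have h1 := mnormM (star (minj b)) (q ** minj j).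
have h2 := mnormM (star (minj b)) (q ** minj (b - (j + i))).
have h3 : mnorm (q ** minj (b - (j + i))) <= del.
  apply: le_trans (mnormM _ _) _; rewrite mnorm_minj; apply: le_trans hr.
  by rewrite -[leRHS]mul1r ler_wpM2r ?hnorm_ge0.
rewrite n1 in h1 h2.
apply: (@le_trans _ _ (hnorm b * del + hnorm b * del)).
  apply: lerD; [apply: le_trans h1 _|apply: le_trans h2 _]; exact: ler_wpM2l.
have -> : eps = (2 * (hnorm b + 1)) * del by rewrite mulrC /del divfK// gt_eqF.
by nra.
Qed.

Lemma sigma_unitalP (R : realType) (A : cstarAlgType R) : sigma_unital A ->
  exists u : nat -> A, [/\ forall n, pos (minj (u n)), forall n, pos (mone A - minj (u n)),
    forall n, exists b, u n.+1 - u n = star b ** b & forall a, hlim (fun n => u n ** a) a].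
Proof.
move=> [u [up ui ul _]]; have uc := multiplier_ucstar A.
have pu n : pos (minj (u n)).
  have [[b ->] _] := up n; rewrite minjM minj_star; exact: (pos_starM uc).
exists u; split=> // [n|a].
  rewrite -[mone A]scale1r -(rmorph1 (real_complex R)).
  apply: (pos_sub uc); first exact: pos_sa.
  by rewrite mnorm_minj -lecR hnormE rmorph1; have [] := up n.
exact: cvg_hlim.
Qed.

(** [y] is outside [tilde P] exactly when some [y a] or [a y] is outside [P], and each of these
    conditions is open. *)
Lemma open_ptilde_notin (R : realType) (A : cstarAlgType R) (y : multiplier A) :
  open [set P : prim A | ~ (ptilde P : set (multiplier A)) y].
Proof.
have -> : [set P : prim A | ~ (ptilde P : set (multiplier A)) y] =
    \bigcup_(a in [set: A]) ([set P : prim A | ~ (P : set A) (mul_l y a)] `|`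
      [set P : prim A | ~ (P : set A) (mul_r a y)]).
  apply/seteqP; split=> P /=; rewrite ptildeE.
    move=> /existsNP[a /not_andP h]; exists a => //; exact: h.
  by move=> [a _ /= [h|h]] /(_ a) [].
by apply: bigcup_open => a _; apply: openU; exact: prim_open_notin.
Qed.

Lemma minj_range_ideal (R : realType) (A : cstarAlgType R) : ideal (range (@minj R A)).
Proof.
split=> [|_ _ [a _ <-] [b _ <-]|k _ [a _ <-]|m _ [a _ <-]|_ m [a _ <-]].
- by exists 0 => //; exact: minj0.
- by exists (a + b) => //; exact: minjD.
- by exists (k *: a) => //; exact: minjZ.
- by exists (mul_l m a) => //; rewrite minj_mul_l.
- by exists (mul_r a m) => //; rewrite minj_mul_r.
Qed.

Lemma minj_range_closed (R : realType) (A : cstarAlgType R) :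
  ucclosed (@mnorm R A) (range (@minj R A)).
Proof.
have uc := multiplier_ucstar A; move=> v l rv vl.
have /boolp.choice[c hc] : forall n, exists a, minj a = v n.
  by move=> n; have [a _ aE] := rv n; exists a.
have [|c0 hc0] := @hnorm_complete _ A c.
  move=> eps eps0; have e2 : 0 < eps / 2 by lra.
  have [n0 hn] := vl _ e2; exists n0 => m n n0m n0n.
  rewrite -mnorm_minj minjB !hc; apply: le_trans (N_triangle uc _ l _) _.
  by rewrite (NC uc l) [leRHS]splitr; apply: lerD; exact: hn.
exists c0 => //; apply: (uclim_unique uc _ vl) => eps eps0.
have [n0 hn] := hc0 _ eps0; exists n0 => n /hn.
by rewrite -hc -minjB mnorm_minj.
Qed.

(* With [z = 2U - 1], the square root [w] of [z^2] equals [1] modulo [A], and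
   [w = z] wherever [z >= 0]. *)
Lemma unit_of_half (R : realType) (A : cstarAlgType R) (u : A) :
  pos (minj u) -> pos (mone A - minj u) ->
  exists eA : A, forall P, ge0_at P (minj u - (2^-1)%:C *: mone A) ->
    (ptilde P : set (multiplier A)) (mone A - minj eA).
Proof.
move=> pu peu; have uc := multiplier_ucstar A.
have key (B : starAlgType R) (e x : B) (N : B -> R) : ucstar e N ->
    e - (x + x - e) ** (x + x - e) = (x + x + x + x) ** (e - x).
  move=> ucB; have [e1 e2] := (uc1l ucB, uc1r ucB).
  by rewrite !amulDr !amulDl !salgNl !salgNr !e1 !e2; nc R B.
pose z := minj u + minj u - mone A.
have sz : sa z by apply: saB; [apply: saD; exact: pos_sa|exact: (star_e uc)].
have Nz : mnorm z <= 1.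
  apply: (N_le1 uc) => //.
    have -> : mone A - z = (mone A - minj u) + (mone A - minj u).
      by rewrite /z; lin R[i] (multiplier A).
    exact: (posD uc).
  have -> : mone A + z = minj u + minj u by rewrite /z addrCA subrr addr0.
  exact: (posD uc).
have [w [pw ww zw hw]] := abs_exists uc sz Nz.
have [|c _ hc] := hw _ (@minj_range_ideal R A) (@minj_range_closed R A).
  have iI := @minj_range_ideal R A; have Iu : range (@minj R A) (minj u) by exists u.
  have -> : mone A - z ** z = (minj u + minj u + minj u + minj u) ** (mone A - minj u).
    exact: (key _ _ _ _ uc).
  by apply: (idealMr iI); do !apply: (idealD iI).
exists (u + (2^-1)%:C *: c) => P h.
have Pwz : (ptilde P : set (multiplier A)) (w - z).
  have [H [sig [rep irr E]]] := prim_primitive (ptilde P).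
  rewrite E => x /=; rewrite (repBl rep) (abs_rep rep pw sz ww zw) ?subrr// => {}x.
  have -> : z = (minj u - (2^-1)%:C *: mone A) + (minj u - (2^-1)%:C *: mone A).
    by rewrite /z; lin R[i] (multiplier A); field.
  exact: (ge0_atD h h rep irr E).
have -> : mone A - minj (u + (2^-1)%:C *: c) = (2^-1)%:C *: (w - z).
  rewrite minjD minjZ hc /z.
  by lin R[i] (multiplier A); field.
exact: (idealZ (prim_ideal_ideal _)).
Qed.

Section base_map.
Variables (R : realType) (A : cstarAlgType R) (X : topologicalType).
Variables (phi : prim A -> X) (phibar : prim (multiplier A) -> stone_cech R X).
Hypotheses (hphi : C0X_algebra phi) (hphibar : multiplier_extension phi phibar).
Local Notation M := (multiplier A).
Local Notation e := (mone A).
Local Notation tosc := (to_stone_cech R).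
Let uc := multiplier_ucstar A.
Let hsdf : hausdorff_space X. Proof. by case: hphi. Qed.
Let lcpt : locally_compact [set: X]. Proof. by case: hphi. Qed.
Let phic : continuous phi. Proof. by case: hphi. Qed.
Implicit Types (P : prim A) (Q : prim M) (a b : A) (m : M) (x y : X) (eps : R).
Implicit Types (S : set (prim A)).

Lemma phibar_ptilde P : phibar (ptilde P) = tosc (phi P).
Proof. by apply: hphibar.2; exact: ptildeE. Qed.

(** The last hypothesis puts [Q] in the closure of the points [ptilde P] with [P] in [S]. Points of
    the compactification are families of values, so [phibar] is controlled one coordinate [f] at a
    time. *)
Lemma phibar_closure S Q (f : @unit_fun R X) (C : set R) : closed C ->
  (forall P, S P -> C (sval f (phi P))) ->
  (forall m, (forall P, S P -> (ptilde P : set M) m) -> (Q : set M) m) ->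
  C ((sval (phibar Q) : unit_fun -> R) f).
Proof.
move=> cC SC SQ.
pose g Q : R := (sval (phibar Q) : unit_fun -> R) f.
have cg : continuous g.
  move=> z; apply: (@continuous_comp _ _ _ phibar
    (fun z : stone_cech R X => (sval z : unit_fun -> R) f)); first exact: hphibar.1.
  exact: stone_cech_eval_continuous.
have clC : closed (g @^-1` C) by apply: preimage_closed => // z _; exact: cg.
apply: clC; apply: (@closureS _ (@ptilde R A @` S)).
  by move=> _ [P SP <-]; rewrite /g /= phibar_ptilde; exact: SC.
by apply/prim_closureP => m h; apply: SQ => P SP; apply: h; exists P.
Qed.

Lemma phibar_in_closure S Q x : phibar Q = tosc x ->
  (forall m, (forall P, S P -> (ptilde P : set M) m) -> (Q : set M) m) ->
  closure (phi @` S) x.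
Proof.
move=> Qx SQ; apply: contrapT => nclx.
have nN : nbhs x (~` closure (phi @` S)).
  apply: open_nbhs_nbhs; split=> //; exact/closed_openC/closed_closure.
have [f [fx f1]] := bump R hsdf lcpt nN.
have : [set (1 : R)] ((sval (phibar Q) : unit_fun -> R) f).
  apply: (phibar_closure _ _ SQ).
    exact/accessible_closed_set1/hausdorff_accessible/norm_hausdorff.
  by move=> P SP; apply: f1 => h; apply: h; apply: subset_closure; exists P.
by rewrite Qx /= => fx1; move: fx; rewrite [sval f x]fx1 => /eqP; rewrite oner_eq0.
Qed.

Lemma phibar_limit Q x :
  (forall N, nbhs x N -> exists S, S `<=` phi @^-1` N /\
    forall m, (forall P, S P -> (ptilde P : set M) m) -> (Q : set M) m) ->
  phibar Q = tosc x.
Proof.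
move=> h; apply: val_inj; apply/funext => f.
apply/eqP; rewrite -subr_eq0 -normr_le0; apply/ler_addgt0Pr => eps eps0; rewrite add0r.
pose C := [set r : R | `|r - sval f x| <= eps].
have cC : closed C.
  apply: (@preimage_closed _ _ (fun r : R => `|r - sval f x|) [set r | r <= eps]).
    by move=> r _; apply: cvg_norm; apply: cvgB; [exact: cvg_id|exact: cvg_cst].
  exact: closed_le.
have nN : nbhs x (sval f @^-1` C).
  have := (proj2_sig f).1 x; move=> /(_ C); apply.
  by apply/nbhs_ballP; exists eps => //= r; rewrite /ball /= /C /= distrC => /ltW.
have [S [SN SQ]] := h _ nN.
by apply: (phibar_closure cC _ SQ) => P /SN.
Qed.

(** [limit_primitive] is applied to the traces of [S] over the neighbourhoods of [x], directed by
    intersection; [phibar_limit] then places [Q] over [x]. *)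
Lemma limit_fiber S (b : M) eps x : 0 < eps -> closure (phi @` S) x ->
  (forall P, S P -> far eps P b) ->
  exists Q, [/\ ~ (Q : set M) b, phibar Q = tosc x &
    forall m, (exists2 N, nbhs x N & forall P, S P -> N (phi P) -> (ptilde P : set M) m) ->
      (Q : set M) m].
Proof.
move=> eps0 clx Sfar.
pose T (i : {N : set X | nbhs x N}) := [set P | S P /\ sval i (phi P)].
have [| | |Q [Qb QT]] := @limit_primitive R A _ (exist _ setT filterT) T b eps eps0.
- move=> [N1 n1] [N2 n2]; exists (exist _ (N1 `&` N2) (filterI n1 n2)).
  by move=> P /= [SP [h1 h2]].
- by move=> [N nN] /=; have [_ [[P SP <-] NP]] := clx _ nN; exists P.
- by move=> P k [i [SP _]]; exact: Sfar.
exists Q; split=> // [|m [N nN Nm]].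
  apply: phibar_limit => N nN; exists (T (exist _ N nN)); split; first by move=> P [].
  exact: QT.
by apply: (QT (exist _ N nN)) => P /= [SP NP]; exact: Nm.
Qed.

Lemma strictly_closed_lim (T : set M) (u : nat -> M) m : strictly_closed T ->
  (forall n, T (u n)) ->
  (forall a, hlim (fun n => mul_l (u n) a) (mul_l m a) /\
    hlim (fun n => mul_r a (u n)) (mul_r a m)) -> T m.
Proof.
move=> cT Tu um; apply: cT => U [V [[W oW <-] Wm WU]].
have cv : {ptws, (strict_maps \o u) @ \oo --> (strict_maps m : A -> A * A)}.
  apply/pointwise_cvgP => a /=.
  have [ll lr] := um a.
  have hcvg (v : nat -> A) l : hlim v l -> v @ \oo --> l.
    move=> vl V' /hnorm_nbhs[eps eps0 hV]; have [i0 hi] := vl _ eps0.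
    by exists i0 => // i /= i0i; apply: hV; rewrite hnormC; exact: hi.
  by apply: cvg_pair; exact: hcvg.
have [|n0 _ hn] := cv W; first by apply: open_nbhs_nbhs.
by exists (u n0); split=> //; apply: WU; exact: (hn n0 (leqnn _)).
Qed.

Lemma prim_closed_norm P : closed (P : set A).
Proof.
move=> a /hnorm_closure cla; apply/ptilde_minj.
have /boolp.choice[u hu] : forall n : nat, exists b, (P : set A) b /\ hnorm (a - b) <= n.+1%:R^-1.
  by move=> n; have [|b Pb hb] := cla n.+1%:R^-1; [rewrite invr_gt0|exists b].
apply: (prim_closed uc (u := fun n => minj (u n))).
  by move=> n; apply/ptilde_minj; exact: (hu n).1.
move=> eps eps0; have [n0 hn] := inv_nat_small eps0; exists n0 => n n0n.
by rewrite -minjB mnorm_minj hnormC; apply: le_trans (hn _ n0n); exact: (hu n).2.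
Qed.

(* The multipliers vanishing along the fibre of [x], that is, the ideal written
   J_x with a tilde: it is always strictly closed and contains [H_ phibar x]. *)
Definition fibre_tilde x : set M := [set m | forall P, phi P = x -> (ptilde P : set M) m].

Lemma fibre_tilde_ideal x : ideal (fibre_tilde x).
Proof.
have iP P := prim_ideal_ideal (ptilde P).
split=> [P _|k m hk hm P Px|k m hm P Px|k m hm P Px|k m hk P Px].
- exact: (ideal0 (iP P)).
- by apply: (idealD (iP P)); [exact: hk|exact: hm].
- by apply: (idealZ (iP P)); exact: hm.
- by apply: (idealMl (iP P)); exact: hm.
- by apply: (idealMr (iP P)); exact: hk.
Qed.

Lemma fibre_tilde_strictly_closed x : strictly_closed (fibre_tilde x).
Proof.
have cl (a : A) : continuous (mul_l^~ a : initial_topology strict_maps -> A).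
  move=> m; apply: (@continuous_comp (initial_topology strict_maps) {ptws A -> (A * A)%type} A
    strict_maps (fun g => (g a).1)); first exact: initial_continuous.
  apply: (@continuous_comp {ptws A -> (A * A)%type} (A * A)%type A (fun g => g a) fst).
    exact: (@proj_continuous _ (fun=> (A * A)%type) a).
  exact: cvg_fst.
have cr (a : A) : continuous (mul_r a : initial_topology strict_maps -> A).
  move=> m; apply: (@continuous_comp (initial_topology strict_maps) {ptws A -> (A * A)%type} A
    strict_maps (fun g => (g a).2)); first exact: initial_continuous.
  apply: (@continuous_comp {ptws A -> (A * A)%type} (A * A)%type A (fun g => g a) snd).
    exact: (@proj_continuous _ (fun=> (A * A)%type) a).
  exact: cvg_snd.
have -> : fibre_tilde x = \bigcap_(Pa in [set Pa : prim A * A | phi Pa.1 = x])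
    ((mul_l^~ Pa.2 @^-1` (Pa.1 : set A)) `&` (mul_r Pa.2 @^-1` (Pa.1 : set A))).
  apply/seteqP; split=> m /= h.
    by move=> [P a] /= /h; rewrite ptildeE => /(_ a).
  by move=> P Px; rewrite ptildeE => a; exact: (h (P, a) Px).
apply: closed_bigI => -[P a] _ /=; apply: closedI.
  by apply: preimage_closed; [move=> m _; exact: cl|exact: prim_closed_norm].
by apply: preimage_closed; [move=> m _; exact: cr|exact: prim_closed_norm].
Qed.

Lemma H_fibre_tilde x : H_ phibar x `<=` fibre_tilde x.
Proof. by move=> m hm P Px; apply: hm; rewrite /= phibar_ptilde Px. Qed.

(** An element of [A] outside [Q] brings [Q] back to a point of [prim A], and injectivity of [X]
    into its compactification puts that point over [x]. *)
Lemma restrict_fibre Q x a : phibar Q = tosc x -> ~ (Q : set M) (minj a) ->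
  exists2 P, (Q : set M) = ptilde P & phi P = x.
Proof.
move=> Qx Qa; have [P QP] := restrict_primitive Qa.
exists P; first by rewrite ptildeE.
by apply: (@to_stone_cech_inj R X hsdf lcpt); rewrite -Qx (hphibar.2 _ _ QP).
Qed.

Lemma fibre_tilde_minj_H x m a : fibre_tilde x m -> H_ phibar x (m ** minj a).
Proof.
move=> mx Q Qx; apply: contrapT => nQ.
have [|P QP Px] := @restrict_fibre Q x (mul_l m a) Qx; first by rewrite -minj_mul_l.
by apply: nQ; rewrite QP; apply: (idealMr (prim_ideal_ideal _)); exact: mx.
Qed.

(** [k z y] lies in every [ptilde P], through [k] or through [y], hence is zero, and primeness of
    [Q] concludes. So [Q] is adherent to the set of [P] whose [ptilde P] misses [y]. *)
Lemma bigcap_open_ptilde (y k : M) Q : ~ (Q : set M) y ->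
  (forall P, ~ (ptilde P : set M) y -> (ptilde P : set M) k) -> (Q : set M) k.
Proof.
move=> Qy h; have [z|//|//] := @primitive_prime _ _ Q k y (prim_primitive Q).
rewrite (@bigcap_ptilde R A (k ** z ** y)).
  exact: (ideal0 (prim_ideal_ideal Q)).
move=> P; have iP := prim_ideal_ideal (ptilde P).
have [Py|Py] := pselect ((ptilde P : set M) y); first exact: (idealMl iP).
by apply/(idealMr iP)/(idealMr iP); exact: h.
Qed.

Lemma fibre_tilde_H_modular x : locally_modular phi x -> locally_closed_at phi x ->
  fibre_tilde x `<=` H_ phibar x.
Proof.
move=> lm lc m mx Q Qx; apply: contrapT => Qm.
have [c [eps [y [eps0 Qy peakS]]]] := peak uc Qm.
pose m1 := c%:C *: (star m ** m).
have m1x : fibre_tilde x m1.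
  by apply: (idealZ (fibre_tilde_ideal x)); exact: (idealMl (fibre_tilde_ideal x)).
pose S := [set P | ~ (ptilde P : set M) y].
have Sfar P : S P -> far eps P m1 by move=> SP k; exact: peakS.
have Snx P : S P -> phi P <> x.
  move=> SP Px; have := Sfar _ SP m1 (m1x P Px).
  by rewrite subrr (N0 uc); lra.
have clx : closure (phi @` S) x.
  by apply: (phibar_in_closure Qx) => k; exact: bigcap_open_ptilde.
have [P0 SP0 P0x] : (phi @` closure S) x.
  apply: lc; first exact: closed_closure.
  by apply: closureS clx => _ [P SP <-]; exists P => //; exact: subset_closure.
pose Hx := phi @^-1` [set x].
have SU P : S P -> ~ Hx° P by move=> SP /interior_subset; exact: Snx.
(* [P0] is on the fibre but not in its interior, being adherent to [S], which avoids the fibre. *)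
have P0U : (closure Hx `\` Hx°) P0.
  split; first by apply: subset_closure; rewrite /Hx /= P0x.
  by move=> /SP0 [P [SP /Snx]].
have [W [oW [WP0 _] [eA unit]]] := lm P0 P0U.
pose S' := S `&` W.
have clx' : closure (phi @` S') x.
  rewrite -P0x => N nN.
  have nNW : nbhs P0 (phi @^-1` N `&` W).
    by apply: filterI; [exact: phic|apply: open_nbhs_nbhs].
  have [P [SP [NP WP]]] := SP0 _ nNW.
  by exists (phi P); split=> //; exists P.
(* Off the interior of the fibre [eA] is a unit on [W], so [b] agrees there with [m1] modulo
   [ptilde P]. Being in [A], it is decided on the fibre, where [m1] vanishes. *)
pose b := m1 ** minj eA.
have S'far P : S' P -> far eps P b.
  move=> [SP WP] k Pk; have iP := prim_ideal_ideal (ptilde P).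
  have Pe : (ptilde P : set M) (e - minj eA).
    rewrite ptildeE => a; have WU : (W `\` Hx°) P by split=> //; exact: SU.
    have [/(_ P WU) h1 /(_ P WU) h2] := unit a.
    rewrite mul_l_sub mul_r_sub mul_l_one mul_r_one mul_l_minj mul_r_minj.
    by rewrite -!(opprB _ a); split; exact: (idealN (prim_ideal_ideal P)).
  have -> : b - k = m1 - (m1 ** (e - minj eA) + k).
    by rewrite amulDr salgNr (uc1r uc) -/b opprD opprB addrA addrCA subrr addr0.
  exact: (Sfar _ SP _ (idealD iP (idealMl iP _ Pe) Pk)).
have [Q' [Q'b Q'x _]] := limit_fiber eps0 clx' S'far.
by apply: Q'b; exact: (fibre_tilde_minj_H _ m1x Q'x).
Qed.

Lemma H_strictly_closed x : locally_modular phi x -> locally_closed_at phi x ->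
  strictly_closed (H_ phibar x).
Proof.
move=> lm lc; have -> : H_ phibar x = fibre_tilde x.
  by apply/seteqP; split; [exact: H_fibre_tilde|exact: fibre_tilde_H_modular].
exact: fibre_tilde_strictly_closed.
Qed.

Lemma fibre_tilde_H x : sigma_unital A -> strictly_closed (H_ phibar x) ->
  fibre_tilde x `<=` H_ phibar x.
Proof.
move=> [u [_ _ ul ur]] cH m mx.
apply: (strictly_closed_lim cH (u := fun n => m ** minj (u n))).
  by move=> n; exact: fibre_tilde_minj_H.
move=> a; split=> eps eps0; last first.
  have [i0 hi] := cvg_hlim (ur (mul_r a m)) eps0; exists i0 => i /hi.
  by rewrite mul_r_mul mul_r_minj.
have m1 : 0 < mnorm m + 1 by have := mnorm_ge0 m; lra.
have [i0 hi] := cvg_hlim (ul a) (divr_gt0 eps0 m1); exists i0 => i /hi h.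
rewrite mul_l_mul mul_l_minj -mul_lB; apply: le_trans (le_mnorm _ _) _.
move: h; rewrite ler_pdivlMr//; have := hnorm_ge0 (u i ** a - a); nra.
Qed.

Lemma fibre_closed x : closed (phi @^-1` [set x]).
Proof.
apply: preimage_closed; first by move=> z _; exact: phic.
exact/accessible_closed_set1/hausdorff_accessible.
Qed.

Lemma base_separated x N : open N -> N x -> forall P,
  closure (phi @^-1` [set x]) P -> closure (phi @^-1` (~` N)) P -> False.
Proof.
move=> oN Nx P.
have cN : closed (phi @^-1` (~` N)).
  by apply: preimage_closed; [move=> z _; exact: phic|exact: open_closedC].
by move=> /(@fibre_closed x) /= Px /cN; apply; rewrite Px.
Qed.

(** * From (i) to (ii) along an approximate unit *)

Section sigma_unital_base.
Variable u : nat -> A.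
Hypotheses (pu : forall n, pos (minj (u n))) (peu : forall n, pos (e - minj (u n))).
Hypothesis du : forall n, exists b, u n.+1 - u n = star b ** b.
Hypothesis ulim : forall a, hlim (fun n => u n ** a) a.

(* [m] is the strict sum of elements [b n* g b n], where the increments of the
   approximate unit are [b n* b n] and [1 - g] annihilates [b n] outside [N n] up
   to an error [2 ^- (n + 3)], while [g] vanishes along the fibre of [x]. *)
Lemma minorant x (N : nat -> set X) : (forall n, open (N n)) -> (forall n, N n x) ->
  (forall n, N n.+1 `<=` N n) -> exists2 m, fibre_tilde x m &
    forall k P, ~ N k (phi P) -> ge0_at P (m + ((4^-1)%:C *: e + (minj (u k) - e))).
Proof.
move=> oN Nx Ndec; have [b hb] := boolp.choice du.
(* These errors sum to 1/4, the constant of the conclusion. *)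
pose eps (n : nat) : R := 2^-1 ^+ n / 8.
have eps0 n : 0 < eps n by rewrite divr_gt0// exprn_gt0// invr_gt0.
have /boolp.choice[D hD] := fun n => split_conj (b n) (base_separated (oN n) (Nx n)) (eps0 n).
pose U n := minj (u n).
have UE n : U n.+1 - U n = minj (star (b n) ** b n) by rewrite -hb minjB.
pose s n := \sum_(i < n) D i.
have pD n : pos (D n) by have [] := hD n.
have pUD n : pos (U n.+1 - U n - D n) by have [_] := hD n; rewrite UE.
have cU a : hcauchy (fun n => mul_l (U n) a).
  move=> del del0; have d2 : 0 < del / 2 by lra.
  have [i0 hi] := ulim a d2; exists i0 => i j i0i i0j.
  have := hnorm_triangle (u i ** a) a (u j ** a); have := hi _ i0i; have := hi _ i0j.
  rewrite (hnormC a) !mul_l_minj; set t1 := hnorm _; set t2 := hnorm _; set t3 := hnorm _; lra.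
have [m hm] := strict_series pD pUD pu peu cU.
have sx n : fibre_tilde x (s n).
  rewrite /s; elim: n => [|n IH]; first by rewrite big_ord0; exact: ideal0 (fibre_tilde_ideal x).
  rewrite big_ord_recr /=; apply: (idealD (fibre_tilde_ideal x)) => // P Px.
  by have [_ _ h _] := hD n; exact: h.
exists m => [|k P kP].
  exact: (strictly_closed_lim (@fibre_tilde_strictly_closed x) sx hm).
have Nl n : (k <= n)%N -> ~ N n (phi P).
  move=> kn; apply: contra_not kP; elim: n kn => [|n IH]; first by rewrite leqn0 => /eqP ->.
  rewrite leq_eqVlt => /orP[/eqP ->//|]; rewrite ltnS => kn /Ndec; exact: IH.
have iP := prim_ideal_ideal (ptilde P).
have bound l : (k <= l)%N -> exists2 q, (ptilde P : set M) q &
    mnorm (U l - U k - (s l - s k) - q) <= 4^-1 * (1 - 2^-1 ^+ l).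
  elim: l => [|l IH].
    rewrite leqn0 => /eqP ->; exists 0; first exact: ideal0 iP.
    by rewrite !subrr (N0 uc) mulr0.
  rewrite leq_eqVlt => /orP[/eqP <-|].
    exists 0; first exact: ideal0 iP.
    rewrite !subrr (N0 uc) mulr_ge0 ?invr_ge0// subr_ge0 exprn_ile1// ?invr_ge0//.
    by rewrite invf_le1 ?ler1n.
  rewrite ltnS => kl; have [q Pq hq] := IH kl.
  have [_ _ _ h] := hD l; have [q' Pq' hq'] := h P (Nl _ kl).
  exists (q + q'); first exact: (idealD iP).
  have -> : U l.+1 - U k - (s l.+1 - s k) - (q + q') =
      (U l - U k - (s l - s k) - q) + (minj (star (b l) ** b l) - D l - q').
    rewrite -UE /s big_ord_recr /= -/(s l).
    lin R[i] (multiplier A).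
  apply: le_trans (ucD uc _ _) _; apply: le_trans (lerD hq hq') _.
  by rewrite /eps exprS; set t := _ ^+ l; lra.
(* [U l] tends strictly to the unit, so the claim is the limit of [s l + 1/4 + U k - U l]. Modulo
   [ptilde P] this is [s k >= 0] plus a term kept nonnegative by [bound]. *)
apply: (@ge0_at_strict_lim _ _ P (fun l => s l + ((4^-1)%:C *: e + (U k - U l))) _ k).
  move=> l kl; have [q Pq hq] := bound l kl.
  have hq' : mnorm (- (U l - U k - (s l - s k) - q)) <= 4^-1.
    rewrite (NN uc); apply: le_trans hq _.
    have : 0 <= (2^-1 : R) ^+ l by rewrite exprn_ge0// invr_ge0.
    lra.
  have h1 : ge0_at P (s k + ((4^-1)%:C *: e - (U l - U k - (s l - s k) - q))).
    apply: ge0_atD; last exact: ge0_at_N.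
    apply: ge0_at_pos; have [p1 _] := partial_sum_pos pD pUD (leq0n k).
    by rewrite /s big_ord0 subr0 in p1.
  apply: (ge0_at_eq h1).
  have -> : s l + ((4^-1)%:C *: e + (U k - U l)) -
      (s k + ((4^-1)%:C *: e - (U l - U k - (s l - s k) - q))) = - q.
    lin R[i] (multiplier A).
  exact: (idealN iP).
move=> a del del0; have d2 : 0 < del / 2 by lra.
have [i1 h1] := (hm a).1 _ d2; have [i2 h2] := ulim a d2.
exists (maxn i1 i2) => i; rewrite geq_max => /andP[/h1 {}h1 /h2 {}h2].
have -> : mul_l (s i + ((4^-1)%:C *: e + (U k - U i))) a -
    mul_l (m + ((4^-1)%:C *: e + (minj (u k) - e))) a =
    (mul_l (s i) a - mul_l m a) - (u i ** a - a).
  have E (h v : M) : mul_l (h + ((4^-1)%:C *: e + (U k - v))) a =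
    mul_l h a + ((4^-1)%:C *: a + (u k ** a - mul_l v a)) by [].
  rewrite !E mul_l_minj mul_l_one.
  rewrite opprD addrACA; congr (_ + _).
  by rewrite opprD addrACA subrr add0r opprD addrACA subrr add0r opprK opprB addrC.
have := hnormD (mul_l (s i) a - mul_l m a) (- (u i ** a - a)).
rewrite hnormN; move: h1 h2; rewrite -/(s i); set t1 := hnorm _; set t2 := hnorm _; lra.
Qed.

(** If [m] were within 1/4 of [ptilde P], the hypothesis would give [u k >= 1 - 1/4 - 1/4 = 1/2] at
    [P]. *)
Lemma far_minorant P m (k : nat) :
  ge0_at P (m + ((4^-1)%:C *: e + (minj (u k) - e))) ->
  ~ ge0_at P (minj (u k) - (2^-1)%:C *: e) -> far 4^-1 P m.
Proof.
move=> h hk q Pq; rewrite leNgt; apply/negP => /ltW lt; apply: hk.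
have lt' : mnorm (- (m - q)) <= 4^-1 by rewrite (NN uc).
apply: (ge0_at_eq (ge0_atD h (ge0_at_N (P:=P) lt'))).
have -> : minj (u k) - (2^-1)%:C *: e -
    (m + ((4^-1)%:C *: e + (minj (u k) - e)) + ((4^-1)%:C *: e + - (m - q))) = - q.
  have -> : (2^-1)%:C = 1 - (4^-1)%:C - (4^-1)%:C :> R[i].
    by rewrite -(rmorph1 (real_complex R)) -!rmorphB; congr (_ %:C); field.
  lin R[i] (multiplier A).
exact: (idealN (prim_ideal_ideal _)).
Qed.

(** At [P] the element [u k] is at most 1/4, so [u k >= 1/2] would make [- 1/4] nonnegative
    there. *)
Lemma small_not_half P (k : nat) q : (ptilde P : set M) q -> mnorm (minj (u k) - q) <= 4^-1 ->
  ~ ge0_at P (minj (u k) - (2^-1)%:C *: e).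
Proof.
move=> Pq hq h; apply: (@ge0_at_Nneg _ _ P 4^-1); first by rewrite invr_gt0.
have hq' : mnorm (- (minj (u k) - q)) <= 4^-1 by rewrite (NN uc).
apply: (ge0_at_eq (ge0_atD h (ge0_at_N (P:=P) hq'))).
have -> : - ((4^-1)%:C *: e) - (minj (u k) - (2^-1)%:C *: e +
    ((4^-1)%:C *: e + - (minj (u k) - q))) = - q.
  have -> : (2^-1)%:C = (4^-1)%:C + (4^-1)%:C :> R[i].
    by rewrite -rmorphD; congr (_ %:C); field.
  lin R[i] (multiplier A).
exact: (idealN (prim_ideal_ideal _)).
Qed.

(* Up to [del / 2], [a = j + i] with [j] in the primitive ideals over [x] and
   [i] in those of [Y]; were [j] large at points of [Y] arbitrarily near [x], a
   limit point over [x] would not contain it. *)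
Lemma small_near x (Y : set (prim A)) a (del : R) : closed Y -> ~ (phi @` Y) x -> 0 < del ->
  exists2 N, nbhs x N & forall P, Y P -> N (phi P) ->
    exists2 q, (ptilde P : set M) q & mnorm (minj a - q) <= del.
Proof.
move=> cY Yx del0; apply: contrapT => nex.
have disj P : closure (phi @^-1` [set x]) P -> closure Y P -> False.
  by move=> /(@fibre_closed x) Px /cY YP; apply: Yx; exists P.
have d2 : 0 < del / 2 by lra.
have [j [i [hj hi hr]]] := separated_dense disj a d2.
pose S := [set P | Y P /\ far del P (minj a)].
have clx : closure (phi @` S) x.
  move=> N nN; apply: contrapT => nS; apply: nex; exists N => // P YP NP.
  apply: contrapT => nq; apply: nS; exists (phi P); split=> //; exists P => //.
  split=> // k Pk; rewrite leNgt; apply/negP => lt.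
  by apply: nq; exists k => //; exact: ltW.
have Sfar P : S P -> far (del / 2) P (minj j).
  move=> [YP fP] k Pk.
  have Pik : (ptilde P : set M) (minj i + k).
    by apply: (idealD (prim_ideal_ideal _)) => //; apply/ptilde_minj; exact: hi.
  have := fP _ Pik.
  have -> : minj a - (minj i + k) = (minj j - k) + minj (a - (j + i)).
    by rewrite minjB minjD; lin R[i] (multiplier A).
  have := ucD uc (minj j - k) (minj (a - (j + i))); rewrite mnorm_minj.
  set t1 := mnorm _; set t2 := mnorm _; set t3 := hnorm _ in hr *; lra.
have [Q [Qj Qx _]] := limit_fiber d2 clx Sfar.
have [P QP Px] := restrict_fibre Qx Qj.
by apply: Qj; rewrite QP; apply/ptilde_minj; exact: hj.
Qed.

(** The neighbourhoods are chosen so that [u (n + 1)] is at most 1/4 on the part of [Y] over [N n].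
    A point of [Y] over [N 0] leaves the decreasing sequence between some [N n] and [N (n + 1)];
    there [u (n + 1)] is small while [m + 1/4 >= 1 - u (n + 1)], so [m] is far from [ptilde P]. *)
Lemma fibre_locally_closed x : fibre_tilde x `<=` H_ phibar x -> locally_closed_at phi x.
Proof.
move=> HJ Y cY clx; apply: contrapT => Yx.
have q0 : 0 < 4^-1 :> R by rewrite invr_gt0.
have /boolp.choice[N' hN'] : forall n : nat, exists N, nbhs x N /\ forall P, Y P -> N (phi P) ->
    exists2 q, (ptilde P : set M) q & mnorm (minj (u n.+1) - q) <= 4^-1.
  by move=> n; have [N nN h] := small_near (u n.+1) cY Yx q0; exists N.
pose N := fix N n := if n is n'.+1 then N n' `&` (N' n)° else (N' 0%N)°.
have oN n : open (N n).
  by elim: n => [|n IH] /=; [|apply: openI => //]; exact: open_interior.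
have Nx n : N n x.
  have NN' k : (N' k)° x by exact: (nbhs_singleton (nbhs_interior (hN' k).1)).
  by elim: n => [|n IH] /=; [|split=> //]; exact: NN'.
have Ndec n : N n.+1 `<=` N n by move=> z [].
have NN' n : N n `<=` N' n by case: n => [|n] z /= => [|[_]]; exact: interior_subset.
have [m mx hm] := minorant oN Nx Ndec.
pose S := [set P | Y P /\ N 0%N (phi P)].
have clS : closure (phi @` S) x.
  move=> V nV; have nV0 : nbhs x (V `&` N 0%N).
    by apply: filterI => //; apply: open_nbhs_nbhs; split=> //; exact: oN.
  by have [_ [[P YP <-] [VP NP]]] := clx _ nV0; exists (phi P); split=> //; exists P.
have Sfar P : S P -> far 4^-1 P m.
  move=> [YP NP].
  have half n : N n (phi P) -> ~ ge0_at P (minj (u n.+1) - (2^-1)%:C *: e).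
    by move=> /NN' /((hN' n).2 P YP)[q Pq hq]; exact: small_not_half hq.
  (* A point over all the [N n] would have [u (l + 1) <= 1/4] for every [l], and the strict limit
     would give [1/4 - 1 >= 0]. The limit starts at index 1 because the choice of the [N n] does not
     control [u 0]. *)
  have [n [Nn Nn1]] : exists n, N n (phi P) /\ ~ N n.+1 (phi P).
    apply: contrapT => nex.
    have Nall n : N n (phi P).
      elim: n => [//|n IH]; apply: contrapT => Nn1; apply: nex; exists n; split=> //.
    apply: (@ge0_at_Nneg _ _ P (1 - 4^-1)); first by rewrite subr_gt0 invf_lt1// ltr1n.
    apply: (@ge0_at_strict_lim _ _ P (fun l => (4^-1)%:C *: e - minj (u l)) _ 1).
      move=> [//|l] _; have [q Pq hq] := (hN' l).2 P YP (NN' _ _ (Nall l)).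
      have hq' : mnorm (- (minj (u l.+1) - q)) <= 4^-1 by rewrite (NN uc).
      apply: (ge0_at_eq (ge0_at_N (P:=P) hq')); rewrite opprD addrACA subrr add0r opprK addKr.
      exact: (idealN (prim_ideal_ideal _)).
    move=> a del del0; have [i0 hi] := ulim a del0; exists i0 => i /hi.
    have -> : mul_l ((4^-1)%:C *: e - minj (u i)) a - mul_l (- ((1 - 4^-1)%:C *: e)) a =
        - (u i ** a - a).
      have -> : mul_l ((4^-1)%:C *: e - minj (u i)) a = (4^-1)%:C *: a - u i ** a by [].
      have -> : mul_l (- ((1 - 4^-1)%:C *: e)) a = - ((1 - 4^-1)%:C *: a) by [].
      by rewrite rmorphB rmorph1 scalerBl scale1r opprK addrC addrA subrK opprB.
    by rewrite hnormN.
  exact: far_minorant (hm _ _ Nn1) (half _ Nn).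
have [Q [Qm Qx _]] := limit_fiber q0 clS Sfar.
by apply: Qm; exact: (HJ _ mx).
Qed.

(** Otherwise [u n >= 1/2] at all points of [W] off the fibre, and [unit_of_half] yields one [eA]
    that is a unit modulo all of them. Points of [W] outside the interior of the fibre are adherent
    to these, so [eA] would be a unit of the excluded quotient. *)
Lemma not_half_near x P0 : closure (phi @^-1` [set x]) P0 -> ~ (phi @^-1` [set x])° P0 ->
  (forall W : set (prim A), open W -> (W `\` (phi @^-1` [set x])°) P0 ->
    ~ unital_quotient (kernel (W `\` (phi @^-1` [set x])°))) ->
  forall (W : set (prim A)) (n : nat), open W -> W P0 ->
    exists P, [/\ W P, phi P <> x & ~ ge0_at P (minj (u n) - (2^-1)%:C *: e)].
Proof.
move=> P0x P0U nW W n oW WP0; apply: contrapT => nex; apply: (nW W) => //.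
have [eA heA] := unit_of_half (pu n) (peu n).
have unit P : W P -> phi P <> x -> forall a, (P : set A) (eA ** a - a) /\ (P : set A) (a ** eA - a).
  move=> WP Px; have : (ptilde P : set M) (e - minj eA).
    by apply: heA; apply: contrapT => hP; apply: nex; exists P.
  rewrite ptildeE => h a; have [h1 h2] := h a.
  rewrite -!(opprB a); split; exact: (idealN (prim_ideal_ideal P)).
have cl P : (W `\` (phi @^-1` [set x])°) P -> closure [set P | W P /\ phi P <> x] P.
  move=> [WP PU] V nV; apply: contrapT => nVW; apply: PU.
  have nVW' : nbhs P (V `&` W) by apply: filterI => //; exact: open_nbhs_nbhs.
  apply: filterS nVW' => P' [VP' WP'] /=; apply: contrapT => P'x.
  by apply: nVW; exists P'.
by exists eA => a; split=> P /cl /prim_closureP; apply=> P' [WP' P'x];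
  have [] := unit P' WP' P'x a.
Qed.

(* Otherwise points [p k] approach the fibre of [x], with [u k.+1] not at least
   1/2 and [a1] not small at [p k]. By the latter they accumulate at the extension
   of some [P] in [prim A], and [minorant] at [phi P] is far from all [p k]. *)
Lemma fibre_locally_modular x : (forall y, range phi y -> fibre_tilde y `<=` H_ phibar y) ->
  locally_modular phi x.
Proof.
move=> HJ Hx U P0 [clP0 P0U]; apply: contrapT => nex.
have P0x : phi P0 = x by exact: (@fibre_closed x).
have q0 : 0 < 4^-1 :> R by rewrite invr_gt0.
have near_P0 := not_half_near clP0 P0U (fun W oW WP uW => nex (ex_intro _ W (And3 oW WP uW))).
have [a P0a] := prim_proper P0.
have [|c [eps [y [eps0 P0y farO]]]] := peak uc (Q := ptilde P0) (m := minj a).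
  by move/ptilde_minj.
pose a1 := c%:C *: (star a ** a).
have a1E : minj a1 = c%:C *: (star (minj a) ** minj a) by rewrite minjZ minjM minj_star.
pose O := [set P | ~ (ptilde P : set M) y].
have Ofar P : O P -> far eps P (minj a1) by move=> OP k; rewrite a1E; exact: farO.
have reg := @completely_regular_regular R X (@locally_compact_completely_regular X R lcpt hsdf).
(* The new neighbourhood has its closure inside the old one and away from [phi (p k)]. The first
   puts the limit point over every [N k]; the second leaves [p k] outside [N (k + 1)], so that
   [minorant] applies with index [k + 1], the index at which [u] is not at least 1/2. *)
have step (kN : nat * set X) : exists PN : prim A * set X, open kN.2 -> kN.2 x ->
    [/\ O PN.1, kN.2 (phi PN.1), ~ ge0_at PN.1 (minj (u kN.1.+1) - (2^-1)%:C *: e),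
      open PN.2 /\ PN.2 x & closure PN.2 `<=` kN.2 `&` [set~ phi PN.1]].
  case: kN => k N /=; have [[oN Nx]|nN] := pselect (open N /\ N x); last first.
    by exists (P0, N) => oN Nx; case: nN.
  have oW : open (O `&` phi @^-1` N).
    apply: openI; first exact: open_ptilde_notin.
    by apply: open_comp => // z _; exact: phic.
  have [|P [[OP NP] Px hP]] := near_P0 _ k.+1 oW; first by split=> //; rewrite /= P0x.
  have nx : nbhs x (N `&` [set~ phi P]).
    apply: open_nbhs_nbhs; split; last by split=> //= /esym.
    apply: openI => //; apply: closed_openC.
    exact/accessible_closed_set1/hausdorff_accessible.
  have [B nB clB] := reg x _ nx.
  exists (P, B°) => _ _; split=> //.
    by split; [exact: open_interior|exact: (nbhs_singleton (nbhs_interior nB))].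
  by apply: subset_trans clB; apply: closureS; exact: interior_subset.
have [F hF] := boolp.choice step.
pose N := fix N k := if k is j.+1 then (F (j, N j)).2 else setT.
have oNx k : open (N k) /\ N k x.
  elim: k => [|k [oN Nx]] /=; first by split=> //; exact: openT.
  by have [_ _ _] := hF (k, N k) oN Nx.
pose p k := (F (k, N k)).1.
have hp k : [/\ O (p k), N k (phi (p k)), ~ ge0_at (p k) (minj (u k.+1) - (2^-1)%:C *: e) &
    closure (N k.+1) `<=` N k `&` [set~ phi (p k)]].
  by have [? ? ? _ ?] := hF (k, N k) (oNx k).1 (oNx k).2.
have Ndec k : N k.+1 `<=` N k.
  by have [_ _ _ h] := hp k; move=> z /subset_closure /h [].
have Nle k l : (k <= l)%N -> N l `<=` N k.
  elim: l => [|l IH]; first by rewrite leqn0 => /eqP ->.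
  rewrite leq_eqVlt => /orP[/eqP ->//|]; rewrite ltnS => /IH; apply: subset_trans.
  exact: Ndec.
pose T k := [set P | exists2 l : nat, (k <= l)%N & P = p l].
have [i j| | |Q [Qa1 QT]] := @limit_primitive R A nat 0%N T (minj a1) eps eps0.
- exists (maxn i j) => P [l]; rewrite geq_max => /andP[il jl] ->.
  by split; exists l.
- by move=> i; exists (p i), i.
- by move=> P k [i [l _ ->]]; apply: Ofar; have [] := hp l.
have [P QP] := restrict_primitive Qa1.
have clT k : closure (phi @` T k) (phi P).
  apply: (phibar_in_closure (hphibar.2 _ _ QP)) => m; exact: QT.
have NP k : N k (phi P).
  have [_ _ _ h] := hp k; apply: (h (phi P) _).1; apply: closureS (clT k.+1).
  by move=> _ [_ [l kl ->] <-]; apply: (Nle _ _ kl); have [] := hp l.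
(* The base point [phi P] may differ from [x], hence the hypothesis on all [y] in the image of
   [phi]. *)
have [m mx hm] := minorant (fun k => (oNx k).1) NP Ndec.
have Sfar P' : T 0%N P' -> far 4^-1 P' m.
  move=> [l _ ->]; have [_ _ h1 h2] := hp l; apply: (far_minorant _ h1); apply: hm.
  by move=> /subset_closure /h2 [_]; exact.
have [Q' [Q'm Q'x _]] := limit_fiber q0 (clT 0%N) Sfar.
by apply: Q'm; apply: (HJ (phi P) _ _ mx) => //; exists P.
Qed.

End sigma_unital_base.
End base_map.

Theorem corollary3p7 (R : realType) (A : cstarAlgType R) (X : topologicalType)
    (phi : prim A -> X) (phibar : prim (multiplier A) -> stone_cech R X)
    (hphi : C0X_algebra phi) (hphibar : multiplier_extension phi phibar) :
  let i := forall x, range phi x -> strictly_closed (H_ phibar x) in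
  let ii := forall x, range phi x ->
    locally_modular phi x /\ locally_closed_at phi x in
  (ii -> i) /\ (sigma_unital A -> (i <-> ii)).
Proof.
move=> i ii; have ii_i : ii -> i.
  by move=> h x /h [lm lc]; exact: (H_strictly_closed hphi hphibar).
split=> // su; split=> // hi x rx.
have [u [pu peu du ul]] := sigma_unitalP su.
have HJ y : range phi y -> fibre_tilde phi y `<=` H_ phibar y.
  by move=> /hi; exact: (fibre_tilde_H hphi hphibar).
split; first exact: (fibre_locally_modular hphi hphibar pu peu du ul HJ).
exact: (fibre_locally_closed hphi hphibar pu peu du ul (HJ x rx)).
Qed.
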